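(* Let $(\xi,\mathcal P)$ be an admissible score and input pair of class (A1) or (A2) such that the $p$-moment condition holds for all $p\in(1,\infty)$. Then the correlations of the $\xi$-weighted measures decay fast: there exist a fast decreasing function $\tilde\phi$ and constants $\tilde C_k<\infty$, $\tilde c_k>0$, $k\in\mathbb N$, such that for all $n\in\mathbb N\cup\{\infty\}$, all $p,q\in\mathbb N$, all positive integers $k_1,\ldots,k_{p+q}$ and all distinct $x_1,\ldots,x_{p+q}\in\mathbb R^d$, $$\Bigl|m^{(k_1,\ldots,k_{p+q})}(x_1,\ldots,x_{p+q};n)-m^{(k_1,\ldots,k_p)}(x_1,\ldots,x_p;n)\,m^{(k_{p+1},\ldots,k_{p+q})}(x_{p+1},\ldots,x_{p+q};n)\Bigr|\le\tilde C_K\,\tilde\phi(\tilde c_K s),$$ where $K:=\sum_{i=1}^{p+q}k_i$ and $s:=\min_{1\le i\le p<j\le p+q}|x_i-x_j|$.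
   Context: Point processes. Fix $d\ge2$. $\mathcal N$ is the space of locally finite subsets of $\mathbb R^d$ (identified with simple Radon counting measures, $\mathcal X(B)=\mathrm{card}(\mathcal X\cap B)$), with its canonical $\sigma$-algebra; a simple point process $\mathcal P$ is a random element of $\mathcal N$. $B_r(x)$ is the closed Euclidean ball, $B_r^c(x)$ its complement. $\mathcal X^{(k)}$ is the set of $k$-tuples of pairwise distinct points of $\mathcal X$. The $k$-th factorial moment measure is $\alpha^{(k)}(\cdot)=E[\mathrm{card}(\mathcal P^{(k)}\cap\cdot)]$ on $(\mathbb R^d)^k$; its Lebesgue density $\rho^{(k)}$ is the $k$-point correlation function (set to $0$ when two coordinates coincide). The Palm expectations $E_{x_1,\ldots,x_k}$ (probabilities $P_{x_1,\ldots,x_k}$) are determined $\alpha^{(k)}$-a.e. by $E\sum_{(x_1,\ldots,x_k)\in\mathcal P^{(k)}}f(x_1,\ldots,x_k;\mathcal P)=\int E_{x_1,\ldots,x_k}[f(x_1,\ldots,x_k;\mathcal P)]\,\alpha^{(k)}(dx_1\cdots dx_k)$ for measurable $f\ge0$. All expressions involving Palm measures or correlation functions are understood almost everywhere, and suprema are essential suprema. $\mathcal P$ is admissible if it is simple, stationary, has intensity $\rho^{(1)}(\mathbf 0)\in(0,\infty)$, and has correlation functions of all orders. $W_n:=[-\frac12n^{1/d},\frac12n^{1/d}]^d$, $\mathcal P_n:=\mathcal P\cap W_n$, $W_\infty:=\mathbb R^d$, $\mathcal P_\infty:=\mathcal P$. Fast decay. A fast decreasing function is a non-increasing $\phi:[0,\infty)\to[0,1]$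 with $\lim_{x\to\infty}x^m\phi(x)=0$ for all $m\ge1$. An admissible $\mathcal P$ has fast decay of correlations if there are constants $c_k>0$, $C_k<\infty$ (correlation decay constants) and a fast decreasing $\phi$ (correlation decay function) such that for all $p,q\in\mathbb N$ and $x_1,\ldots,x_{p+q}\in\mathbb R^d$, with $s:=\min_{i\le p<j}|x_i-x_j|$, $$|\rho^{(p+q)}(x_1,\ldots,x_{p+q})-\rho^{(p)}(x_1,\ldots,x_p)\rho^{(q)}(x_{p+1},\ldots,x_{p+q})|\le C_{p+q}\,\phi(c_{p+q}s).$$ Without loss of generality $c_k$ is non-increasing and $C_k\ge1$ is non-decreasing in $k$. Scores. A score function is $\xi:\mathbb R^d\times\mathcal N\to\mathbb R$, measurable in each coordinate, with $\xi(x,\mathcal X)=0$ if $x\notin\mathcal X$, and translation invariant: $\xi(\cdot+y,\cdot+y)=\xi(\cdot,\cdot)$. The radius of stabilization $R^\xi(x,\mathcal X)$, $x\in\mathcal X$, is the smallest $r\in\mathbb N$ with $\xi(x,\mathcal X\cap B_r(x))=\xi(x,(\mathcal X\cap B_r(x))\cup(\mathcal A\cap B_r^c(x)))$ for all locally finite $\mathcal A\subset\mathbb R^d$ ($\infty$ if none). $\xi$ is stabilizing on $\mathcal P$ if there are constants $a_l>0$ and $\varphi:[0,\infty)\to[0,1]$ with $\varphi(t)\downarrow0$ as $t\to\infty$, such that for all $l\in\mathbb N$, $t>0$: $\sup_{1\le n\le\infty}\sup_{x_1,\ldots,x_l\in W_n}P_{x_1,\ldots,x_l}(R^\xi(x_1,\mathcal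 P_n)>t)\le\varphi(a_lt)$. It is exponentially stabilizing if moreover $\limsup_{t\to\infty}t^{-c}\log\varphi(t)\in(-\infty,0)$ for some $c\in(0,\infty)$. Class (A1): $\mathcal P$ is admissible with fast decay of correlations and $\xi(x,\mathcal X)=\frac1{k!}\sum_{\mathbf x\in\mathcal X^{(k-1)}}h(x,\mathbf x)$ (for $x\in\mathcal X$) for some $k\in\mathbb N$ and symmetric translation-invariant $h:\mathbb R^d\times(\mathbb R^d)^{k-1}\to\mathbb R$ with $h(x_1,\ldots,x_k)=0$ whenever $\max_{2\le i\le k}|x_i-x_1|>r$ (for some given $r>0$) or $x_i=x_j$ for some $i\ne j$, and $\|h\|_\infty<\infty$ (for $k=1$, $\xi(x,\mathcal X)=h(x)$). Class (A2): $\mathcal P$ is admissible with fast decay of correlations with $c_k\equiv1$, $C_k=O(k^{ak})$ for some $a\in[0,1)$, and $\limsup_{t\to\infty}t^{-b}\log\phi(t)\in(-\infty,0)$ for some $b\in(0,\infty)$; $\xi$ is exponentially stabilizing on $\mathcal P$ and satisfies the power growth condition: there is $\hat c\in[1,\infty)$ such that for all $r\in(0,\infty)$ and $n$, $|\xi(x,\mathcal X\cap B_r(x))|\mathbf 1[\mathrm{card}(\mathcal X\cap B_r(x))=n]\le(\hat c\max(r,1))^n$. $p$-moment condition ($p\in[1,\infty)$): $\sup_{1\le n\le\infty}\sup_{1\le p'\le\lfloor p\rfloor}\sup_{x_1,\ldots,x_{p'}\in W_n}E_{x_1,\ldots,x_{p'}}\max\{|\xi(x_1,\mathcal P_n)|,1\}^p<\infty$.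 Correlation functions of the $\xi$-weighted measures $\sum_{x\in\mathcal P_n}\xi(x,\mathcal P_n)\delta_x$: $m^{(k_1,\ldots,k_p)}(x_1,\ldots,x_p;n):=E_{x_1,\ldots,x_p}\bigl[\xi(x_1,\mathcal P_n)^{k_1}\cdots\xi(x_p,\mathcal P_n)^{k_p}\bigr]\rho^{(p)}(x_1,\ldots,x_p)$. *)

(* Defs.v *)
From HB Require Import structures.
From mathcomp Require Import all_boot all_order all_algebra.
From mathcomp Require Import all_classical all_reals all_analysis.
From mathcomp Require Import measurable_realfun.

Set Implicit Arguments.
Unset Strict Implicit.
Unset Printing Implicit Defensive.

Import Order.TTheory GRing.Theory Num.Theory.
Import numFieldNormedType.Exports.

Local Open Scope classical_set_scope.
Local Open Scope ring_scope.

(* Tuples, rather than row vectors, because they carry the product (Borel)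
   sigma-algebra of the library; [k.-tuple (pt R d)] is then (R^d)^k. *)
Notation pt R d := (d.-tuple (R : realType)).

Definition translate (R : realType) (d : nat) (y x : pt R d) : pt R d :=
  [tuple tnth x i + tnth y i | i < d].

Definition dist (R : realType) (d : nat) (x y : pt R d) : R :=
  Num.sqrt (\sum_(i < d) (tnth x i - tnth y i) ^+ 2).

Definition cball (R : realType) (d : nat) (x : pt R d) (r : R) : set (pt R d) :=
  [set y | dist x y <= r].

Definition tfst (T : Type) (p q : nat) (x : (p + q).-tuple T) : p.-tuple T :=
  [tuple tnth x (lshift q i) | i < p].

Definition tsnd (T : Type) (p q : nat) (x : (p + q).-tuple T) : q.-tuple T :=
  [tuple tnth x (rshift p j) | j < q].

(* For 0 < p and 0 < q this is the infimum of a finite nonempty set, i.e. the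
   minimum of |x_i - x_j| over i <= p < j. *)
Definition sep (R : realType) (d p q : nat) (x : (p + q).-tuple (pt R d)) : R :=
  inf [set s | exists (i : 'I_p) (j : 'I_q),
                 s = dist (tnth (tfst x) i) (tnth (tsnd x) j)].

(* The windows W_n; the index [None] stands for n = infinity. *)
Definition window (R : realType) (d : nat) (n : option nat) : set (pt R d) :=
  if n is Some m then
    [set x | forall i, `|tnth x i| <= m%:R `^ d%:R^-1 / 2]
  else setT.

Definition window_index (n : option nat) : Prop :=
  if n is Some m then (1 <= m)%N else True.

Definition tcons (T : Type) (n : nat) (z : T * n.-tuple T) : n.+1.-tuple T :=
  [tuple of z.1 :: z.2].

Lemma measurable_tcons (d : measure_display) (T : measurableType d) (n : nat) :
  measurable_fun setT (@tcons T n).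
Proof. by apply: measurable_cons => //; exact: measurable_snd. Qed.

Definition powm_succ (d : measure_display) (T : measurableType d)
    (R : realType) (n : nat) (m : {sigma_finite_measure set T -> \bar R})
    (mn : {sigma_finite_measure set (n.-tuple T) -> \bar R}) :
    set (n.+1.-tuple T) -> \bar R :=
  pushforward (product_measure1 m mn) (@tcons T n).

Lemma powm_succ0 (d : measure_display) (T : measurableType d)
    (R : realType) (n : nat) (m : {sigma_finite_measure set T -> \bar R})
    (mn : {sigma_finite_measure set (n.-tuple T) -> \bar R}) :
  powm_succ m mn set0 = 0%E.
Proof. by rewrite /powm_succ /pushforward preimage_set0 measure0. Qed.

Lemma powm_succ_ge0 (d : measure_display) (T : measurableType d)
    (R : realType) (n : nat) (m : {sigma_finite_measure set T -> \bar R})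
    (mn : {sigma_finite_measure set (n.-tuple T) -> \bar R}) A :
  (0 <= powm_succ m mn A)%E.
Proof. exact: (measure_ge0 (product_measure1 m mn)). Qed.

Lemma powm_succ_sigma_additive (d : measure_display) (T : measurableType d)
    (R : realType) (n : nat) (m : {sigma_finite_measure set T -> \bar R})
    (mn : {sigma_finite_measure set (n.-tuple T) -> \bar R}) :
  semi_sigma_additive (powm_succ m mn).
Proof.
have mt : measurable_fun setT (@tcons T n) by exact: measurable_tcons.
move=> F mF tF mUF; rewrite /powm_succ /pushforward preimage_bigcup.
apply: (@measure_semi_sigma_additive _ _ _ (product_measure1 m mn)).
- by move=> k; rewrite -[X in measurable X]setTI; exact: mt.
- apply/trivIsetP => /= i j _ _ ij; rewrite -preimage_setI.
  by move/trivIsetP : tF => /(_ _ _ _ _ ij) ->//; rewrite preimage_set0.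
- by rewrite -preimage_bigcup -[X in measurable X]setTI; exact: mt.
Qed.

HB.instance Definition _ (d : measure_display) (T : measurableType d)
    (R : realType) (n : nat) (m : {sigma_finite_measure set T -> \bar R})
    (mn : {sigma_finite_measure set (n.-tuple T) -> \bar R}) :=
  isMeasure.Build _ _ _ (powm_succ m mn) (powm_succ0 m mn)
    (powm_succ_ge0 m mn) (@powm_succ_sigma_additive _ _ _ _ m mn).

Lemma powm_succ_sigma_finite (d : measure_display) (T : measurableType d)
    (R : realType) (n : nat) (m : {sigma_finite_measure set T -> \bar R})
    (mn : {sigma_finite_measure set (n.-tuple T) -> \bar R}) :
  sigma_finite setT (powm_succ m mn).
Proof.
have /sigma_finiteP[F [TF ndF Foo]] := sigma_finiteT m.
have /sigma_finiteP[G [TG ndG Goo]] := sigma_finiteT mn.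
pose g (t : n.+1.-tuple T) : T * n.-tuple T := (thead t, [tuple of behead t]).
have gK : cancel (@tcons T n) g.
  by move=> [x t]; congr pair; apply/val_inj.
have mg : measurable_fun setT g.
  apply: measurable_fun_pair; first exact: measurable_tnth.
  exact: measurable_behead.
exists (fun k => g @^-1` (F k `*` G k)).
  rewrite -preimage_bigcup (_ : \bigcup_k _ = setT) ?preimage_setT//.
  rewrite -setXTT TF TG; apply/seteqP; split => [[x y] [k _ []]|[x y]] /=.
    by move=> Fx Gy; split; exists k.
  move=> -[[k _ Fx] [l _ Gy]]; exists (maxn k l) => //; split.
  - by move: x Fx; exact/subsetPset/ndF/leq_maxl.
  - by move: y Gy; exact/subsetPset/ndG/leq_maxr.
move=> k; have [mF Fk] := Foo k; have [mG Gk] := Goo k; split.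
  by rewrite -[X in measurable X]setTI; apply: mg => //; exact: measurableX.
rewrite /powm_succ /pushforward (_ : _ @^-1` _ = F k `*` G k).
  by rewrite product_measure1E// lte_mul_pinfty// ge0_fin_numE.
by rewrite -comp_preimage (_ : g \o _ = id)//; apply/funext => z; exact: gK.
Qed.

HB.instance Definition _ (d : measure_display) (T : measurableType d)
    (R : realType) (n : nat) (m : {sigma_finite_measure set T -> \bar R})
    (mn : {sigma_finite_measure set (n.-tuple T) -> \bar R}) :=
  Measure_isSigmaFinite.Build _ _ _ (powm_succ m mn)
    (powm_succ_sigma_finite m mn).

Fixpoint powm (d : measure_display) (T : measurableType d) (R : realType)
    (m : {sigma_finite_measure set T -> \bar R}) (n : nat) :
    {sigma_finite_measure set (n.-tuple T) -> \bar R} :=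
  if n is n'.+1 then powm_succ m (powm m n') else \d_[tuple].

(* Lebesgue measure, on the measurable structure carried by [R] itself instead
   of that of its alias [measurableTypeR R]. *)
Definition lebR (R : realType) : set R -> \bar R := lebesgue_measure.

HB.instance Definition _ (R : realType) :=
  isMeasure.Build _ _ _ (@lebR R)
    (measure0 lebesgue_measure) (measure_ge0 lebesgue_measure)
    (@measure_semi_sigma_additive _ _ _ lebesgue_measure).

HB.instance Definition _ (R : realType) :=
  Measure_isSigmaFinite.Build _ _ _ (@lebR R) (sigma_finiteT lebesgue_measure).

Definition leb (R : realType) (d : nat) :
    {sigma_finite_measure set (pt R d) -> \bar R} :=
  powm (@lebR R) d.

Definition lebk (R : realType) (d k : nat) :
    {sigma_finite_measure set (k.-tuple (pt R d)) -> \bar R} :=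
  powm (@leb R d) k.

Definition locally_finite (R : realType) (d : nat) (X : set (pt R d)) : Prop :=
  forall r : R, finite_set (X `&` [set x | forall i, `|tnth x i| <= r]).

Record lfset (R : realType) (d : nat) :=
  LFSet { lf_set :> set (pt R d); lf_setP : locally_finite lf_set }.

Lemma locally_finite0 (R : realType) (d : nat) :
  locally_finite (set0 : set (pt R d)).
Proof. by move=> r; rewrite set0I. Qed.

Lemma locally_finiteI (R : realType) (d : nat) (X : lfset R d)
  (B : set (pt R d)) : locally_finite (X `&` B).
Proof.
by move=> r; apply: sub_finite_set (lf_setP X r) => x [[Xx _] xr].
Qed.

Lemma locally_finiteU (R : realType) (d : nat) (X Y : lfset R d) :
  locally_finite (X `|` Y).
Proof.
by move=> r; rewrite setIUl finite_setU; split; exact: lf_setP.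
Qed.

Lemma locally_finite_translate (R : realType) (d : nat) (y : pt R d)
  (X : lfset R d) : locally_finite (translate y @` X).
Proof.
move=> r; pose s := r + \sum_(i < d) `|tnth y i|.
apply: sub_finite_set (finite_image (translate y) (lf_setP X s)).
move=> _ [[x Xx <-] xr]; exists x => //; split=> // i.
have := xr i; rewrite tnth_mktuple => xyr.
rewrite -[tnth x i](addrK (tnth y i)) (le_trans (ler_normB _ _))// lerD//.
by rewrite (bigD1 i)//= lerDl sumr_ge0.
Qed.

Definition lf0 (R : realType) (d : nat) : lfset R d :=
  LFSet (@locally_finite0 R d).

Definition lfI (R : realType) (d : nat) (X : lfset R d) (B : set (pt R d)) :
  lfset R d := LFSet (locally_finiteI X B).

Definition lfU (R : realType) (d : nat) (X Y : lfset R d) : lfset R d :=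
  LFSet (locally_finiteU X Y).

Definition lf_translate (R : realType) (d : nat) (y : pt R d)
  (X : lfset R d) : lfset R d := LFSet (locally_finite_translate y X).

HB.instance Definition _ (R : realType) (d : nat) := gen_eqMixin (lfset R d).
HB.instance Definition _ (R : realType) (d : nat) :=
  gen_choiceMixin (lfset R d).
HB.instance Definition _ (R : realType) (d : nat) :=
  isPointed.Build (lfset R d) (lf0 R d).

(* The canonical sigma-algebra: the smallest one making all the evaluations
   X |-> card (X `&` B), with B Borel, measurable. *)
Definition lf_measurable (R : realType) (d : nat) : set (set (lfset R d)) :=
  <<s [set A | exists B : set (pt R d), exists Y : set (\bar R),
         [/\ measurable B, measurable Y &
             A = (fun X : lfset R d => counting (X `&` B)) @^-1` Y]] >>.

Lemma lf_measurable0 (R : realType) (d : nat) : @lf_measurable R d set0.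
Proof. exact: sigma_algebra0. Qed.

Lemma lf_measurableC (R : realType) (d : nat) (A : set (lfset R d)) :
  lf_measurable A -> lf_measurable (~` A).
Proof. exact: sigma_algebraC. Qed.

Lemma lf_measurable_bigcup (R : realType) (d : nat)
    (F : (set (lfset R d))^nat) :
  (forall i, lf_measurable (F i)) -> lf_measurable (\bigcup_i F i).
Proof. exact: sigma_algebra_bigcup. Qed.

HB.instance Definition _ (R : realType) (d : nat) :=
  @isMeasurable.Build default_measure_display (lfset R d) (@lf_measurable R d)
    (@lf_measurable0 R d) (@lf_measurableC R d) (@lf_measurable_bigcup R d).

(* X^(k), the k-tuples of pairwise distinct points of X. *)
Definition ktuples (R : realType) (d k : nat) (X : set (pt R d)) :
    set (k.-tuple (pt R d)) :=
  [set x : k.-tuple (pt R d) | uniq x /\ forall i, X (tnth x i)].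
Arguments ktuples {R d} k X.

Definition factorial_moment (dd : measure_display) (Omega : measurableType dd)
    (R : realType) (P : probability Omega R) (d : nat)
    (X : {RV P >-> lfset R d}) (k : nat) (B : set (k.-tuple (pt R d))) :
    \bar R :=
  (\int[P]_w counting (ktuples k (X w) `&` B))%E.

Definition correlation_function (dd : measure_display)
    (Omega : measurableType dd) (R : realType) (P : probability Omega R)
    (d : nat) (X : {RV P >-> lfset R d}) (k : nat)
    (rho : k.-tuple (pt R d) -> R) : Prop :=
  [/\ measurable_fun setT rho,
      forall x, 0 <= rho x,
      forall x : k.-tuple (pt R d), ~~ uniq x -> rho x = 0 &
      forall B, measurable B ->
        factorial_moment X B = (\int[lebk R d k]_(x in B) (rho x)%:E)%E].

(* [palm] is a version of the Palm probabilities P_{x_1,...,x_k}. *)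
Definition palm_version (dd : measure_display)
    (Omega : measurableType dd) (R : realType) (P : probability Omega R)
    (d : nat) (X : {RV P >-> lfset R d}) (k : nat)
    (palm : R.-pker (k.-tuple (pt R d)) ~> lfset R d) : Prop :=
  forall f : k.-tuple (pt R d) * lfset R d -> \bar R,
    measurable_fun setT f -> (forall z, 0 <= f z)%E ->
    ((\int[P]_w \esum_(x in ktuples k (X w)) f (x, X w)) =
     \int[factorial_moment X (k := k)]_x \int[palm x]_Y f (x, Y))%E.

Definition stationary (dd : measure_display) (Omega : measurableType dd)
    (R : realType) (P : probability Omega R) (d : nat)
    (X : {RV P >-> lfset R d}) : Prop :=
  forall (y : pt R d) (A : set (lfset R d)), measurable A ->
    distribution P X (lf_translate y @^-1` A) = distribution P X A.

(* Simplicity is built into [lfset].  For a stationary process the one-point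
   correlation function is a.e. constant, and rho^(1)(0) denotes this constant. *)
Definition admissible (dd : measure_display) (Omega : measurableType dd)
    (R : realType) (P : probability Omega R) (d : nat)
    (X : {RV P >-> lfset R d}) (rho : forall k, k.-tuple (pt R d) -> R) :
    Prop :=
  [/\ stationary X,
      forall k, (1 <= k)%N -> correlation_function X (@rho k) &
      exists2 intensity : R, 0 < intensity &
        {ae lebk R d 1, forall x, rho 1 x = intensity}].

Definition fast_decreasing (R : realType) (phi : R -> R) : Prop :=
  [/\ forall t : R, 0 <= t -> 0 <= phi t <= 1,
      forall s t : R, 0 <= s -> s <= t -> phi t <= phi s &
      forall m, (1 <= m)%N -> (fun t => t ^+ m * phi t) @ +oo --> 0].

Definition correlation_decay (R : realType) (d : nat)
    (rho : forall k, k.-tuple (pt R d) -> R)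
    (phi : R -> R) (c C : nat -> R) : Prop :=
  [/\ fast_decreasing phi,
      forall k, (1 <= k)%N -> 0 < c k &
      forall p q, (1 <= p)%N -> (1 <= q)%N ->
        {ae lebk R d (p + q), forall x,
          `|rho (p + q)%N x - rho p (tfst x) * rho q (tsnd x)|
            <= C (p + q)%N * phi (c (p + q)%N * sep x)}].

(* limsup_{t -> oo} t^-b log(phi t) is in ]-oo, 0[; [lne] is used because
   log 0 = -oo. *)
Definition log_decay (R : realType) (phi : R -> R) (b : R) : Prop :=
  let L := limf_esup
    (fun t : R => ((t `^ (- b))%:E * lne (phi t)%:E)%E) (+oo%R : set_system R)
  in (-oo < L /\ L < 0)%E.

Definition score_function (R : realType) (d : nat)
    (xi : pt R d -> lfset R d -> R) : Prop :=
  [/\ forall X, measurable_fun setT (fun x => xi x X),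
      forall x, measurable_fun setT (xi x),
      forall x (X : lfset R d), ~ lf_set X x -> xi x X = 0 &
      forall y x X, xi (translate y x) (lf_translate y X) = xi x X].

(* The radius of stabilization, +oo when no r is suitable. *)
Definition stab_radius (R : realType) (d : nat)
    (xi : pt R d -> lfset R d -> R) (x : pt R d) (X : lfset R d) : \bar R :=
  ereal_inf [set r%:R%:E | r in [set r : nat | (1 <= r)%N /\
    forall A : lfset R d,
      xi x (lfI X (cball x r%:R)) =
      xi x (lfU (lfI X (cball x r%:R)) (lfI A (~` cball x r%:R)))]].

(* The event {R^xi > t} involves an uncountable intersection; its probability is
   written with the outer measure [mu_ext], i.e. with the completed measure,
   which agrees with the measure itself on measurable events. *)
Definition stabilizing (dd : measure_display) (Omega : measurableType dd)
    (R : realType) (P : probability Omega R) (d : nat)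
    (X : {RV P >-> lfset R d})
    (palm : forall k, R.-pker (k.-tuple (pt R d)) ~> lfset R d)
    (xi : pt R d -> lfset R d -> R) (a : nat -> R) (phi : R -> R) : Prop :=
  [/\ forall l, (1 <= l)%N -> 0 < a l,
      forall t : R, 0 <= t -> 0 <= phi t <= 1,
      forall s t : R, 0 <= s -> s <= t -> phi t <= phi s,
      phi @ +oo --> 0 &
      forall (l : nat) (t : R) (n : option nat), 0 < t -> window_index n ->
        {ae factorial_moment X (k := l.+1), forall x,
          (forall i, window n (tnth x i)) ->
          (mu_ext (palm l.+1 x)
             [set Y | t%:E < stab_radius xi (thead x) (lfI Y (window n))]
           <= (phi (a l.+1 * t))%:E)%E}].

Definition exponentially_stabilizing (dd : measure_display)
    (Omega : measurableType dd) (R : realType) (P : probability Omega R)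
    (d : nat) (X : {RV P >-> lfset R d})
    (palm : forall k, R.-pker (k.-tuple (pt R d)) ~> lfset R d)
    (xi : pt R d -> lfset R d -> R) : Prop :=
  exists a phi, stabilizing X palm xi a phi /\
    exists2 c : R, 0 < c & log_decay phi c.

Definition power_growth (R : realType) (d : nat)
    (xi : pt R d -> lfset R d -> R) : Prop :=
  exists2 chat : R, 1 <= chat &
    forall (x : pt R d) (X : lfset R d) (r : R) (n : nat), 0 < r ->
      (lf_set X `&` cball x r #= `I_n)%card ->
      `|xi x (lfI X (cball x r))| <= (chat * Num.max r 1) ^+ n.

(* The order is k = k'.+1.  By local finiteness of X and the finite range of h,
   the sum has finite support, as [\sum_(_ \in _)] requires. *)
Definition class_A1 (R : realType) (d : nat)
    (rho : forall k, k.-tuple (pt R d) -> R)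
    (xi : pt R d -> lfset R d -> R) : Prop :=
  (exists phi c C, correlation_decay rho phi c C) /\
  exists (k' : nat) (h : k'.+1.-tuple (pt R d) -> R) (r : R),
    [/\ 0 < r,
        [/\ forall x y : k'.+1.-tuple (pt R d), perm_eq x y -> h x = h y,
            forall y (x : k'.+1.-tuple (pt R d)),
              h [tuple of map (translate y) x] = h x &
            exists M : R, forall x, `|h x| <= M],
        forall x, (exists i, r < dist (tnth x i) (thead x)) -> h x = 0,
        forall x : k'.+1.-tuple (pt R d), ~~ uniq x -> h x = 0 &
        forall x (X : lfset R d), lf_set X x ->
          xi x X = (k'.+1)`!%:R^-1 *
            \sum_(y \in ktuples k' X) h [tuple of x :: y]].

Definition class_A2 (dd : measure_display) (Omega : measurableType dd)
    (R : realType) (P : probability Omega R) (d : nat)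
    (X : {RV P >-> lfset R d}) (rho : forall k, k.-tuple (pt R d) -> R)
    (palm : forall k, R.-pker (k.-tuple (pt R d)) ~> lfset R d)
    (xi : pt R d -> lfset R d -> R) : Prop :=
  [/\ exists (phi : R -> R) (C : nat -> R),
        [/\ correlation_decay rho phi (fun=> 1) C,
            exists2 a : R, 0 <= a < 1 &
              C =O_\oo (fun k : nat => k%:R `^ (a * k%:R)) &
            exists2 b : R, 0 < b & log_decay phi b],
      exponentially_stabilizing X palm xi &
      power_growth xi].

(* Essential suprema are taken with respect to the factorial moment measure, the
   measure up to whose null sets the Palm probabilities are determined. *)
Definition moment_condition (dd : measure_display) (Omega : measurableType dd)
    (R : realType) (P : probability Omega R) (d : nat)
    (X : {RV P >-> lfset R d})
    (palm : forall k, R.-pker (k.-tuple (pt R d)) ~> lfset R d)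
    (xi : pt R d -> lfset R d -> R) (p : R) : Prop :=
  exists M : R, forall (n : option nat) (l : nat),
    window_index n -> (l.+1 <= Num.truncn p)%N ->
    {ae factorial_moment X (k := l.+1), forall x,
      (forall i, window n (tnth x i)) ->
      (\int[palm l.+1 x]_Y
         ((Num.max `|xi (thead x) (lfI Y (window n))| 1) `^ p)%:E <= M%:E)%E}.

(* m^(k_1,...,k_p)(x_1,...,x_p; n), as an extended real so that a divergent
   expectation is not replaced by a default value. *)
Definition weighted_correlation (R : realType) (d : nat)
    (rho : forall k, k.-tuple (pt R d) -> R)
    (palm : forall k, R.-pker (k.-tuple (pt R d)) ~> lfset R d)
    (xi : pt R d -> lfset R d -> R) (n : option nat) (p : nat)
    (ks : p.-tuple nat) (x : p.-tuple (pt R d)) : \bar R :=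
  (\int[palm p x]_Y
     (\prod_(i < p) xi (tnth x i) (lfI Y (window n)) ^+ tnth ks i)%:E
   * (rho p x)%:E)%E.

(* Main.v *)
(* A score depending only on the points within distance t of x is, by Moebius
   inversion over finite sets, a sum over l of (1/l!) times a sum over l-tuples of
   further points close to x.  By Campbell's formula its Palm mean times rho^(p)
   becomes a series of integrals against rho^(p+l).  For two clusters at distance
   s > 2t, the decay of correlations applied to rho^(p+l1+q+l2) compares the series
   of the product with the product of the series.

   In class (A1) the score is local; a product of U-statistics is a polynomial in
   the indicators of the points, so only finitely many l contribute.  In class (A2)
   the score is replaced by its value on the ball of radius t, clipped at the level
   t.  Stabilization and moments bound the effect by any power of 1/t, while the
   growth of C_k makes the series at most exp(c t^e) for some e; since phi decays
   like exp(-eps s^b), choosing t of order s^(1/N) with N large makes the error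
   smaller than any power of 1/s.  The resulting bounds A_(K,m) (1+s)^-m, for all m,
   are finally merged into a single fast decreasing function. *)
From HB Require Import structures.
Require Import Defs.
From mathcomp Require Import all_boot all_order all_algebra.
From mathcomp Require Import all_classical all_reals all_analysis.
From mathcomp Require Import measurable_realfun ring lra.

Import Order.TTheory GRing.Theory Num.Theory.
Import numFieldNormedType.Exports.

Set Implicit Arguments.
Unset Strict Implicit.
Unset Printing Implicit Defensive.

Local Open Scope classical_set_scope.
Local Open Scope ring_scope.

(** * Concatenated tuples and iterated product measures *)

(** Palm probabilities and correlation functions are fixed only up to null sets, so identities
    between them are proved by integrating over test sets and comparing integrands. This calculus is
    one of nonnegative functions, while Moebius coefficients have signs. Each expansion is therefore
    split into its positive and negative parts, and a product of two local functionals gives four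
    nonnegative comparisons, recombined once all terms are known to be finite. A null set can serve
    countably many parameters only: hence radii [t] in class (A2) that are natural numbers, chosen
    after the points are known. Finiteness of the series rests on two bounds. The positions of [l]
    points near a cluster have volume at most [V ^+ l], and [rho k <= kappa k] follows from the
    decay itself by detaching one point at a time. In class (A2) the Moebius coefficient of order
    [l] is at most [2 ^+ l * t ^+ K], where [K] is the sum of the exponents, and [kappa k] grows at
    most like B^k (k!)^a with [a < 1], so the weight 1/l! wins. *)

Definition tcat {T : Type} {p q : nat} (x : p.-tuple T) (y : q.-tuple T) :
  (p + q).-tuple T := [tuple of x ++ y].

Lemma tfst_tcat {T : Type} {p q : nat} (x : p.-tuple T) (y : q.-tuple T) :
  tfst (tcat x y) = x.
Proof. by apply: eq_from_tnth => i; rewrite tnth_mktuple tnth_lshift. Qed.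

Lemma tsnd_tcat {T : Type} {p q : nat} (x : p.-tuple T) (y : q.-tuple T) :
  tsnd (tcat x y) = y.
Proof. by apply: eq_from_tnth => i; rewrite tnth_mktuple tnth_rshift. Qed.

Lemma tcatK {T : Type} {p q : nat} (z : (p + q).-tuple T) :
  tcat (tfst z) (tsnd z) = z.
Proof.
apply: eq_from_tnth => i; case: (split_ordP i) => j ->.
  by rewrite tnth_lshift tnth_mktuple.
by rewrite tnth_rshift tnth_mktuple.
Qed.

Lemma tcat0 {T : Type} {q : nat} (x : 0.-tuple T) (y : q.-tuple T) :
  tcat x y = y.
Proof. by apply: val_inj; rewrite /= (tuple0 x). Qed.

Lemma tcat_tcons {T : Type} {p q : nat} (a : T) (x : p.-tuple T)
  (y : q.-tuple T) : tcat (tcons (a, x)) y = tcons (a, tcat x y).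
Proof. exact: val_inj. Qed.

Section measurable_tuples.
Context {d1 d2 : measure_display} {S : measurableType d1}
  {T : measurableType d2}.

Lemma measurable_tfst p q :
  measurable_fun setT (@tfst T p q).
Proof.
apply/measurable_fun_tnthP => i /=.
rewrite [X in measurable_fun _ X](_ : _ = (fun x => tnth x (lshift q i))).
  exact: measurable_tnth.
by apply/funext => x /=; rewrite tnth_mktuple.
Qed.

Lemma measurable_tsnd p q :
  measurable_fun setT (@tsnd T p q).
Proof.
apply/measurable_fun_tnthP => i /=.
rewrite [X in measurable_fun _ X](_ : _ = (fun x => tnth x (rshift p i))).
  exact: measurable_tnth.
by apply/funext => x /=; rewrite tnth_mktuple.
Qed.

Lemma measurable_tcat p q (f : S -> p.-tuple T) (g : S -> q.-tuple T) :
  measurable_fun setT f -> measurable_fun setT g ->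
  measurable_fun setT (fun s => tcat (f s) (g s)).
Proof.
move=> mf mg; apply/measurable_fun_tnthP => i /=.
case: (split_ordP i) => j ->.
  rewrite [X in measurable_fun _ X](_ : _ = (fun s => tnth (f s) j)).
    exact: (measurableT_comp (measurable_tnth j) mf).
  by apply/funext => x /=; rewrite tnth_lshift.
rewrite [X in measurable_fun _ X](_ : _ = (fun s => tnth (g s) j)).
  exact: (measurableT_comp (measurable_tnth j) mg).
by apply/funext => x /=; rewrite tnth_rshift.
Qed.

End measurable_tuples.

(* Tonelli's formula for [m], seen as the image of [m1 x m2] under [j]. *)
Definition factors {d1 d2 d3 : measure_display} {T1 : measurableType d1}
    {T2 : measurableType d2} {T3 : measurableType d3} {R : realType}
    (m1 : {measure set T1 -> \bar R}) (m2 : {measure set T2 -> \bar R})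
    (m : {measure set T3 -> \bar R}) (j : T1 -> T2 -> T3) :=
  forall f : T3 -> \bar R, measurable_fun setT f -> (forall z, 0 <= f z)%E ->
    (\int[m]_z f z = \int[m1]_x \int[m2]_y f (j x y))%E.

Section factors_ae.
Context {d1 d2 d3 : measure_display} {T1 : measurableType d1}
    {T2 : measurableType d2} {T3 : measurableType d3} {R : realType}.
Variables (m1 : {sigma_finite_measure set T1 -> \bar R})
    (m2 : {sigma_finite_measure set T2 -> \bar R})
    (m : {measure set T3 -> \bar R}) (j : T1 -> T2 -> T3).
Hypothesis mj : measurable_fun setT (fun z : T1 * T2 => j z.1 z.2).
Hypothesis fj : factors m1 m2 m j.

(** By Tonelli's formula the function [h], which gives the [m2]-measure of the section of a null set
    at [x], has integral zero, hence vanishes for almost every [x]. This passes bounds on [rho] at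
    enlarged tuples to almost every choice of the added points. *)
Lemma factors_ae (Q : T3 -> Prop) : {ae m, forall z, Q z} ->
  {ae m1, forall x, {ae m2, forall y, Q (j x y)}}.
Proof.
move=> [N [mN N0 QN]].
have mjN : measurable ((fun z : T1 * T2 => j z.1 z.2) @^-1` N).
  by rewrite -[X in measurable X]setTI; exact: mj.
have mf : measurable_fun setT (fun z : T3 => (\1_N z)%:E : \bar R).
  by apply/measurable_EFinP; exact: measurable_indic.
have mg : measurable_fun setT (fun z : T1 * T2 => (\1_N (j z.1 z.2))%:E : \bar R).
  exact: (measurableT_comp mf mj).
have := fj mf (fun z => ltac:(by rewrite lee_fin)).
rewrite integral_indic// setIT N0 => /esym.
set h := fun x => (\int[m2]_y _)%E => h0.
have mh : measurable_fun setT h.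
  apply: (@measurable_fun_fubini_tonelli_F _ _ _ _ _ m2
    (fun z : T1 * T2 => (\1_N (j z.1 z.2))%:E)) => //.
have hge0 x : (0 <= h x)%E by apply: integral_ge0 => y _; rewrite lee_fin.
have : {ae m1, forall x, h x = 0}%E.
  have := (ae_eq_integral_abs m1 measurableT mh).1.
  rewrite (_ : (\int[m1]_(x in _) `|h x|)%E = 0%E); last first.
    by rewrite -[RHS]h0; apply: eq_integral => x _; rewrite gee0_abs.
  by move=> /(_ erefl); apply: (@filterS _ (almost_everywhere m1)) => x /(_ Logic.I).
apply: (@filterS _ (almost_everywhere m1)) => x hx.
have mgx : measurable_fun setT (fun y => (\1_N (j x y))%:E : \bar R).
  exact: (measurableT_comp mg (measurable_pair1 x)).
have := (ae_eq_integral_abs m2 measurableT mgx).1.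
rewrite (_ : (\int[m2]_(x in _) `| _ |)%E = 0%E); last first.
  by rewrite -[RHS]hx; apply: eq_integral => y _; rewrite gee0_abs// lee_fin.
move=> /(_ erefl); apply: (@filterS _ (almost_everywhere m2)) => y /(_ Logic.I) /= [].
rewrite indicE; case: (boolP (_ \in _)) => [_ /eqP|/negP]; first by rewrite oner_eq0.
by move=> nN _; apply: contrapT => nQ; apply: nN; rewrite inE; exact: QN.
Qed.

(** The indicator of the preimage is constant in [y], so its integral is the total mass of [m2]
    times zero, which is zero even if that mass is infinite. *)
Lemma factors_ae_fst (pi : T3 -> T1) (Q : T1 -> Prop) :
  measurable_fun setT pi -> (forall x y, pi (j x y) = x) ->
  {ae m1, forall x, Q x} -> {ae m, forall z, Q (pi z)}.
Proof.
move=> mpi piE [N [mN N0 QN]].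
have mpN : measurable (pi @^-1` N).
  by rewrite -[X in measurable X]setTI; exact: mpi.
exists (pi @^-1` N); split => //; last by move=> z /= nQ; exact: QN.
have := fj (f := fun z => (\1_(pi @^-1` N) z)%:E)
  ltac:(apply/measurable_EFinP; exact: measurable_indic)
  (fun z => ltac:(by rewrite lee_fin)).
rewrite integral_indic// setIT => ->.
under eq_integral => x _.
  rewrite (_ : (fun y => _) = (cst (\1_N x)%:E)); last first.
    by apply/funext => y /=; congr (_%:E); rewrite !indicE; congr (_%:R); apply: congr1; apply/idP/idP; rewrite !inE /= piE.
  rewrite integral_cst// muleC.
  over.
rewrite ge0_integralZl//; last first.
  by apply/measurable_EFinP; exact: measurable_indic.
have -> : (\int[m1]_x (\1_N x)%:E = 0)%E by rewrite integral_indic// setIT.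
by rewrite mule0.
Qed.

End factors_ae.

Section powm_factors.
Context {dm : measure_display} {T : measurableType dm} {R : realType}.
Variable m : {sigma_finite_measure set T -> \bar R}.

Lemma factors_tcons n :
  factors m (powm m n) (powm m n.+1) (fun x y => tcons (x, y)).
Proof.
move=> f mf f0 /=.
have mt : measurable_fun setT (@tcons T n) by exact: measurable_tcons.
rewrite ge0_integral_pushforward//.
rewrite preimage_setT fubini_tonelli1//; first exact: (measurableT_comp mf mt).
by move=> z /=.
Qed.

Lemma integral_powm0 (f : 0.-tuple T -> \bar R) :
  measurable_fun setT f -> (\int[powm m 0]_x f x = f [tuple])%E.
Proof. by move=> mf; rewrite /= integral_dirac// diracT mul1e. Qed.

Lemma factors_tcat p q :
  factors (powm m p) (powm m q) (powm m (p + q)) (fun x y => tcat x y).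
Proof.
elim: p => [|p IH] f mf f0.
  have mh : measurable_fun setT (fun z : 0.-tuple T * q.-tuple T => f (tcat z.1 z.2)).
    by apply: (measurableT_comp mf); apply: measurable_tcat => //.
  rewrite integral_powm0; last first.
    exact: (@measurable_fun_fubini_tonelli_F _ _ _ _ _ (powm m q) _ mh).
  by apply: eq_integral => y _; rewrite tcat0.
rewrite (factors_tcons mf f0).
have mh : measurable_fun setT (fun z : p.+1.-tuple T * q.-tuple T => f (tcat z.1 z.2)).
  by apply: (measurableT_comp mf); apply: measurable_tcat => //.
rewrite (factors_tcons (f := fun x => (\int[powm m q]_y f (tcat x y))%E)); last 2 first.
- exact: (@measurable_fun_fubini_tonelli_F _ _ _ _ _ (powm m q) _ mh).
- by move=> x; apply: integral_ge0.
apply: eq_integral => a _.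
rewrite (IH (fun z => f (tcons (a, z)))) //; last first.
apply: (measurableT_comp (f := f) (g := fun z => tcons (a, z)) mf (measurable_cons (measurable_cst a) (@measurable_id _ _ setT))) => //.
by apply: eq_integral => x _; apply: eq_integral => y _; rewrite tcat_tcons.
Qed.

(* Regroups with each of the two clusters the points added to it. *)
Definition tcat4 {p q l1 l2 : nat} (z : (p + q).-tuple T)
    (u : (l1 + l2).-tuple T) : (p + l1 + (q + l2)).-tuple T :=
  tcat (tcat (tfst z) (tfst u)) (tcat (tsnd z) (tsnd u)).

Lemma measurable_tcat4 p q l1 l2 :
  measurable_fun setT (fun s : (p + q).-tuple T * (l1 + l2).-tuple T =>
    tcat4 s.1 s.2).
Proof.
do 2 apply: measurable_tcat.
- exact: (measurableT_comp (@measurable_tfst _ T _ _) measurable_fst).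
- exact: (measurableT_comp (@measurable_tfst _ T _ _) measurable_snd).
- exact: (measurableT_comp (@measurable_tsnd _ T _ _) measurable_fst).
- exact: (measurableT_comp (@measurable_tsnd _ T _ _) measurable_snd).
Qed.

(** Once all blocks are split, the two sides differ in the order of integration only: the additions
    [y] to the first cluster have to be exchanged with the second cluster [x']. *)
Lemma factors_tcat4 p q l1 l2 :
  factors (powm m (p + q)) (powm m (l1 + l2)) (powm m (p + l1 + (q + l2)))
    (fun z u => tcat4 z u).
Proof.
move=> f mf f0.
have mcat a b (g : (a + b).-tuple T -> \bar R) : measurable_fun setT g ->
    measurable_fun setT (fun s : a.-tuple T * b.-tuple T => g (tcat s.1 s.2)).
  by move=> mg; apply: (measurableT_comp mg); apply: measurable_tcat.
have mi (d1 d2 : measure_display) (S1 : measurableType d1) (S2 : measurableType d2)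
    (mu : {sigma_finite_measure set S2 -> \bar R}) (g : S1 * S2 -> \bar R) :
    measurable_fun setT g -> (forall z, 0 <= g z)%E ->
    measurable_fun setT (fun x => \int[mu]_y g (x, y))%E.
  by move=> mg g0; exact: measurable_fun_fubini_tonelli_F.
rewrite (factors_tcat mf f0).
rewrite (factors_tcat (f := fun x => \int[powm m (q + l2)]_y f (tcat x y)))%E; last 2 first.
- exact: (mi _ _ _ _ (powm m (q + l2)) (fun s => f (tcat s.1 s.2)) (mcat _ _ _ mf)).
- by move=> x; exact: integral_ge0.
rewrite (factors_tcat (f := fun z => \int[powm m (l1 + l2)]_u f (tcat4 z u)))%E; last 2 first.
- apply: (mi _ _ _ _ (powm m (l1 + l2)) (fun s => f (tcat4 s.1 s.2))) => //.
  exact: (measurableT_comp mf (@measurable_tcat4 _ _ _ _)).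
- by move=> x; exact: integral_ge0.
apply: eq_integral => x _.
transitivity (\int[powm m l1]_y \int[powm m q]_x' \int[powm m l2]_y'
    f (tcat (tcat x y) (tcat x' y')))%E.
  apply: eq_integral => y _.
  rewrite (factors_tcat (f := fun u => f (tcat (tcat x y) u)))//.
  by apply: (measurableT_comp mf); apply: measurable_tcat.
rewrite (fubini_tonelli (m1 := powm m l1) (m2 := powm m q)
  (fun s => \int[powm m l2]_y' f (tcat (tcat x s.1) (tcat s.2 y'))))%E; last 2 first.
- apply: (mi _ _ _ _ (powm m l2) (fun s => f (tcat (tcat x s.1.1) (tcat s.1.2 s.2)))) => //.
  apply: (measurableT_comp mf); apply: measurable_tcat; apply: measurable_tcat => //.
  + exact: (measurableT_comp measurable_fst measurable_fst).
  + exact: (measurableT_comp measurable_snd measurable_fst).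
- by move=> s; exact: integral_ge0.
apply: eq_integral => x' _.
have mfu : measurable_fun setT (fun u : (l1 + l2).-tuple T => f (tcat4 (tcat x x') u)).
  apply: (measurableT_comp mf).
  exact: (measurableT_comp (@measurable_tcat4 _ _ _ _) (measurable_pair1 (tcat x x'))).
apply: etrans (esym (factors_tcat mfu (fun u => f0 _))).
apply: eq_integral => y _; apply: eq_integral => y' _.
by rewrite /tcat4 !tfst_tcat !tsnd_tcat.
Qed.

End powm_factors.

(** * Integrals against densities, and comparison of functions through their integrals *)

Section eq_integral_meas.
Context {d : measure_display} {T : measurableType d} {R : realType}.
Import HBNNSimple.

(** [factorial_moment] is a bare set function, without a measure structure. Its integral is still a
    difference of suprema over simple functions, which evaluate the set function on measurable sets
    only. *)
Lemma eq_setfun_integral (m1 m2 : set T -> \bar R) (f : T -> \bar R) :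
  (forall A, measurable A -> m1 A = m2 A) ->
  (\int[m1]_x f x = \int[m2]_x f x)%E.
Proof.
move=> m12.
have S (h : {nnsfun T >-> R}) : sintegral m1 h = sintegral m2 h.
  by rewrite /sintegral; apply: eq_fsbigr => x _; rewrite m12.
rewrite /integral; congr (ereal_sup _ - ereal_sup _)%E;
  by apply/funext => y; apply/propext; split => -[h hg <-]; exists h.
Qed.

Section density.
Variables (mu : {measure set T -> \bar R}) (rho : T -> R).
Hypothesis mrho : measurable_fun setT rho.
Hypothesis rho0 : forall x, 0 <= rho x.

Let dens (A : set T) : \bar R := (\int[mu]_(x in A) (rho x)%:E)%E.

Let dens_set0 : dens set0 = 0%E.
Proof. by rewrite /dens integral_set0. Qed.

Let dens_ge0 A : (0 <= dens A)%E.
Proof. by apply: integral_ge0 => x _; rewrite lee_fin. Qed.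

Let dens_sigma_additive : semi_sigma_additive dens.
Proof.
move=> F mF tF mUF; rewrite /dens ge0_integral_bigcup//; last 2 first.
- by apply/measurable_EFinP; exact: measurable_funTS.
- by move=> x _; rewrite lee_fin.
by apply: is_cvg_ereal_nneg_natsum => n _; apply: integral_ge0 => x _; rewrite lee_fin.
Qed.

(** [alpha] may be replaced by the measure [dens], as they agree on measurable sets. Both integrals
    are then limits along one sequence of simple functions, for which the formula is linearity. *)
Lemma integral_density (alpha : set T -> \bar R) (f : T -> \bar R) :
  (forall A, measurable A -> alpha A = (\int[mu]_(x in A) (rho x)%:E)%E) ->
  measurable_fun setT f -> (forall x, 0 <= f x)%E ->
  (\int[alpha]_x f x = \int[mu]_x (f x * (rho x)%:E))%E.
Proof.
move=> alphaE mf f0.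
pose M : {measure set T -> \bar R} := HB.pack dens
  (isMeasure.Build _ _ _ dens dens_set0 dens_ge0 dens_sigma_additive).
transitivity (\int[M]_x f x)%E; first exact: eq_setfun_integral.
have mrE : measurable_fun setT (EFin \o rho) by exact/measurable_EFinP.
pose h := nnsfun_approx measurableT mf.
have hf x : ((h n x)%:E @[n --> \oo] --> f x)%E by exact: cvg_nnsfun_approx.
have ndh x : {homo (fun n => h n x) : a b / (a <= b)%N >-> a <= b}.
  by move=> a b ab; exact/lefP/nd_nnsfun_approx.
have mh n : measurable_fun setT (EFin \o h n) by exact/measurable_EFinP.
have -> : (\int[M]_x f x = limn (fun n => \int[M]_x (h n x)%:E))%E.
  under eq_integral => x _ do rewrite -(cvg_lim _ (hf x))//.
  apply: monotone_convergence => //.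
  - by move=> n x _; rewrite lee_fin.
  - by move=> x _ a b ab; rewrite lee_fin ndh.
have -> : (\int[mu]_x (f x * (rho x)%:E) =
           limn (fun n => \int[mu]_x ((h n x)%:E * (rho x)%:E)))%E.
  have hfr x : ((h n x)%:E * (rho x)%:E @[n --> \oo] --> f x * (rho x)%:E)%E.
    exact: cvgeZr.
  under eq_integral => x _ do rewrite -(cvg_lim _ (hfr x))//.
  apply: monotone_convergence => //.
  - by move=> n; exact: (emeasurable_funM (mh n) mrE).
  - by move=> n x _; rewrite -EFinM lee_fin mulr_ge0.
  - by move=> x _ a b ab; rewrite -!EFinM lee_fin ler_wpM2r// ndh.
congr (limn _); apply/funext => n.
have mi r : measurable_fun setT (fun x => (r * \1_(h n @^-1` [set r]) x)%:E : \bar R).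
  apply/measurable_EFinP; apply: measurable_funM => //.
transitivity (\int[M]_x
   (\sum_(y \in range (h n)) (y * \1_(h n @^-1` [set y]) x)%:E))%E.
  by apply: eq_integral => t tE; rewrite /= fimfunE -fsumEFin.
rewrite ge0_integral_fsum//; last by move=> m y Ey; exact: nnfun_muleindic_ge0.
transitivity (\int[mu]_x
   (\sum_(y \in range (h n)) (y * \1_(h n @^-1` [set y]) x)%:E * (rho x)%:E))%E; last first.
  apply: eq_integral => t tE; rewrite [in RHS]fimfunE -fsumEFin// ge0_mule_fsuml//.
  by move=> r; exact: nnfun_muleindic_ge0.
rewrite [RHS]ge0_integral_fsum//; last 2 first.
- by move=> r; exact: (emeasurable_funM (mi r) mrE).
- by move=> m y _; rewrite mule_ge0// ?lee_fin//; exact: nnfun_muleindic_ge0.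
apply: eq_fsbigr => r rh.
under [RHS]eq_integral do rewrite EFinM -muleA.
have r0 : 0 <= r by move: rh; rewrite inE => -[x _ <-].
under [LHS]eq_integral do rewrite EFinM.
have mI : measurable_fun setT (fun x => (\1_(h n @^-1` [set r]) x)%:E : \bar R).
  by apply/measurable_EFinP; exact: measurable_indic.
rewrite ge0_integralZl// [RHS]ge0_integralZl//; last 2 first.
- exact: (emeasurable_funM mI mrE).
- by move=> x _; rewrite mule_ge0// lee_fin.
congr (_ * _)%E.
rewrite integral_indic// setIT /= /dens integral_mkcond.
apply: eq_integral => x _; rewrite patchE indicE.
by case: ifPn => _; rewrite ?mul1e ?mul0e.
Qed.

End density.
End eq_integral_meas.

(** The bound makes [g] integrable on sets of finite measure, where equal integrals over all
    measurable subsets force equality almost everywhere; countably many such sets cover the space.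
    No finiteness of [f] is presupposed, which suits Palm means not yet known to be finite. *)
Lemma ae_eq_of_integrals {d : measure_display} {T : measurableType d}
    {R : realType} (mu : {sigma_finite_measure set T -> \bar R})
    (f g : T -> \bar R) (c : R) :
  measurable_fun setT f -> measurable_fun setT g ->
  (forall x, 0 <= f x)%E -> (forall x, 0 <= g x)%E ->
  {ae mu, forall x, g x <= c%:E}%E ->
  (forall B, measurable B -> \int[mu]_(x in B) f x = \int[mu]_(x in B) g x)%E ->
  {ae mu, forall x, f x = g x}.
Proof.
move=> mf mg f0 g0 gc fg.
have /sigma_finiteP[F [TF ndF Foo]] := sigma_finiteT mu.
have H n : {ae mu, forall x, F n x -> g x = f x}.
  have [mF Fn] := Foo n.
  apply: (@integral_ae_eq _ _ _ mu (F n) mF f g) => //.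
  - apply/integrableP; split; first exact: measurable_funTS.
    under eq_integral do rewrite gee0_abs//.
    apply: (@le_lt_trans _ _ (\int[mu]_(x in F n) (Num.max c 0)%:E)%E).
      apply: ae_ge0_le_integral => //.
      + exact: measurable_funTS.
      + by move=> x _; rewrite lee_fin le_max lexx orbT.
      + by apply: (filterS _ gc) => x + _ => /le_trans; apply; rewrite lee_fin le_max lexx.
    rewrite integral_cst// lte_mul_pinfty//.
    by rewrite lee_fin le_max lexx orbT.
  - exact: measurable_funTS.
  - by move=> E _ mE; rewrite fg.
have := ae_foralln H.
apply: filterS => x Hx.
have : (\bigcup_i F i) x by rewrite -TF.
by move=> [n _ /Hx ->].
Qed.

(** * Measurability of functionals of locally finite sets *)

Section point_measurability.
Context {R : realType} {n : nat}.

Lemma measurable_tuple_set1 (x : n.-tuple R) : measurable [set x].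
Proof.
rewrite (_ : [set x] = \bigcap_(i in [set: 'I_n]) ((fun y => tnth y i) @^-1` [set tnth x i])).
  apply: fin_bigcap_measurable => // i _; rewrite -[X in measurable X]setTI.
  exact: (measurable_tnth i).
apply/seteqP; split => [y -> i _//|y xy /=].
by apply: eq_from_tnth => i; exact: xy.
Qed.

Lemma measurable_eq_pt {d : measure_display} {T : measurableType d}
    (f g : T -> n.-tuple R) :
  measurable_fun setT f -> measurable_fun setT g ->
  measurable [set x | f x = g x].
Proof.
move=> /measurable_fun_tnthP mf /measurable_fun_tnthP mg.
rewrite (_ : [set x | _] =
    \bigcap_(i in [set: 'I_n]) [set x | tnth (f x) i = tnth (g x) i]).
  apply: fin_bigcap_measurable => // i _.
  have := measurable_fun_eqr (mf i) (mg i) measurableT (Y := [set true]) Logic.I.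
  rewrite setTI; congr (measurable _); apply/seteqP; split => x /=; first by move/eqP.
  by move=> ->; rewrite eqxx.
apply/seteqP; split => [y yE i _|y xy /=]; first by rewrite /= yE.
by apply: eq_from_tnth => i; exact: xy.
Qed.

End point_measurability.

Section counting_points.
Context {R : realType} {d : nat}.
Notation pts := (lfset R d).

Definition box (m : nat) : set (pt R d) := [set x | forall i, `|tnth x i| <= m%:R].

Lemma measurable_box m : measurable (box m).
Proof.
rewrite (_ : box m = \bigcap_(i in [set: 'I_d]) ((fun y => tnth y i) @^-1` [set r | `|r| <= m%:R])).
  apply: fin_bigcap_measurable => // i _; rewrite -[X in measurable X]setTI.
  apply: (measurable_tnth i) => //.
  rewrite (_ : [set r | _] = `[- m%:R, m%:R]%classic); first exact: measurable_itv.
  by apply/seteqP; split => r /=; rewrite in_itv/= ler_norml.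
by apply/seteqP; split => [y h i _//|y h i]; exact: h.
Qed.

Lemma nd_box : {homo box : a b / (a <= b)%N >-> a `<=` b}.
Proof. by move=> a b ab x h i; rewrite (le_trans (h i))// ler_nat. Qed.

Lemma bigcup_box : \bigcup_m box m = setT.
Proof.
apply/seteqP; split => // x _.
exists (Num.truncn (\sum_(i < d) `|tnth x i|)).+1 => // i.
apply: (le_trans _ (ltW (truncnS_gt _))).
by rewrite (bigD1 i)//= lerDl sumr_ge0.
Qed.

Lemma finite_box (Y : pts) m : finite_set (Y `&` box m).
Proof. exact: (lf_setP Y). Qed.

Lemma lfset_bigcup (Y : pts) : \bigcup_m (Y `&` box m) = Y.
Proof. by rewrite -setI_bigcupr bigcup_box setIT. Qed.

Lemma countable_lfset (Y : pts) : countable Y.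
Proof.
rewrite -lfset_bigcup; apply: bigcup_countable => // m _.
by apply: finite_set_countable; exact: finite_box.
Qed.

Lemma measurable_lfset (Y : pts) : measurable (Y : set (pt R d)).
Proof. by apply: countable_measurable (countable_lfset Y); exact: measurable_tuple_set1. Qed.

(** With a locally finite set seen as a measure, sums over its points become integrals, and their
    measurability in [Y] becomes a statement on kernels. *)
Definition ptcount (Y : pts) : {measure set (pt R d) -> \bar R} :=
  mrestr counting (measurable_lfset Y).

Lemma ptcountE (Y : pts) A : ptcount Y A = counting (Y `&` A).
Proof. by rewrite /ptcount /= /mrestr setIC. Qed.

Lemma ptcount_set1 (Y : pts) y : lf_set Y y -> ptcount Y [set y] = 1%E.
Proof.
move=> Yy; rewrite ptcountE (_ : _ `&` _ = [set y]); last first.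
  by apply/seteqP; split => [x []|x ->].
by rewrite /counting asboolT// fset_set1 finmap.cardfs1.
Qed.

(** The increments of [Y] along growing boxes are finite and disjoint, and on each of them the
    integral is a finite sum. The complement of [Y] is a null set of [ptcount Y]. *)
Lemma integral_ptcount (Y : pts) (f : pt R d -> \bar R) :
  measurable_fun setT f -> (forall x, 0 <= f x)%E ->
  (\int[ptcount Y]_y f y = \esum_(y in Y) f y)%E.
Proof.
move=> mf f0.
have mS1 := @measurable_tuple_set1 R d.
pose G m := Y `&` box m.
have GE : \bigcup_m seqD G m = Y by rewrite eq_bigcup_seqD lfset_bigcup.
have ndG : {homo G : a b / (a <= b)%N >-> (a <= b)%O}.
  by move=> a b ab; apply/subsetPset; apply: setIS; exact: nd_box.
have tG := trivIset_seqD ndG.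
have fG m : finite_set (seqD G m).
  apply: sub_finite_set (finite_box Y m).
  by case: m => [//|m] x /= [].
have mG m : measurable (seqD G m).
  by apply: countable_measurable => //; exact: finite_set_countable.
have step m : (\int[ptcount Y]_(x in seqD G m) f x = \esum_(x in seqD G m) f x)%E.
  rewrite esum_fset// fsbig_finite//=.
  have {1}-> : seqD G m = \big[setU/set0]_(x <- finmap.enum_fset (fset_set (seqD G m))) [set x].
    rewrite -bigcup_seq (_ : [set` _] = seqD G m); last by rewrite fset_setK.
    by apply/seteqP; split => [x Gx|x [y Gy /= ->]//]; exists x.
  rewrite ge0_integral_bigsetU//; last 2 first.
  - by apply/trivIsetP => i j _ _ ij; apply/seteqP; split => // x /= [-> /eqP]; rewrite (negPf ij).
  - exact: measurable_funTS.
  rewrite big_seq [RHS]big_seq; apply: eq_bigr => x.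
  rewrite in_fset_set// => /set_mem Gx.
  rewrite (_ : (\int[_]_(y in [set x]) f y = \int[ptcount Y]_(y in [set x]) cst (f x) y)%E).
    rewrite integral_cst// (_ : (ptcount Y : set _ -> _) _ = 1%E) ?mule1//.
    by apply: ptcount_set1; rewrite -GE; exists m.
  by apply: eq_integral => y /[!inE] ->.
have mY := measurable_lfset Y.
transitivity (\int[ptcount Y]_(y in Y) f y)%E.
  rewrite -[in LHS](setUv (Y : set (pt R d))) ge0_integral_setU//; last 3 first.
  - exact: measurableC.
  - by rewrite setUv.
  - by apply/disj_setPCl.
  rewrite [X in (_ + X)%E](_ : _ = 0%E) ?adde0//.
  apply: null_set_integral => //.
  - exact: measurableC.
  - exact: measurable_funTS.
  - by rewrite ptcountE setICr measure0.
rewrite -{1 2}GE nneseries_sum_bigcup//.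
under [RHS]eq_eseriesr do rewrite -step.
rewrite ge0_integral_bigcup//.
exact: measurable_funTS.
Qed.

Section measurable_esum.
Import HBNNSimple.
Context {dX : measure_display} {X : measurableType dX}.
Variable Y : X -> pts.
Hypothesis mY : measurable_fun setT Y.

Lemma measurable_count (B : set (pt R d)) : measurable B ->
  measurable_fun setT (fun Z : pts => counting (Z `&` B) : \bar R).
Proof.
move=> mB _ C mC; rewrite setTI.
by apply: sub_gen_smallest; exists B, C.
Qed.

Let k (x : X) : {measure set (pt R d) -> \bar R} := ptcount (Y x).

Let mk U : measurable U -> measurable_fun setT (k ^~ U).
Proof.
move=> mU; rewrite (_ : (fun x => k x U) = (fun Z : pts => counting (Z `&` U)) \o Y).
  by apply: measurableT_comp => //; exact: measurable_count.
by apply/funext => x; rewrite /= -ptcountE.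
Qed.

(** The sum is an integral of [f] against the kernel of points of [Y x]. Approximation by simple
    functions reduces the claim to the number of points in the sections of a measurable set. *)
Lemma measurable_esum_lfset (f : X * pt R d -> \bar R) :
  measurable_fun setT f -> (forall z, 0 <= f z)%E ->
  measurable_fun setT (fun x => \esum_(y in Y x) f (x, y))%E.
Proof.
move=> mf f0.
pose K : R.-ker X ~> pt R d := HB.pack k (isKernel.Build _ _ _ _ _ k mk).
rewrite (_ : (fun x => _) = (fun x => \int[K x]_y f (x, y))%E); last first.
  apply/funext => x; rewrite integral_ptcount//.
  exact: (measurableT_comp mf (measurable_pair1 x)).
pose h := nnsfun_approx measurableT mf.
apply: (@measurable_fun_xsection_integral _ _ _ _ _ f K h).
- by move=> a b ab; exact/nd_nnsfun_approx.
- by move=> z; exact: cvg_nnsfun_approx.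
move=> n r; set A := _ @^-1` _.
have mA : measurable A by rewrite /A; exact: measurable_sfunP.
(* The kernel may have infinite mass, while the result on sections is for finite measures: the
   points are restricted to [box m], and the limit in [m] restores all of them. *)
rewrite (_ : (fun x => _) = (fun x => limn_esup (fun m => mrestr (K x) (measurable_box m) (xsection A x)))).
  apply: measurable_fun_limn_esup => m.
  have [] // := @measurable_prod_subset_xsection_kernel _ _ _ _ _ K (box m) (measurable_box m) _ A mA.
  move=> x; have fin := finite_box (Y x) m.
  exists ((size (finmap.enum_fset (fset_set (Y x `&` box m))))%:R + 1) => U mU.
  rewrite /mrestr ptcountE.
  apply: (@le_lt_trans _ _ (counting (Y x `&` box m))).
    rewrite /counting !asboolT//; last by apply: sub_finite_set fin => y [? []].
    rewrite lee_fin ler_nat; apply: finmap.fsubset_leq_card.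
    rewrite -fset_set_sub//; first by move=> y [? []].
    by apply: sub_finite_set fin => y [? []].
  by rewrite /counting asboolT// lte_fin ltrDl.
apply/funext => x.
have mAx : measurable (xsection A x) by exact: measurable_xsection.
have cv : (mrestr (K x) (measurable_box m) (xsection A x) @[m --> \oo] --> K x (xsection A x))%E.
  rewrite /mrestr.
  have {2}-> : xsection A x = \bigcup_m (xsection A x `&` box m).
    by rewrite -setI_bigcupr bigcup_box setIT.
  apply: nondecreasing_cvg_mu.
  - by move=> m; apply: measurableI => //; exact: measurable_box.
  - by apply: bigcup_measurable => m _; apply: measurableI => //; exact: measurable_box.
  - by move=> a b ab; apply/subsetPset; apply: setIS; exact: nd_box.
rewrite is_cvg_limn_esupE; last by apply/cvg_ex; eexists; exact: cv.
by rewrite (cvg_lim _ cv).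
Qed.

End measurable_esum.

Lemma measurable_to_lfset {dX : measure_display} {X : measurableType dX}
    (F : X -> pts) :
  (forall B, measurable B ->
    measurable_fun setT (fun x => counting (F x `&` B) : \bar R)) ->
  measurable_fun setT F.
Proof.
move=> h; apply: (@measurability _ _ X pts setT F _ erefl).
move=> _ [_ [B [C [mB mC ->]]] <-].
exact: (h B mB measurableT C mC).
Qed.

Lemma esum_indic (Y : pts) (A : set (pt R d)) : measurable A ->
  counting (Y `&` A) = (\esum_(y in Y) (\1_A y)%:E)%E :> \bar R.
Proof.
move=> mA; rewrite -integral_ptcount//; last first.
  by apply/measurable_EFinP; exact: measurable_indic.
by rewrite integral_indic// setIT -ptcountE.
Qed.

Section measurable_lfset_maps.
Context {dX : measure_display} {X : measurableType dX}.
Variable Y : X -> pts.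
Hypothesis mY : measurable_fun setT Y.

Lemma measurable_lfI (A : X -> set (pt R d)) :
  measurable [set z : X * pt R d | A z.1 z.2] ->
  measurable_fun setT (fun x => lfI (Y x) (A x)).
Proof.
move=> mA; apply: measurable_to_lfset => B mB.
have mAx x : measurable (A x).
  rewrite (_ : A x = xsection [set z : X * pt R d | A z.1 z.2] x).
    exact: measurable_xsection.
  by apply/seteqP; split => y; rewrite /xsection /= inE.
rewrite (_ : (fun x => _) = (fun x => \esum_(y in Y x)
    (\1_([set z : X * pt R d | A z.1 z.2] `&` (snd @^-1` B)) (x, y))%:E : \bar R)%E).
  apply: (measurable_esum_lfset mY (f := fun z => (\1_([set z : X * pt R d | A z.1 z.2] `&` (snd @^-1` B)) z)%:E)) => //.
  apply/measurable_EFinP/measurable_indic/measurableI => //.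
  by rewrite -[X in measurable X]setTI; exact: measurable_snd.
apply/funext => x; rewrite /= -setIA esum_indic; last exact: measurableI.
apply: eq_esum => y _; congr (_%:E); rewrite !indicE.
Qed.

Lemma measurable_lf_translate (v : X -> pt R d) : measurable_fun setT v ->
  measurable_fun setT (fun x => lf_translate (v x) (Y x)).
Proof.
move=> mv; apply: measurable_to_lfset => B mB.
have mt : measurable_fun setT (fun z : X * pt R d => translate (v z.1) z.2).
  apply/measurable_fun_tnthP => i /=.
  rewrite [X in measurable_fun _ X](_ : _ = (fun z => tnth z.2 i + tnth (v z.1) i)).
    apply: measurable_funD.
      exact: (measurableT_comp (measurable_tnth i) measurable_snd).
    apply: (measurableT_comp (measurable_tnth i)).
    exact: (measurableT_comp mv measurable_fst).
  by apply/funext => z /=; rewrite tnth_mktuple.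
have mtB : measurable ((fun z : X * pt R d => translate (v z.1) z.2) @^-1` B).
  by rewrite -[X in measurable X]setTI; exact: mt.
rewrite (_ : (fun x => _) = (fun x => \esum_(y in Y x)
    (\1_((fun z : X * pt R d => translate (v z.1) z.2) @^-1` B) (x, y))%:E : \bar R)%E).
  apply: (measurable_esum_lfset mY (f := fun z => (\1_((fun z : X * pt R d => translate (v z.1) z.2) @^-1` B) z)%:E)) => //.
  exact/measurable_EFinP/measurable_indic.
apply/funext => x; rewrite esum_indic// esum_image//.
  move=> y z _ _ /(congr1 (fun t => tnth t)) yz.
  apply: eq_from_tnth => i; have := congr1 (@^~ i) yz.
  by rewrite !tnth_mktuple => /addIr.
Qed.

(** Membership means that the number of points of [Y x] equal to [v x] is nonzero, and this number
    is a measurable sum over [Y x]. *)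
Lemma measurable_mem_lfset (v : X -> pt R d) : measurable_fun setT v ->
  measurable [set x | lf_set (Y x) (v x)].
Proof.
move=> mv.
have mE : measurable [set z : X * pt R d | z.2 = v z.1].
  apply: measurable_eq_pt => //; exact: (measurableT_comp mv measurable_fst).
have mf : measurable_fun setT (fun x => \esum_(y in Y x)
    (\1_[set z : X * pt R d | z.2 = v z.1] (x, y))%:E : \bar R)%E.
  apply: (measurable_esum_lfset mY (f := fun z => (\1_[set z : X * pt R d | z.2 = v z.1] z)%:E)) => //.
  exact/measurable_EFinP/measurable_indic.
have := emeasurable_neq measurableT mf 0%E; rewrite setTI.
congr measurable; apply/seteqP; split => x /=; last first.
  move=> Yv; apply/eqP => /eqP; rewrite gt_eqF//.
  apply: (@lt_le_trans _ _ 1%E) => //; apply: esum_ge.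
  exists [set v x]; first by split => // _ ->.
  by rewrite fsbig_set1 indicE mem_set.
apply: contra_neqP => nYv; apply: esum1 => y Yy.
rewrite indicE memNset// => /= yv; apply: nYv; rewrite -yv.
exact: Yy.
Qed.

End measurable_lfset_maps.

(** Repetitions are allowed, unlike in [ktuples], so that a sum over tuples is an iterated sum over
    points; distinctness is imposed afterwards by an indicator. *)
Definition lftuples l (Z : pts) : set (l.-tuple (pt R d)) :=
  [set u | forall i, lf_set Z (tnth u i)].
Arguments lftuples : clear implicits.

Lemma esum_lftuplesS l (Z : pts) (f : l.+1.-tuple (pt R d) -> \bar R) :
  (forall u, 0 <= f u)%E ->
  (\esum_(u in lftuples l.+1 Z) f u =
   \esum_(y in Z) \esum_(u in lftuples l Z) f (tcons (y, u)))%E.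
Proof.
move=> f0; rewrite esum_esum//.
rewrite (reindex_esum ((Z : set _) `*`` fun=> lftuples l Z) _ (@tcons _ l)); first by apply: eq_esum => -[].
split.
- move=> [y u] [/= Zy Zu] i; have [j ->|->] := unliftP ord0 i.
    by rewrite tnthS; exact: Zu.
  by rewrite tnth0.
- move=> [y u] [y' u'] _ _ /(congr1 val) /= [-> uu'].
  by congr pair; exact: val_inj.
- move=> u Zu; exists (thead u, [tuple of behead u]).
    split => /=; first exact: Zu.
    by move=> i; rewrite tnth_behead; exact: Zu.
  by rewrite [RHS]tuple_eta.
Qed.

(** In the induction on [l] the first point of the tuple joins the parameter, which is why the
    parameter space is generalized. *)
Lemma measurable_esum_lftuples l {dX : measure_display} {X : measurableType dX}
    (Y : X -> pts) (f : X * l.-tuple (pt R d) -> \bar R) :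
  measurable_fun setT Y -> measurable_fun setT f -> (forall z, 0 <= f z)%E ->
  measurable_fun setT (fun x => \esum_(u in lftuples l (Y x)) f (x, u))%E.
Proof.
elim: l dX X Y f => [|l IH] dX X Y f mY mf f0.
  rewrite (_ : (fun x => _) = (fun x => f (x, [tuple]))).
    exact: (measurableT_comp mf (measurable_pair2 [tuple])).
  apply/funext => x; rewrite (_ : lftuples 0 _ = [set [tuple]]) ?esum_set1//.
  apply/seteqP; split => [u _|u _ [[]]//].
  by rewrite /= (tuple0 u).
rewrite (_ : (fun x => _) = (fun x => \esum_(y in Y x)
    \esum_(u in lftuples l (Y x)) f (x, tcons (y, u))))%E; last first.
  by apply/funext => x; rewrite esum_lftuplesS.
apply: (measurable_esum_lfset mY
  (f := fun z => \esum_(u in lftuples l (Y z.1)) f (z.1, tcons (z.2, u))))%E; last first.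
  by move=> z; apply: esum_ge0.
apply: (IH _ _ (Y \o fst) (fun z => f (z.1.1, tcons (z.1.2, z.2)))) => //.
  exact: measurableT_comp.
apply: (measurableT_comp mf); apply: measurable_fun_pair.
  exact: (measurableT_comp measurable_fst measurable_fst).
apply: measurable_cons; last exact: measurable_snd.
exact: (measurableT_comp measurable_snd measurable_fst).
Qed.

End counting_points.

Arguments lftuples {R d} l Z _.

(** * Campbell's formula *)

(** For finite nonzero [c] the inequality [half] is used for [c] and for its inverse. For infinite
    [c] both sides are infinite as soon as one term is nonzero. *)
Lemma ge0_esumZl {R : realType} {T : choiceType} (I : set T) (c : \bar R)
    (a : T -> \bar R) : (0 <= c)%E -> (forall i, 0 <= a i)%E ->
  (c * (\esum_(i in I) a i) = \esum_(i in I) (c * a i))%E.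
Proof.
move=> c0 a0.
have half (r : R) (b : T -> \bar R) : 0 <= r -> (forall i, 0 <= b i)%E ->
    (\esum_(i in I) (r%:E * b i) <= r%:E * \esum_(i in I) b i)%E.
  move=> r0 b0; apply: ge_ereal_sup => _ [F [finF FI] <-].
  rewrite -ge0_mule_fsumr//.
  by apply: lee_wpmul2l; rewrite ?lee_fin//; apply: esum_ge; exists F.
case: c c0 => [r r0|_|//].
- rewrite lee_fin in r0; apply/eqP; rewrite eq_le half// andbT.
  have [->|rn0] := eqVneq r 0.
    by rewrite mul0e; apply: esum_ge0 => i _; rewrite mul0e.
  have ri0 : 0 <= r^-1 by rewrite invr_ge0.
  have := half r^-1 (fun i => r%:E * a i)%E ri0.
  rewrite (_ : \esum_(i in I) _ = \esum_(i in I) a i)%E; last first.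
    by apply: eq_esum => i _; rewrite muleA -EFinM mulVf// mul1e.
  have r0e : (0 <= r%:E)%E by rewrite lee_fin.
  move=> /(_ (fun i => mule_ge0 r0e (a0 i))).
  by move/(lee_wpmul2l (x := r%:E) r0e); rewrite muleA -EFinM mulfV// mul1e.
- have [[i Ii ai]|H] := pselect (exists2 i, I i & a i != 0%E).
    have ai0 : (0 < a i)%E by rewrite lt_neqAle eq_sym ai a0.
    rewrite gt0_mulye; last first.
      apply: (lt_le_trans ai0); apply: esum_ge; exists [set i].
        by split => // _ ->.
      by rewrite fsbig_set1.
    apply/esym/eqP; rewrite -leye_eq; apply: esum_ge; exists [set i].
      by split => // _ ->.
    by rewrite fsbig_set1 gt0_mulye.
  have az i : I i -> a i = 0%E.
    by move=> Ii; apply/eqP; apply: contraPT isT => nz _; apply: H; exists i.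
  by rewrite [X in (_ * X)%E]esum1// mule0 esum1// => i /az ->; rewrite mule0.
Qed.

Lemma measurable_ktuples {R : realType} {d k : nat} {dX : measure_display}
    {T : measurableType dX} (Y : T -> lfset R d) (w : T -> k.-tuple (pt R d)) :
  measurable_fun setT Y -> measurable_fun setT w ->
  measurable [set t | ktuples k (Y t) (w t)].
Proof.
move=> mY mw.
have mwi i : measurable_fun setT (fun t => tnth (w t) i).
  exact: (measurableT_comp (measurable_tnth i) mw).
rewrite (_ : [set t | _] =
   (\bigcap_(ij in [set ij : 'I_k * 'I_k | ij.1 != ij.2])
      ~` [set t | tnth (w t) ij.1 = tnth (w t) ij.2]) `&`
   \bigcap_(i in [set: 'I_k]) [set t | lf_set (Y t) (tnth (w t) i)]).
  apply: measurableI; apply: fin_bigcap_measurable => // i _.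
    by apply: measurableC; exact: measurable_eq_pt.
  exact: measurable_mem_lfset.
apply/seteqP; split => t /= [H1 H2]; split => //.
- by move=> ij /= nij /tuple_uniqP -/(_ H1) => e; rewrite e eqxx in nij.
- by move=> i _; exact: H2.
- apply/tuple_uniqP => a b ab; apply/eqP; apply: contraT => nab.
  by have := H1 (a, b) nab; rewrite /= ab.
- by move=> i; exact: H2.
Qed.

Section palm_campbell.
Context {dd : measure_display} {Omega : measurableType dd} {R : realType}.
Variables (P : probability Omega R) (d : nat) (X : {RV P >-> lfset R d})
  (rho : forall k : nat, k.-tuple (pt R d) -> R)
  (palm : forall k : nat, R.-pker (k.-tuple (pt R d)) ~> lfset R d).
Hypothesis corr : forall k, (1 <= k)%N -> correlation_function X (@rho k).
Hypothesis palmP : forall k, (1 <= k)%N -> palm_version X (palm k).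

Lemma measurable_integral_palm k (f : k.-tuple (pt R d) * lfset R d -> \bar R) :
  measurable_fun setT f -> (forall z, 0 <= f z)%E ->
  measurable_fun setT (fun x => \int[palm k x]_Y f (x, Y))%E.
Proof.
by move=> mf f0; exact: (measurable_fun_integral_sfinite_kernel f (palm k)).
Qed.

Lemma campbell k (f : k.-tuple (pt R d) * lfset R d -> \bar R) : (1 <= k)%N ->
  measurable_fun setT f -> (forall z, 0 <= f z)%E ->
  ((\int[P]_w \esum_(x in ktuples k (X w)) f (x, X w)) =
   \int[lebk R d k]_x ((\int[palm k x]_Y f (x, Y)) * (rho x)%:E))%E.
Proof.
move=> k1 mf f0; rewrite (palmP k1)//.
have [mrho rho0 _ rhoE] := corr k1.
apply: integral_density => //; first exact: measurable_integral_palm.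
by move=> x; apply: integral_ge0.
Qed.

Section joined.
Variables (k L J : nat) (j : k.-tuple (pt R d) -> L.-tuple (pt R d) -> J.-tuple (pt R d))
  (p1 : J.-tuple (pt R d) -> k.-tuple (pt R d))
  (p2 : J.-tuple (pt R d) -> L.-tuple (pt R d)).
Hypotheses (k1 : (1 <= k)%N) (J1 : (1 <= J)%N).
Hypothesis mj : measurable_fun setT
  (fun z : k.-tuple (pt R d) * L.-tuple (pt R d) => j z.1 z.2).
Hypothesis mp1 : measurable_fun setT p1.
Hypotheses (jp : forall w, j (p1 w) (p2 w) = w) (p1j : forall x u, p1 (j x u) = x)
  (p2j : forall x u, p2 (j x u) = u).
Hypothesis jmem : forall x u (Z : set (pt R d)),
  ktuples J Z (j x u) -> ktuples k Z x /\ (forall i, Z (tnth u i)).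
Hypothesis fj : factors (lebk R d k) (lebk R d L) (lebk R d J) j.

(* Here [j x u] is [tcat x u], or [tcat4 x u] for two clusters. *)
Definition joint_sum (G : J.-tuple (pt R d) -> \bar R) (x : k.-tuple (pt R d))
    (Y : lfset R d) : \bar R :=
  (\esum_(u in [set u | ktuples J Y (j x u)]) G (j x u))%E.

Lemma joint_sum_ge0 G x Y : (forall w, 0 <= G w)%E -> (0 <= joint_sum G x Y)%E.
Proof. by move=> G0; apply: esum_ge0 => u _. Qed.

Lemma measurable_joint_sum {dX : measure_display} {T : measurableType dX}
    (G : J.-tuple (pt R d) -> \bar R) (x : T -> k.-tuple (pt R d))
    (Y : T -> lfset R d) :
  measurable_fun setT G -> (forall w, 0 <= G w)%E ->
  measurable_fun setT x -> measurable_fun setT Y ->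
  measurable_fun setT (fun t => joint_sum G (x t) (Y t)).
Proof.
move=> mG G0 mx mY.
pose D := [set z : T * L.-tuple (pt R d) | ktuples J (Y z.1) (j (x z.1) z.2)].
have mjz : measurable_fun setT (fun z : T * L.-tuple (pt R d) => j (x z.1) z.2).
  apply: (measurableT_comp mj (g := fun z : T * L.-tuple (pt R d) => (x z.1, z.2))).
  apply: measurable_fun_pair => //.
  exact: (measurableT_comp mx measurable_fst).
have mD : measurable D.
  apply: measurable_ktuples => //; exact: (measurableT_comp mY measurable_fst).
rewrite (_ : (fun t => _) = (fun t => \esum_(u in lftuples L (Y t))
    (G (j (x t) u) * (\1_D (t, u))%:E)))%E.
  apply: (measurable_esum_lftuples (f := fun z => G (j (x z.1) z.2) * (\1_D z)%:E))%E => //.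
    apply: emeasurable_funM; first exact: (measurableT_comp mG mjz).
    exact/measurable_EFinP/measurable_indic.
  by move=> z; rewrite mule_ge0// lee_fin.
apply/funext => t; rewrite /joint_sum esum_mkcond [RHS]esum_mkcond.
apply: eq_esum => u _; rewrite indicE.
case: ifPn => [/set_mem H|/negP nD].
  have [_ uY] := jmem H.
  by rewrite !mem_set// mule1.
rewrite (memNset (A := D)) ?mule0; first by case: ifP.
by move=> H'; apply: nD; exact: mem_set.
Qed.

(** The map [j] is a bijection from base tuples with their extensions onto the [J]-tuples of [Y],
    and [p1] recovers the base tuple on which [g] depends. *)
Lemma esum_joint_sum (G : J.-tuple (pt R d) -> \bar R)
    (g : k.-tuple (pt R d) -> \bar R) (Y : lfset R d) :
  (forall w, 0 <= G w)%E -> (forall w, 0 <= g w)%E ->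
  (\esum_(x in ktuples k Y) (g x * joint_sum G x Y) =
   \esum_(w in ktuples J Y) (g (p1 w) * G w))%E.
Proof.
move=> G0 g0.
have -> : (\esum_(x in ktuples k Y) (g x * joint_sum G x Y) =
  \esum_(x in ktuples k Y) \esum_(u in [set u | ktuples J Y (j x u)]) (g x * G (j x u)))%E.
  by apply: eq_esum => x _; rewrite ge0_esumZl.
rewrite esum_esum; last by move=> *; exact: mule_ge0.
rewrite (reindex_esum (ktuples k Y `*`` fun x => [set u | ktuples J Y (j x u)]) _
  (fun z => j z.1 z.2)).
  by apply: eq_esum => -[x u] _ /=; rewrite p1j.
split.
- by move=> [x u] [].
- move=> [x u] [x' u'] _ _ /= e; congr pair.
    by rewrite -(p1j x u) e p1j.
  by rewrite -(p2j x u) e p2j.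
- move=> w Yw; exists (p1 w, p2 w) => /=; last by rewrite jp.
  by rewrite jp; split => //; move: Yw; rewrite -{1}(jp w) => /jmem[].
Qed.

(** Both sides are integrated over a test set [B]. Campbell's formula of order [k] turns the left
    side into a sum over base tuples and extensions, that is over [J]-tuples; Campbell's formula of
    order [J] and Tonelli's formula then give the right side. The bound [c] is what the comparison
    of integrands asks for. *)
Lemma palm_joint_sum (G : J.-tuple (pt R d) -> \bar R) (c : R) :
  measurable_fun setT G -> (forall w, 0 <= G w)%E ->
  {ae lebk R d k, forall x,
    (\int[lebk R d L]_u (G (j x u) * (rho (j x u))%:E) <= c%:E)%E} ->
  {ae lebk R d k, forall x,
    ((\int[palm k x]_Y joint_sum G x Y) * (rho x)%:E =
     \int[lebk R d L]_u (G (j x u) * (rho (j x u))%:E))%E}.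
Proof.
move=> mG G0 Gc.
have [mrhok rhok0 _ _] := corr k1.
have [mrhoJ rhoJ0 _ _] := corr J1.
have mS : measurable_fun setT (fun z : k.-tuple (pt R d) * lfset R d => joint_sum G z.1 z.2).
  exact: measurable_joint_sum.
have S0 z Y : (0 <= joint_sum G z Y)%E by exact: joint_sum_ge0.
have mGrho : measurable_fun setT (fun w => G w * (rho w)%:E)%E.
  by apply: emeasurable_funM => //; exact/measurable_EFinP.
have mGj : measurable_fun setT (fun z : k.-tuple (pt R d) * L.-tuple (pt R d) =>
    G (j z.1 z.2) * (rho (j z.1 z.2))%:E)%E.
  exact: (measurableT_comp mGrho mj).
have Grho0 w : (0 <= G w * (rho w)%:E)%E by rewrite mule_ge0// lee_fin.
have mpalm := measurable_integral_palm mS (fun z => S0 _ _).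
apply: (ae_eq_of_integrals (mu := lebk R d k) (c := c)) => //.
- by apply: emeasurable_funM => //; exact/measurable_EFinP.
- exact: (@measurable_fun_fubini_tonelli_F _ _ _ _ _ (lebk R d L) _ mGj).
- by move=> x; rewrite mule_ge0 ?lee_fin//; exact: integral_ge0.
- by move=> x; exact: integral_ge0.
move=> B mB; rewrite integral_mkcond [RHS]integral_mkcond.
have mB1 : measurable_fun setT (fun x => (\1_B x)%:E : \bar R).
  exact/measurable_EFinP/measurable_indic.
have E1 : (\int[lebk R d k]_x (((fun x => (\int[palm k x]_Y joint_sum G x Y) * (rho x)%:E) \_ B) x) =
   \int[P]_w \esum_(x in ktuples k (X w)) ((\1_B x)%:E * joint_sum G x (X w)))%E.
  rewrite (campbell (f := fun z => (\1_B z.1)%:E * joint_sum G z.1 z.2)%E)//; last 2 first.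
  - by apply: emeasurable_funM => //; exact: (measurableT_comp mB1 measurable_fst).
  - by move=> z; rewrite mule_ge0// lee_fin.
  apply: eq_integral => x _; rewrite patchE /=.
  rewrite ge0_integralZl//; last exact: (measurableT_comp mS (measurable_pair1 x)).
  by rewrite indicE; case: ifPn => _; rewrite ?mul1e ?mul0e.
rewrite [LHS]E1.
transitivity (\int[P]_w
    (\esum_(w' in ktuples J (X w)) ((\1_B (p1 w'))%:E * G w')))%E.
  apply: eq_integral => w _.
  by rewrite (esum_joint_sum (g := fun x => (\1_B x)%:E)).
have mB2 : measurable_fun setT (fun w => (\1_B (p1 w))%:E : \bar R).
  exact: (measurableT_comp mB1 mp1).
rewrite (campbell (f := fun z => (\1_B (p1 z.1))%:E * G z.1)%E)//; last 2 first.
- apply: (@emeasurable_funM _ _ _ _ (fun z => (\1_B (p1 z.1))%:E) (fun z => G z.1)).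
    exact: (measurableT_comp mB2 measurable_fst).
  exact: (measurableT_comp mG measurable_fst).
- by move=> z; rewrite mule_ge0// lee_fin.
transitivity (\int[lebk R d J]_w ((\1_B (p1 w))%:E * (G w * (rho w)%:E)))%E.
  (* The summand does not depend on the configuration, and a Palm probability has total mass one. *)
  apply: eq_integral => w _; rewrite /= integral_cst// prob_kernel mule1.
  by rewrite muleA.
rewrite fj; last 2 first.
- by apply: emeasurable_funM => //.
- by move=> w; rewrite mule_ge0// lee_fin.
apply: eq_integral => x _; rewrite patchE /=.
under eq_integral do rewrite p1j.
rewrite ge0_integralZl//; last exact: (measurableT_comp mGj (measurable_pair1 x)).
by rewrite indicE; case: ifPn => _; rewrite ?mul1e ?mul0e.
Qed.

End joined.
End palm_campbell.

(** * Distances and volumes *)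

Section distance.
Context {R : realType} {d : nat}.
Implicit Types x y z : pt R d.

(** Lagrange's identity: twice the defect is the sum of the squares of the minors. *)
Let cauchy_schwarz (a b : 'I_d -> R) :
  (\sum_i a i * b i) ^+ 2 <= (\sum_i a i ^+ 2) * (\sum_i b i ^+ 2).
Proof.
have E : \sum_i \sum_j (a i * b j - a j * b i) ^+ 2 =
    2 * ((\sum_i a i ^+ 2) * (\sum_i b i ^+ 2) - (\sum_i a i * b i) ^+ 2).
  have -> : \sum_i \sum_j (a i * b j - a j * b i) ^+ 2 =
     \sum_i \sum_j (a i ^+ 2 * b j ^+ 2) + \sum_i \sum_j (a j ^+ 2 * b i ^+ 2)
     - 2 * \sum_i \sum_j ((a i * b i) * (a j * b j)).
    rewrite mulr_sumr -big_split -sumrB /=; apply: eq_bigr => i _.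
    rewrite mulr_sumr -big_split -sumrB /=; apply: eq_bigr => j _.
    by ring.
  rewrite [X in _ + X - _]exchange_big /= expr2.
  by rewrite -!big_distrlr /=; ring.
rewrite -subr_ge0 -(@pmulr_rge0 _ 2)// -E.
by apply: sumr_ge0 => i _; apply: sumr_ge0 => j _; exact: sqr_ge0.
Qed.

Lemma dist_ge0 x y : 0 <= dist x y.
Proof. exact: sqrtr_ge0. Qed.

Lemma distC x y : dist x y = dist y x.
Proof.
by rewrite /dist; congr Num.sqrt; apply: eq_bigr => i _; rewrite -sqrrN opprB.
Qed.

Lemma distxx x : dist x x = 0.
Proof.
by rewrite /dist big1 ?sqrtr0// => i _; rewrite subrr expr0n.
Qed.

Lemma dist_triangle y x z : dist x z <= dist x y + dist y z.
Proof.
rewrite -ler_sqr ?nnegrE ?addr_ge0 ?dist_ge0//.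
set a := fun i => tnth x i - tnth y i; set b := fun i => tnth y i - tnth z i.
have A0 : 0 <= \sum_i a i ^+ 2 by apply: sumr_ge0 => i _; exact: sqr_ge0.
have B0 : 0 <= \sum_i b i ^+ 2 by apply: sumr_ge0 => i _; exact: sqr_ge0.
rewrite sqrrD /dist !sqr_sqrtr//; last by apply: sumr_ge0 => i _; exact: sqr_ge0.
rewrite -/(a _) (_ : \sum_i (tnth x i - tnth z i) ^+ 2 =
  \sum_i a i ^+ 2 + (\sum_i a i * b i) *+ 2 + \sum_i b i ^+ 2); last first.
  rewrite -sumrMnl -!big_split /=; apply: eq_bigr => i _.
  by rewrite -sqrrD /a /b addrA subrK.
rewrite lerD2r lerD2l ler_pMn2r// -sqrtrM//.
apply: (le_trans (ler_norm _)); rewrite -sqrtr_sqr ler_sqrt//.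
exact: mulr_ge0.
Qed.

Lemma coord_le_dist x y i : `|tnth x i - tnth y i| <= dist x y.
Proof.
rewrite -sqrtr_sqr ler_sqrt//; last by apply: sumr_ge0 => j _; exact: sqr_ge0.
by rewrite (bigD1 i)//= lerDl; apply: sumr_ge0 => j _; exact: sqr_ge0.
Qed.

Lemma measurable_dist {dX : measure_display} {T : measurableType dX}
    (f g : T -> pt R d) : measurable_fun setT f -> measurable_fun setT g ->
  measurable_fun setT (fun s => dist (f s) (g s)).
Proof.
move=> /measurable_fun_tnthP mf /measurable_fun_tnthP mg.
apply: (measurableT_comp (continuous_measurable_fun (@sqrt_continuous R))).
apply: measurable_sum => i; apply: measurable_funX.
apply: measurable_funB; [exact: mf | exact: mg].
Qed.

Section separation.
Variables (p q : nat).
Implicit Type w : (p + q).-tuple (pt R d).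

Let seps w := [set s | exists (i : 'I_p) (j : 'I_q),
  s = dist (tnth (tfst w) i) (tnth (tsnd w) j)].

Lemma sep_le w i j : sep w <= dist (tnth (tfst w) i) (tnth (tsnd w) j).
Proof.
apply: (@ge_inf _ (seps w)); last by exists i, j.
by exists 0 => _ [i' [j' ->]]; exact: dist_ge0.
Qed.

Lemma sep_ge w s : (1 <= p)%N -> (1 <= q)%N ->
  (forall i j, s <= dist (tnth (tfst w) i) (tnth (tsnd w) j)) -> s <= sep w.
Proof.
move=> p1 q1 h; apply: (@lb_le_inf _ (seps w)).
  by exists (dist (tnth (tfst w) (Ordinal p1)) (tnth (tsnd w) (Ordinal q1))), (Ordinal p1), (Ordinal q1).
by move=> _ [i [j ->]].
Qed.

(** If one block is empty, [sep] is the infimum of the empty set, which is 0 by convention. *)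
Lemma sep_ge0 w : 0 <= sep w.
Proof.
have [e|/set0P ne] := eqVneq (seps w) set0.
  by rewrite /sep -/(seps w) e inf0.
case: ne => _ [i [j _]].
apply: sep_ge => [||i' j']; [by case: p i => [[]|] | by case: q j => [[]|] |].
exact: dist_ge0.
Qed.

End separation.
End distance.

Section volume.
Context {dm : measure_display} {T : measurableType dm} {R : realType}.
Variable m : {sigma_finite_measure set T -> \bar R}.

Lemma measurable_tuple_box n (A : 'I_n -> set T) : (forall i, measurable (A i)) ->
  measurable [set u : n.-tuple T | forall i, A i (tnth u i)].
Proof.
move=> mA.
rewrite (_ : [set u | _] = \bigcap_(i in [set: 'I_n]) ((fun u => tnth u i) @^-1` A i)).
  apply: fin_bigcap_measurable => // i _; rewrite -[X in measurable X]setTI.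
  exact: (measurable_tnth i).
by apply/seteqP; split => [y h i _|y h i]; exact: h.
Qed.

Lemma powm_box n (A : 'I_n -> set T) : (forall i, measurable (A i)) ->
  powm m n [set u | forall i, A i (tnth u i)] = (\prod_(i < n) m (A i))%E.
Proof.
elim: n A => [|n IH] A mA.
  by rewrite big_ord0 /= diracE mem_set// => -[].
have mB := measurable_tuple_box mA.
have mA' i : measurable (A (lift ord0 i)) by [].
have mB' := measurable_tuple_box mA'.
rewrite big_ord_recl -(IH (fun i => A (lift ord0 i)))//.
transitivity (\int[powm m n.+1]_u (\1_[set u : n.+1.-tuple T | forall i, A i (tnth u i)] u)%:E)%E.
  by rewrite integral_indic// setIT.
rewrite factors_tcons//; last exact/measurable_EFinP/measurable_indic.
under eq_integral => x _.
  rewrite (eq_integral (fun u => (\1_(A ord0) x)%:E *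
      (\1_[set u : n.-tuple T | forall i, A (lift ord0 i) (tnth u i)] u)%:E)%E); last first.
    move=> u _; rewrite -EFinM !indicE -natrM mulnb; congr ((nat_of_bool _)%:R%:E).
    apply/idP/andP => [/set_mem h|[/set_mem h0 /set_mem h]].
      split; apply: mem_set; first by have := h ord0; rewrite tnth0.
      by move=> i; have := h (lift ord0 i); rewrite tnthS.
    apply: mem_set => i; have [j ->|->] := unliftP ord0 i; last by rewrite tnth0.
    by rewrite tnthS; exact: h.
  rewrite ge0_integralZl//; last exact/measurable_EFinP/measurable_indic.
  rewrite integral_indic// setIT muleC.
  over.
rewrite ge0_integralZl//; last exact/measurable_EFinP/measurable_indic.
by rewrite integral_indic// setIT muleC.
Qed.

End volume.

Section near_points.
Context {R : realType} {d : nat}.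

Definition near_points p (t : R) (x : p.-tuple (pt R d)) : set (pt R d) :=
  [set y | exists i, dist (tnth x i) y <= t].

Definition near_tuples p l (t : R) (x : p.-tuple (pt R d)) : set (l.-tuple (pt R d)) :=
  [set u | forall i, near_points t x (tnth u i)].

Arguments near_tuples {p} l t x _.

Lemma near_pointsE p (t : R) (x : p.-tuple (pt R d)) :
  near_points t x = \big[setU/set0]_(i < p) cball (tnth x i) t.
Proof.
rewrite -bigcup_seq; apply/seteqP; split => [y [i h]|y [i _ h]]; exists i => //=.
by rewrite mem_index_enum.
Qed.

Lemma measurable_cball (x : pt R d) (t : R) : measurable (cball x t).
Proof.
have := measurable_dist (f := fun=> x) (g := id) (measurable_cst _) (@measurable_id _ _ _).
move=> /(_ measurableT `]-oo, t]%classic (measurable_itv _)).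
by rewrite setTI; congr measurable; apply/seteqP; split => y /=; rewrite in_itv.
Qed.

Lemma measurable_near_points p (t : R) (x : p.-tuple (pt R d)) :
  measurable (near_points t x).
Proof.
by rewrite near_pointsE; apply: bigsetU_measurable => i _; exact: measurable_cball.
Qed.

Lemma measurable_near_tuples p l (t : R) (x : p.-tuple (pt R d)) :
  measurable (near_tuples l t x).
Proof. exact: (measurable_tuple_box (fun=> measurable_near_points t x)). Qed.

(** The ball lies in a cube of side [2 * t]. Only the power of [t] will matter, not the constant. *)
Lemma leb_cball_le (x : pt R d) (t : R) : 0 <= t ->
  (leb R d (cball x t) <= ((2 * t) ^+ d)%:E)%E.
Proof.
move=> t0; pose A (i : 'I_d) := `[tnth x i - t, tnth x i + t]%classic.
have mA i : measurable (A i) by exact: measurable_itv.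
apply: (@le_trans _ _ (leb R d [set u | forall i, A i (tnth u i)])).
  apply: le_measure; rewrite ?inE; [exact: measurable_cball|exact: measurable_tuple_box|].
  move=> y xy i; rewrite /A /= in_itv /=.
  have := le_trans (coord_le_dist x y i) xy.
  by rewrite ler_distlC addrC; lra.
rewrite /leb powm_box//.
rewrite (eq_bigr (fun=> (2 * t)%:E)); last first.
  move=> i _; rewrite /= /lebR /A lebesgue_measure_itv /= lte_fin.
  case: ifPn => [_|]; first by rewrite -EFinD; congr EFin; lra.
  by rewrite -leNgt => h; congr EFin; lra.
by rewrite prodEFin prodr_const card_ord.
Qed.

(** Only an upper bound for the volume of [p] balls of radius [t]: the balls are replaced by cubes
    and may overlap. *)
Definition near_volume p (t : R) : R := p%:R * (2 * t) ^+ d.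

Lemma near_volume_ge0 p (t : R) : 0 <= t -> 0 <= near_volume p t.
Proof. by move=> t0; rewrite mulr_ge0// exprn_ge0// mulr_ge0. Qed.

Lemma leb_near_points p (t : R) (x : p.-tuple (pt R d)) : 0 <= t ->
  (leb R d (near_points t x) <= (near_volume p t)%:E)%E.
Proof.
move=> t0; rewrite near_pointsE.
apply: (@le_trans _ _ (\sum_(i < p) leb R d (cball (tnth x i) t))%E).
  pose F k := if insub k is Some i then cball (tnth x i) t else set0.
  have FE (i : 'I_p) : F i = cball (tnth x i) t by rewrite /F valK.
  rewrite (eq_bigr (fun i : 'I_p => F i))// [leRHS](eq_bigr (fun i : 'I_p => leb R d (F i))); last first.
    by move=> i _; rewrite FE.
  apply: Boole_inequality => k kp; rewrite -[k]/(val (Ordinal kp)) FE.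
  exact: measurable_cball.
apply: (@le_trans _ _ (\sum_(i < p) ((2 * t) ^+ d)%:E)%E).
  by apply: lee_sum => i _; exact: leb_cball_le.
by rewrite sumEFin lee_fin sumr_const card_ord /near_volume [leRHS]mulr_natl.
Qed.

Lemma lebk_near_tuples p l (t : R) (x : p.-tuple (pt R d)) : 0 <= t ->
  (lebk R d l (near_tuples l t x) <= (near_volume p t ^+ l)%:E)%E.
Proof.
move=> t0; rewrite /lebk /near_tuples (powm_box (leb R d) (fun=> measurable_near_points t x)).
apply: (@le_trans _ _ (\prod_(i < l) (near_volume p t)%:E)%E); last first.
  by rewrite prodEFin prodr_const card_ord.
suff /andP[] : (0 <= \prod_(i < l) leb R d (near_points t x) <=
    \prod_(i < l) (near_volume p t)%:E)%E by [].
elim/big_ind2 : _ => //; last by move=> i _; rewrite measure_ge0 leb_near_points.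
  by rewrite lexx andbT lee_fin.
move=> a b a' b' /andP[a0 ab] /andP[a'0 ab']; rewrite mule_ge0//.
exact: lee_pmul.
Qed.

End near_points.
Arguments near_tuples {R d p} l t x _.
Arguments near_volume {R} d p t.

(** * Expansions over additional points *)

Lemma ge0_nneseriesZl {R : realType} (c : \bar R) (a : nat -> \bar R) :
  (0 <= c)%E -> (forall i, 0 <= a i)%E ->
  (c * \sum_(i <oo) a i = \sum_(i <oo) (c * a i))%E.
Proof.
move=> c0 a0; rewrite !nneseries_esumT//; first exact: ge0_esumZl.
by move=> i; exact: mule_ge0.
Qed.

Lemma ge0_nneseriesZr {R : realType} (c : \bar R) (a : nat -> \bar R) :
  (0 <= c)%E -> (forall i, 0 <= a i)%E ->
  ((\sum_(i <oo) a i) * c = \sum_(i <oo) (a i * c))%E.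
Proof.
move=> c0 a0; rewrite muleC ge0_nneseriesZl//.
by apply: eq_eseriesr => i _; rewrite muleC.
Qed.

Section ktuples_tcat.
Context {R : realType} {d : nat}.

Lemma ktuples_tcat p q (Z : set (pt R d)) (x : p.-tuple (pt R d))
    (y : q.-tuple (pt R d)) :
  ktuples (p + q) Z (tcat x y) <->
  [/\ ktuples p Z x, ktuples q Z y & forall i j, tnth x i <> tnth y j].
Proof.
split=> [[]|[[ux Zx] [uy Zy] xy]].
  rewrite cat_uniq => /and3P[ux /hasPn xy uy] Zxy; split.
  - by split => // i; have := Zxy (lshift q i); rewrite tnth_lshift.
  - by split => // i; have := Zxy (rshift p i); rewrite tnth_rshift.
  - by move=> i j e; have := xy _ (mem_tnth j y); rewrite /= -e mem_tnth.
split.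
  rewrite cat_uniq ux uy andbT /=; apply/hasPn => _ /tnthP[j ->] /=.
  by apply/negP => /tnthP[i /esym]; exact: xy.
by move=> a; case: (split_ordP a) => i ->; rewrite ?tnth_lshift ?tnth_rshift.
Qed.

Lemma ktuples_tcat_mem p q (x : p.-tuple (pt R d)) (u : q.-tuple (pt R d))
    (Z : set (pt R d)) :
  ktuples (p + q) Z (tcat x u) -> ktuples p Z x /\ (forall i, Z (tnth u i)).
Proof. by move=> /ktuples_tcat[? [_ ?] _]. Qed.

Lemma ktuples_tcat4 p q l1 l2 (z : (p + q).-tuple (pt R d))
    (u : (l1 + l2).-tuple (pt R d)) (Z : set (pt R d)) :
  ktuples _ Z (tcat4 z u) -> ktuples (p + q) Z z /\ (forall i, Z (tnth u i)).
Proof.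
move=> /ktuples_tcat[/ktuples_tcat[xZ [_ yZ] xy] /ktuples_tcat[x'Z [_ y'Z] xy'] zz].
split.
  rewrite -[z]tcatK; apply/ktuples_tcat; split => // i j.
  by have := zz (lshift _ i) (lshift _ j); rewrite !tnth_lshift.
rewrite -[u]tcatK => a; case: (split_ordP a) => i ->.
  by rewrite tnth_lshift.
by rewrite tnth_rshift.
Qed.

Lemma near_tcat p l t (x : p.-tuple (pt R d)) (u : l.-tuple (pt R d)) a :
  0 <= t -> near_tuples l t x u -> exists i, dist (tnth x i) (tnth (tcat x u) a) <= t.
Proof.
move=> t0 xu; case: (split_ordP a) => i ->.
  by exists i; rewrite tnth_lshift distxx.
by have [k xk] := xu i; exists k; rewrite tnth_rshift.
Qed.

(** Every entry of an enlarged cluster, old or new, is within [t] of an entry of the original one,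
    so two triangle inequalities lose [2 * t]. *)
Lemma dist_tcat4 p q l1 l2 t (z : (p + q).-tuple (pt R d))
    (u : (l1 + l2).-tuple (pt R d)) a b : 0 <= t ->
  near_tuples l1 t (tfst z) (tfst u) -> near_tuples l2 t (tsnd z) (tsnd u) ->
  sep z - 2 * t <=
    dist (tnth (tcat (tfst z) (tfst u)) a) (tnth (tcat (tsnd z) (tsnd u)) b).
Proof.
move=> t0 n1 n2.
have [i xi] := near_tcat a t0 n1; have [j xj] := near_tcat b t0 n2.
have := sep_le z i j.
have := dist_triangle (tnth (tcat (tfst z) (tfst u)) a) (tnth (tfst z) i) (tnth (tsnd z) j).
have := dist_triangle (tnth (tcat (tsnd z) (tsnd u)) b)
  (tnth (tcat (tfst z) (tfst u)) a) (tnth (tsnd z) j).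
rewrite (distC (tnth (tcat (tsnd z) (tsnd u)) b) (tnth (tsnd z) j)).
lra.
Qed.

Lemma sep_tcat4 p q l1 l2 t (z : (p + q).-tuple (pt R d))
    (u : (l1 + l2).-tuple (pt R d)) : (1 <= p)%N -> (1 <= q)%N -> 0 <= t ->
  near_tuples l1 t (tfst z) (tfst u) -> near_tuples l2 t (tsnd z) (tsnd u) ->
  sep z - 2 * t <= sep (tcat4 z u).
Proof.
move=> p1 q1 t0 n1 n2; apply: sep_ge => [||i j]; rewrite ?addn_gt0 ?p1 ?q1//.
by rewrite tfst_tcat tsnd_tcat; exact: dist_tcat4.
Qed.

(** The coefficients of an expansion into sums over additional points. They are nonnegative so that
    sums and integrals can be exchanged before any finiteness is known. *)
Definition local_family p (t : R) (M : nat -> R)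
    (g : forall l, (p + l).-tuple (pt R d) -> R) :=
  forall l, [/\ measurable_fun setT (g l), forall w, 0 <= g l w <= M l &
    forall w, g l w != 0 -> near_tuples l t (tfst w) (tsnd w)].

Notation js g := (joint_sum tcat (fun w => (g w)%:E)).

(** The weight 1/l! makes up for the orderings of [l] additional points, so that in effect each
    finite set of them counts once. *)
Definition expansion p (g : forall l, (p + l).-tuple (pt R d) -> R)
    (x : p.-tuple (pt R d)) (Y : lfset R d) : \bar R :=
  (\sum_(l <oo) ((l`!%:R^-1)%:E * js (g l) x Y))%E.

Definition tensor p q l1 l2 (g1 : (p + l1).-tuple (pt R d) -> R)
    (g2 : (q + l2).-tuple (pt R d) -> R) (w : (p + l1 + (q + l2)).-tuple (pt R d)) : R :=
  g1 (tfst w) * g2 (tsnd w).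

Section family.
Variables (p : nat) (t : R) (M : nat -> R) (g : forall l, (p + l).-tuple (pt R d) -> R).
Hypothesis fg : local_family t M g.

Lemma family_M0 l : 0 <= M l.
Proof.
have [_ /(_ [tuple [tuple 0 | i < d] | j < p + l]) /andP[a b] _] := fg l.
exact: le_trans a b.
Qed.

Lemma family_ge0 l w : 0 <= g (l := l) w.
Proof. by have [_ /(_ w) /andP[]] := fg l. Qed.

Lemma family_le l x u : g (tcat x u) <= M l * \1_(near_tuples l t x) u.
Proof.
have [_ /(_ (tcat x u)) /andP[g0 gM] /(_ (tcat x u))] := fg l.
rewrite tfst_tcat tsnd_tcat indicE; have [->|_ /(_ isT) n] := eqVneq (g (tcat x u)) 0.
  by move=> _; rewrite mulr_ge0// family_M0.
by rewrite mem_set// mulr1.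
Qed.

Lemma measurable_js l {dX : measure_display} {T : measurableType dX}
    (x : T -> p.-tuple (pt R d)) (Y : T -> lfset R d) :
  measurable_fun setT x -> measurable_fun setT Y ->
  measurable_fun setT (fun s => js (@g l) (x s) (Y s)).
Proof.
move=> mx mY.
apply: measurable_joint_sum => //.
- exact: measurable_tcat.
- exact: ktuples_tcat_mem.
- by apply/measurable_EFinP; have [] := fg l.
- by move=> w; rewrite lee_fin family_ge0.
Qed.

Lemma js_ge0 l x Y : (0 <= js (@g l) x Y)%E.
Proof. by apply: joint_sum_ge0 => w; rewrite lee_fin family_ge0. Qed.

Lemma term_ge0 l x Y : (0 <= (l`!%:R^-1)%:E * js (@g l) x Y)%E.
Proof. by rewrite mule_ge0 ?js_ge0// lee_fin invr_ge0. Qed.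

Lemma expansion_ge0 x Y : (0 <= expansion g x Y)%E.
Proof. by apply: nneseries_ge0 => l _ _; exact: term_ge0. Qed.

Lemma measurable_expansion {dX : measure_display} {T : measurableType dX}
    (x : T -> p.-tuple (pt R d)) (Y : T -> lfset R d) :
  measurable_fun setT x -> measurable_fun setT Y ->
  measurable_fun setT (fun s => expansion g (x s) (Y s)).
Proof.
move=> mx mY; apply: ge0_emeasurable_sum => [l s _ _|l _]; first exact: term_ge0.
by apply: emeasurable_funM => //; exact: measurable_js.
Qed.

End family.

(** The product of sums runs over pairs of extensions that might share points, the joint sum over
    tuples with all points distinct. Clusters more than [2 * t] apart have no common point within
    [t], so the additional pairs have coefficient zero. *)
Lemma js_tensor p q l1 l2 t M1 M2 (g1 : forall l, (p + l).-tuple (pt R d) -> R)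
    (g2 : forall l, (q + l).-tuple (pt R d) -> R) z Y :
  0 <= t -> local_family t M1 g1 -> local_family t M2 g2 -> 2 * t < sep z ->
  (js (@g1 l1) (tfst z) Y * js (@g2 l2) (tsnd z) Y =
   joint_sum (fun z u => tcat4 z u) (fun w => (tensor (@g1 l1) (@g2 l2) w)%:E) z Y)%E.
Proof.
move=> t0 f1 f2 st.
rewrite ge0_esumZl; last 2 first.
- exact: js_ge0 f1 _ _ _.
- by move=> u; rewrite lee_fin (family_ge0 f2).
transitivity (\esum_(u2 in [set u | ktuples (q + l2) Y (tcat (tsnd z) u)])
  \esum_(u1 in [set u | ktuples (p + l1) Y (tcat (tfst z) u)])
    (g1 l1 (tcat (tfst z) u1) * g2 l2 (tcat (tsnd z) u2))%:E)%E.
  apply: eq_esum => u2 _; rewrite muleC ge0_esumZl.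
  - by apply: eq_esum => u1 _; rewrite muleC.
  - by rewrite lee_fin (family_ge0 f2).
  - by move=> u; rewrite lee_fin (family_ge0 f1).
rewrite esum_esum; last first.
  by move=> i j _ _; rewrite lee_fin mulr_ge0// ?(family_ge0 f1) ?(family_ge0 f2).
set D := [set u : (l1 + l2).-tuple (pt R d) | ktuples (p + l1) Y (tcat (tfst z) (tfst u)) /\
  ktuples (q + l2) Y (tcat (tsnd z) (tsnd u))].
transitivity (\esum_(u in D) (tensor (@g1 l1) (@g2 l2) (tcat4 z u))%:E)%E.
  rewrite (reindex_esum ([set u | ktuples (q + l2) Y (tcat (tsnd z) u)] `*``
     fun=> [set u | ktuples (p + l1) Y (tcat (tfst z) u)]) D (fun v => tcat v.2 v.1)).
    apply: eq_esum => -[u2 u1] _ /=.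
    by rewrite /tensor /tcat4 !tfst_tcat !tsnd_tcat.
  split.
  - by move=> [u2 u1] [/= K2 K1]; rewrite /D /= tfst_tcat tsnd_tcat.
  - move=> [u2 u1] [v2 v1] _ _ /= e; congr pair.
      by rewrite -(tsnd_tcat u1 u2) e tsnd_tcat.
    by rewrite -(tfst_tcat u1 u2) e tfst_tcat.
  - by move=> u [D1 D2]; exists (tsnd u, tfst u) => //=; rewrite tcatK.
rewrite /joint_sum esum_mkcond [RHS]esum_mkcond; apply: eq_esum => u _.
have [/set_mem uD|/negP uD] := boolP (u \in D); last first.
  rewrite ifF//; apply/negP => /set_mem /ktuples_tcat[H1 H2 _].
  by apply: uD; apply: mem_set.
case: ifPn => // /negP nu.
(* A nonzero coefficient would place all added points near their own clusters, and the whole tuple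
   would then have distinct entries. *)
apply/eqP; rewrite eqe; apply: contraPT isT => /eqP nz _; apply: nu; apply: mem_set => /=.
move: nz; rewrite /tensor /tcat4 tfst_tcat tsnd_tcat => /eqP.
rewrite mulf_eq0 negb_or => /andP[nz1 nz2].
have [_ _ /(_ _ nz1)] := f1 l1; rewrite tfst_tcat tsnd_tcat => n1.
have [_ _ /(_ _ nz2)] := f2 l2; rewrite tfst_tcat tsnd_tcat => n2.
case: uD => D1 D2; apply/ktuples_tcat; split => // a b e.
have := dist_tcat4 a b t0 n1 n2; rewrite e distxx; lra.
Qed.

End ktuples_tcat.

Lemma integral_le_indic {dm : measure_display} {T : measurableType dm}
    {R : realType} (mu : {measure set T -> \bar R}) (A : set T) (h : T -> \bar R)
    (c v : R) : measurable A -> 0 <= c -> (mu A <= v%:E)%E ->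
  measurable_fun setT h -> (forall u, 0 <= h u)%E ->
  {ae mu, forall u, (h u <= (c * \1_A u)%:E)%E} ->
  (\int[mu]_u h u <= (c * v)%:E)%E.
Proof.
move=> mA c0 Av mh h0 hA.
have mI : measurable_fun setT (fun u => (\1_A u)%:E : \bar R).
  exact/measurable_EFinP/measurable_indic.
apply: (@le_trans _ _ (\int[mu]_u (c%:E * (\1_A u)%:E))%E).
  apply: ae_ge0_le_integral => //.
  - by move=> u _; rewrite -EFinM lee_fin mulr_ge0.
  - by apply: emeasurable_funM.
  - by apply: (@filterS _ (almost_everywhere mu) _ _ _ _ hA) => u hu _; rewrite -EFinM.
rewrite ge0_integralZl// integral_indic// setIT EFinM.
by apply: lee_wpmul2l; rewrite ?lee_fin.
Qed.

Lemma ae_and {dm : measure_display} {T : measurableType dm} {R : realType}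
    {mu : {measure set T -> \bar R}} {P Q : T -> Prop} :
  {ae mu, forall x, P x} -> {ae mu, forall x, Q x} ->
  {ae mu, forall x, P x /\ Q x}.
Proof. by move=> hP hQ; exact: (@filterI _ (almost_everywhere mu) _ P Q hP hQ). Qed.

(** * Palm means of expansions, for one cluster and for two distant clusters *)

Section core.
Context {dd : measure_display} {Omega : measurableType dd} {R : realType}.
Variables (P : probability Omega R) (d : nat) (X : {RV P >-> lfset R d})
  (rho : forall k : nat, k.-tuple (pt R d) -> R)
  (palm : forall k : nat, R.-pker (k.-tuple (pt R d)) ~> lfset R d).
Hypothesis corr : forall k, (1 <= k)%N -> correlation_function X (@rho k).
Hypothesis palmP : forall k, (1 <= k)%N -> palm_version X (palm k).
Variable kappa : nat -> R.
Hypothesis kappa0 : forall k, 0 <= kappa k.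
Hypothesis rho_le : forall k, (1 <= k)%N -> {ae lebk R d k, forall x, rho x <= kappa k}.

Notation js g := (joint_sum tcat (fun w => (g w)%:E)).

(** This will be the Palm mean of the sum of order [l], multiplied by [rho x]. *)
Definition family_integral p (g : forall l, (p + l).-tuple (pt R d) -> R) l
    (x : p.-tuple (pt R d)) : \bar R :=
  (\int[lebk R d l]_u (@g l (tcat x u) * rho (tcat x u))%:E)%E.

Section one.
Variables (p : nat) (t : R) (M : nat -> R) (g : forall l, (p + l).-tuple (pt R d) -> R).
Hypotheses (p1 : (1 <= p)%N) (t0 : 0 <= t) (fg : local_family t M g).
Let V := near_volume d p t.

Let g0 l w : 0 <= g (l := l) w := family_ge0 fg w.

Let pl l : (1 <= p + l)%N. Proof. by rewrite addn_gt0 p1. Qed.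

Lemma measurable_family_rho l (x : p.-tuple (pt R d)) :
  measurable_fun setT (fun u : l.-tuple (pt R d) => (@g l (tcat x u) * rho (tcat x u))%:E : \bar R).
Proof.
have [mg _ _] := fg l; have [mrho _ _ _] := corr (pl l).
have mt : measurable_fun setT (fun u : l.-tuple (pt R d) => tcat x u).
  by apply: measurable_tcat.
apply/measurable_EFinP; apply: measurable_funM.
  exact: (measurableT_comp mg mt).
exact: (measurableT_comp mrho mt).
Qed.

Lemma family_integral_ge0 l x : (0 <= family_integral g l x)%E.
Proof.
have [_ rho0 _ _] := corr (pl l).
by apply: integral_ge0 => u _; rewrite lee_fin mulr_ge0.
Qed.

(** The three factors bound the coefficient, the correlation function of the enlarged tuple, and the
    volume of the positions near [x]. *)
Lemma family_integral_le l : {ae lebk R d p, forall x,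
  (family_integral g l x <= (M l * kappa (p + l) * V ^+ l)%:E)%E}.
Proof.
have [_ rho0 _ _] := corr (pl l).
have := factors_ae (m1 := lebk R d p) (m2 := lebk R d l)
  (j := fun x u => tcat x u) (measurable_tcat measurable_fst measurable_snd)
  (@factors_tcat _ _ _ (leb R d) p l) (rho_le (pl l)).
apply: (@filterS _ (almost_everywhere (lebk R d p))) => x hx.
rewrite /family_integral.
apply: (@integral_le_indic _ _ _ (lebk R d l) (near_tuples l t x)).
- exact: measurable_near_tuples.
- by rewrite mulr_ge0// (family_M0 fg).
- exact: lebk_near_tuples.
- exact: measurable_family_rho.
- by move=> u; rewrite lee_fin mulr_ge0.
- apply: (@filterS _ (almost_everywhere (lebk R d l)) _ _ _ _ hx) => u hu.
  rewrite lee_fin mulrAC ler_pM//.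
  exact: family_le fg _ _ _.
Qed.

Lemma palm_family l : {ae lebk R d p, forall x,
  ((\int[palm p x]_Y js (@g l) x Y) * (rho x)%:E = family_integral g l x)%E}.
Proof.
have [mg _ _] := fg l.
have := @palm_joint_sum _ _ _ _ _ _ _ palm corr palmP p l (p + l) (fun x u => tcat x u)
  (@tfst _ p l) (@tsnd _ p l) p1 (pl l) (measurable_tcat measurable_fst measurable_snd)
  (@measurable_tfst _ (pt R d) p l) (@tcatK _ p l) (@tfst_tcat _ p l) (@tsnd_tcat _ p l)
  (@ktuples_tcat_mem _ _ p l) (@factors_tcat _ _ _ (leb R d) p l)
  (fun w => (g w)%:E) (M l * kappa (p + l) * V ^+ l).
apply.
- exact/measurable_EFinP.
- by move=> w; rewrite lee_fin.
- by have := family_integral_le l.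
Qed.

Lemma palm_expansion : {ae lebk R d p, forall x,
  ((\int[palm p x]_Y expansion g x Y) * (rho x)%:E =
   \sum_(l <oo) ((l`!%:R^-1)%:E * family_integral g l x))%E}.
Proof.
have [_ rho0 _ _] := corr p1.
have := ae_foralln palm_family.
apply: (@filterS _ (almost_everywhere (lebk R d p))) => x hx.
have mj l : measurable_fun setT (fun Y : lfset R d => js (@g l) x Y).
  exact: (measurable_js fg l (measurable_cst x) (@measurable_id _ _ _)).
rewrite /expansion integral_nneseries//; last 2 first.
- by move=> l; apply: emeasurable_funM.
- by move=> l Y _; exact: term_ge0 fg _ _ _.
rewrite ge0_nneseriesZr ?lee_fin//; last first.
  by move=> l; apply: integral_ge0 => Y _; exact: term_ge0 fg _ _ _.
apply: eq_eseriesr => l _; rewrite -hx ge0_integralZl//; last first.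
  by move=> Y _; exact: js_ge0 fg _ _ _.
by rewrite muleA.
Qed.

End one.

Lemma ae_tfst p q (Q : p.-tuple (pt R d) -> Prop) :
  {ae lebk R d p, forall x, Q x} -> {ae lebk R d (p + q), forall z, Q (tfst z)}.
Proof.
apply: (factors_ae_fst (m1 := lebk R d p) (m2 := lebk R d q)
  (j := fun x y => tcat x y) (@factors_tcat _ _ _ (leb R d) p q)).
  exact: measurable_tfst.
exact: tfst_tcat.
Qed.

Lemma ae_tsnd p q (Q : q.-tuple (pt R d) -> Prop) :
  {ae lebk R d q, forall x, Q x} -> {ae lebk R d (p + q), forall z, Q (tsnd z)}.
Proof.
apply: (factors_ae_fst (m1 := lebk R d q) (m2 := lebk R d p)
  (j := fun y x => tcat x y)).
- move=> f mf f0; rewrite (factors_tcat (leb R d) mf f0).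
  apply: (fubini_tonelli (m1 := lebk R d p) (m2 := lebk R d q)
    (fun z : p.-tuple (pt R d) * q.-tuple (pt R d) => f (tcat z.1 z.2))) => //.
  by apply: (measurableT_comp mf); exact: measurable_tcat.
- exact: measurable_tsnd.
- by move=> y x; exact: tsnd_tcat.
Qed.

Section two.
Variables (p q : nat) (t : R) (M1 M2 : nat -> R)
  (g1 : forall l, (p + l).-tuple (pt R d) -> R)
  (g2 : forall l, (q + l).-tuple (pt R d) -> R).
Hypotheses (p1 : (1 <= p)%N) (q1 : (1 <= q)%N) (t0 : 0 <= t).
Hypotheses (f1 : local_family t M1 g1) (f2 : local_family t M2 g2).
Variables (phi : R -> R) (c C : nat -> R).
Hypothesis decay : correlation_decay rho phi c C.
Let V1 := near_volume d p t.
Let V2 := near_volume d q t.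

Let g10 l w : 0 <= g1 (l := l) w := family_ge0 f1 w.
Let g20 l w : 0 <= g2 (l := l) w := family_ge0 f2 w.
Let M10 l : 0 <= M1 l := family_M0 f1 l.
Let M20 l : 0 <= M2 l := family_M0 f2 l.

Let near2 l1 l2 (z : (p + q).-tuple (pt R d)) : set ((l1 + l2).-tuple (pt R d)) :=
  [set u | near_tuples l1 t (tfst z) (tfst u) /\ near_tuples l2 t (tsnd z) (tsnd u)].

Arguments near2 : clear implicits.

Let measurable_near2 l1 l2 z : measurable (near2 l1 l2 z).
Proof.
apply: measurableI; rewrite -[X in measurable X]setTI.
  apply: (@measurable_tfst _ (pt R d) l1 l2) => //.
  exact: measurable_near_tuples.
apply: (@measurable_tsnd _ (pt R d) l1 l2) => //.
exact: measurable_near_tuples.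
Qed.

Let lebk_near2 l1 l2 z : (lebk R d (l1 + l2) (near2 l1 l2 z) <= (V1 ^+ l1 * V2 ^+ l2)%:E)%E.
Proof.
have -> : (lebk R d (l1 + l2) (near2 l1 l2 z) =
    \int[lebk R d (l1 + l2)]_u (\1_(near2 l1 l2 z) u)%:E)%E.
  by rewrite integral_indic ?setIT//; exact: (@measurable_near2 l1 l2 z).
have mI : measurable_fun setT (fun u : (l1 + l2).-tuple (pt R d) => (\1_(near2 l1 l2 z) u)%:E : \bar R).
  by apply/measurable_EFinP; apply: measurable_indic; exact: (@measurable_near2 l1 l2 z).
have I0 u : (0 <= (\1_(near2 l1 l2 z) u)%:E :> \bar R)%E by rewrite lee_fin.
rewrite (@factors_tcat _ _ _ (leb R d) l1 l2 _ mI I0).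
have m1 := @measurable_near_tuples R d _ l1 t (tfst z).
have m2 := @measurable_near_tuples R d _ l2 t (tsnd z).
under eq_integral => x _.
  rewrite (eq_integral (fun y => (\1_(near_tuples l1 t (tfst z)) x)%:E *
      (\1_(near_tuples l2 t (tsnd z)) y)%:E)%E); last first.
    move=> y _; rewrite -EFinM !indicE -natrM mulnb; congr ((nat_of_bool _)%:R%:E).
    apply/idP/andP => [/set_mem[]|[/set_mem h0 /set_mem h]].
      by rewrite tfst_tcat tsnd_tcat => ? ?; split; exact: mem_set.
    by apply: mem_set; split; rewrite ?tfst_tcat ?tsnd_tcat.
  rewrite ge0_integralZl//; last exact/measurable_EFinP/measurable_indic.
  rewrite integral_indic// setIT muleC.
  over.
rewrite ge0_integralZl//; last exact/measurable_EFinP/measurable_indic.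
rewrite integral_indic// setIT muleC EFinM.
apply: lee_pmul => //.
  exact: (@lebk_near_tuples R d _ l1 t (tfst z)).
exact: (@lebk_near_tuples R d _ l2 t (tsnd z)).
Qed.

Let tensor0 l1 l2 w : 0 <= tensor (@g1 l1) (@g2 l2) w.
Proof. by rewrite mulr_ge0. Qed.

Let tensor_le l1 l2 z u :
  tensor (@g1 l1) (@g2 l2) (tcat4 z u) <= M1 l1 * M2 l2 * \1_(near2 l1 l2 z) u.
Proof.
rewrite /tensor /tcat4 tfst_tcat tsnd_tcat.
have a1 := family_le f1 (tfst z) (tfst u); have a2 := family_le f2 (tsnd z) (tsnd u).
apply: (le_trans (ler_pM (g10 _) (g20 _) a1 a2)).
rewrite mulrACA ler_wpM2l ?mulr_ge0// !indicE -natrM mulnb ler_nat.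
case: (boolP (_ && _)) => // /andP[/set_mem h1 /set_mem h2].
by rewrite mem_set.
Qed.

Let measurable_tensor l1 l2 : measurable_fun setT (tensor (@g1 l1) (@g2 l2)).
Proof.
have [m1 _ _] := f1 l1; have [m2 _ _] := f2 l2.
apply: measurable_funM.
  exact: (measurableT_comp m1 (@measurable_tfst _ (pt R d) _ _)).
exact: (measurableT_comp m2 (@measurable_tsnd _ (pt R d) _ _)).
Qed.

Let tcat4z l1 l2 (z : (p + q).-tuple (pt R d)) :
  measurable_fun setT (fun u : (l1 + l2).-tuple (pt R d) => tcat4 z u).
Proof. exact: (measurableT_comp (@measurable_tcat4 _ (pt R d) p q l1 l2) (measurable_pair1 z)). Qed.

Let comp4 l1 l2 z (h : (p + l1 + (q + l2)).-tuple (pt R d) -> R) :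
  measurable_fun setT h -> measurable_fun setT (fun u : (l1 + l2).-tuple (pt R d) => h (tcat4 z u)).
Proof. by move=> mh; exact: (measurableT_comp mh (tcat4z z)). Qed.

Let J1 l1 l2 : (1 <= p + l1 + (q + l2))%N.
Proof. by rewrite !addn_gt0 p1. Qed.

Let pq1 : (1 <= p + q)%N. Proof. by rewrite addn_gt0 p1. Qed.
Let pl1 l : (1 <= p + l)%N. Proof. by rewrite addn_gt0 p1. Qed.
Let ql1 l : (1 <= q + l)%N. Proof. by rewrite addn_gt0 q1. Qed.

Definition tensor_integral l1 l2 (z : (p + q).-tuple (pt R d)) : \bar R :=
  (\int[lebk R d (l1 + l2)]_u
     (tensor (@g1 l1) (@g2 l2) (tcat4 z u) * rho (tcat4 z u))%:E)%E.

Let tensor_integral_le l1 l2 : {ae lebk R d (p + q), forall z,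
  (tensor_integral l1 l2 z <=
   (M1 l1 * M2 l2 * kappa (p + l1 + (q + l2)) * (V1 ^+ l1 * V2 ^+ l2))%:E)%E}.
Proof.
have [mrho rho0 _ _] := corr (J1 l1 l2).
have := factors_ae (m1 := lebk R d (p + q)) (m2 := lebk R d (l1 + l2))
  (j := fun z u => tcat4 z u) (@measurable_tcat4 _ (pt R d) p q l1 l2)
  (@factors_tcat4 _ _ _ (leb R d) p q l1 l2) (rho_le (J1 l1 l2)).
apply: (@filterS _ (almost_everywhere (lebk R d (p + q)))) => z hz.
apply: (@integral_le_indic _ _ _ (lebk R d (l1 + l2)) (near2 l1 l2 z)).
- exact: (@measurable_near2 l1 l2 z).
- by rewrite !mulr_ge0.
- exact: lebk_near2.
- apply/measurable_EFinP; apply: measurable_funM.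
    exact: (@comp4 l1 l2 z _ (@measurable_tensor l1 l2)).
  exact: (@comp4 l1 l2 z _ mrho).
- by move=> u; rewrite lee_fin mulr_ge0.
- apply: (@filterS _ (almost_everywhere (lebk R d (l1 + l2))) _ _ _ _ hz) => u hu.
  rewrite lee_fin [leRHS]mulrAC ler_pM//; exact: tensor_le.
Qed.

Notation js4 l1 l2 := (joint_sum (fun z u => tcat4 z u)
  (fun w => (tensor (@g1 l1) (@g2 l2) w)%:E)).

Let palm_tensor l1 l2 : {ae lebk R d (p + q), forall z,
  ((\int[palm (p + q)%N z]_Y js4 l1 l2 z Y) * (rho z)%:E = tensor_integral l1 l2 z)%E}.
Proof.
(* [p1'] and [p2'] invert [tcat4]: the original points of both clusters, and the points added to
   them. *)
pose p1' (w : (p + l1 + (q + l2)).-tuple (pt R d)) := tcat (tfst (tfst w)) (tfst (tsnd w)).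
pose p2' (w : (p + l1 + (q + l2)).-tuple (pt R d)) := tcat (tsnd (tfst w)) (tsnd (tsnd w)).
have mp1' : measurable_fun setT p1'.
  apply: measurable_tcat.
    exact: (measurableT_comp (@measurable_tfst _ (pt R d) _ _) (@measurable_tfst _ (pt R d) _ _)).
  exact: (measurableT_comp (@measurable_tfst _ (pt R d) _ _) (@measurable_tsnd _ (pt R d) _ _)).
apply: (@palm_joint_sum _ _ _ _ _ _ _ palm corr palmP (p + q)%N (l1 + l2)%N _
  (fun z u => tcat4 z u) p1' p2' pq1 (J1 l1 l2) (@measurable_tcat4 _ (pt R d) p q l1 l2) mp1' _ _ _
  (@ktuples_tcat4 _ _ p q l1 l2) (@factors_tcat4 _ _ _ (leb R d) p q l1 l2)
  (fun w => (tensor (@g1 l1) (@g2 l2) w)%:E)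
  (M1 l1 * M2 l2 * kappa (p + l1 + (q + l2)) * (V1 ^+ l1 * V2 ^+ l2))).
- by move=> w; rewrite /tcat4 /p1' /p2' !tfst_tcat !tsnd_tcat !tcatK.
- by move=> z u; rewrite /tcat4 /p1' !tfst_tcat !tsnd_tcat !tfst_tcat tcatK.
- by move=> z u; rewrite /tcat4 /p2' !tfst_tcat !tsnd_tcat tcatK.
- by apply/measurable_EFinP; exact: measurable_tensor.
- by move=> w; rewrite lee_fin.
- by have := tensor_integral_le l1 l2.
Qed.

(** The cost, at orders [l1] and [l2], of replacing the joint correlation function by a product. The
    absolute value is there because [correlation_decay] says nothing about the sign of [C]. *)
Let sharp l1 l2 (z : (p + q).-tuple (pt R d)) : R := M1 l1 * M2 l2 * (V1 ^+ l1 * V2 ^+ l2) *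
  (`|C (p + l1 + (q + l2))%N| * phi (c (p + l1 + (q + l2))%N * (sep z - 2 * t))).
Arguments sharp : clear implicits.

Let phi0 s : 0 <= s -> 0 <= phi s.
Proof. by case: decay => -[h _ _] _ _ /h /andP[]. Qed.

Let c_gt0 k : (1 <= k)%N -> 0 < c k.
Proof. by case: decay => _ h _ /h. Qed.

Let sharp0 l1 l2 z : 2 * t < sep z -> 0 <= sharp l1 l2 z.
Proof.
move=> st; rewrite /sharp !mulr_ge0 ?exprn_ge0 ?near_volume_ge0// phi0//.
by rewrite mulr_ge0 ?subr_ge0 ?(ltW st)// ltW// c_gt0.
Qed.

Let factor_integral l1 l2 z :
  (\int[lebk R d (l1 + l2)]_u (tensor (@g1 l1) (@g2 l2) (tcat4 z u) *
     (rho (tcat (tfst z) (tfst u)) * rho (tcat (tsnd z) (tsnd u))))%:E =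
   family_integral g1 l1 (tfst z) * family_integral g2 l2 (tsnd z))%E.
Proof.
have [_ r1 _ _] := corr (pl1 l1); have [_ r2 _ _] := corr (ql1 l2).
pose A (u : l1.-tuple (pt R d)) : \bar R := (g1 (tcat (tfst z) u) * rho (tcat (tfst z) u))%:E.
pose B (u : l2.-tuple (pt R d)) : \bar R := (g2 (tcat (tsnd z) u) * rho (tcat (tsnd z) u))%:E.
have mA : measurable_fun setT A by exact: (measurable_family_rho p1 f1).
have mB : measurable_fun setT B by exact: (measurable_family_rho q1 f2).
have A0 u : (0 <= A u)%E by rewrite lee_fin mulr_ge0.
have B0 u : (0 <= B u)%E by rewrite lee_fin mulr_ge0.
transitivity (\int[lebk R d (l1 + l2)]_u (A (tfst u) * B (tsnd u)))%E.
  apply: eq_integral => u _; rewrite /A /B -EFinM /tensor /tcat4 tfst_tcat tsnd_tcat.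
  by rewrite mulrACA.
have mAB : measurable_fun setT (fun u : (l1 + l2).-tuple (pt R d) => A (tfst u) * B (tsnd u))%E.
  apply: emeasurable_funM.
    exact: (measurableT_comp mA (@measurable_tfst _ (pt R d) _ _)).
  exact: (measurableT_comp mB (@measurable_tsnd _ (pt R d) _ _)).
rewrite (factors_tcat (leb R d) mAB (fun u => mule_ge0 (A0 _) (B0 _))).
under eq_integral => x _.
  rewrite (eq_integral (fun y => A x * B y)%E); last first.
    by move=> y _; rewrite tfst_tcat tsnd_tcat.
  rewrite ge0_integralZl// muleC.
  over.
rewrite ge0_integralZl//; last by apply: integral_ge0 => u _; exact: B0.
by rewrite muleC.
Qed.

(** The integrands are compared pointwise by the decay hypothesis at the enlarged clusters, whose
    separation is at least [sep z - 2 * t], together with the monotonicity of [phi]. Two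
    inequalities replace an absolute difference because the integrals are extended reals. *)
Let compare l1 l2 : {ae lebk R d (p + q), forall z, 2 * t < sep z ->
  (tensor_integral l1 l2 z <=
     family_integral g1 l1 (tfst z) * family_integral g2 l2 (tsnd z) + (sharp l1 l2 z)%:E)%E /\
  (family_integral g1 l1 (tfst z) * family_integral g2 l2 (tsnd z) <=
     tensor_integral l1 l2 z + (sharp l1 l2 z)%:E)%E}.
Proof.
have [mrho rho0 _ _] := corr (J1 l1 l2).
have [mr1 r1 _ _] := corr (pl1 l1); have [mr2 r2 _ _] := corr (ql1 l2).
case: (decay) => -[_ phi_ni _] _ /(_ (p + l1)%N (q + l2)%N (pl1 l1) (ql1 l2)) dec.
have := factors_ae (m1 := lebk R d (p + q)) (m2 := lebk R d (l1 + l2))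
  (j := fun z u => tcat4 z u) (@measurable_tcat4 _ (pt R d) p q l1 l2)
  (@factors_tcat4 _ _ _ (leb R d) p q l1 l2) dec.
apply: (@filterS _ (almost_everywhere (lebk R d (p + q)))) => z hz st.
rewrite -factor_integral.
set J := (p + l1 + (q + l2))%N.
set a := fun u => (tensor (@g1 l1) (@g2 l2) (tcat4 z u) * rho (tcat4 z u))%:E : \bar R.
set b := fun u : (l1 + l2).-tuple (pt R d) => (tensor (@g1 l1) (@g2 l2) (tcat4 z u) *
     (rho (tcat (tfst z) (tfst u)) * rho (tcat (tsnd z) (tsnd u))))%:E : \bar R.
set D := `|C J| * phi (c J * (sep z - 2 * t)).
have D0 : 0 <= D.
  rewrite mulr_ge0// phi0// mulr_ge0 ?subr_ge0 ?(ltW st)// ltW// c_gt0//.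
  exact: J1.
set e := fun u => (M1 l1 * M2 l2 * D * \1_(near2 l1 l2 z) u)%:E : \bar R.
have MD0 : 0 <= M1 l1 * M2 l2 * D by rewrite mulr_ge0// mulr_ge0.
have e0 u : (0 <= e u)%E by rewrite lee_fin mulr_ge0.
have a0 u : (0 <= a u)%E by rewrite lee_fin mulr_ge0.
have b0 u : (0 <= b u)%E by rewrite lee_fin !mulr_ge0.
have mten := @comp4 l1 l2 z _ (@measurable_tensor l1 l2).
have ma : measurable_fun setT a.
  apply/measurable_EFinP; apply: measurable_funM => //.
  exact: (@comp4 l1 l2 z _ mrho).
have mb : measurable_fun setT b.
  apply/measurable_EFinP; apply: measurable_funM => //; apply: measurable_funM.
    apply: (measurableT_comp mr1); apply: measurable_tcat => //; exact: measurable_tfst.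
  apply: (measurableT_comp mr2); apply: measurable_tcat => //; exact: measurable_tsnd.
have me : measurable_fun setT e.
  apply/measurable_EFinP; apply: measurable_funM => //.
  by apply: measurable_indic; exact: (@measurable_near2 l1 l2 z).
have ie : (\int[lebk R d (l1 + l2)]_u e u <= (sharp l1 l2 z)%:E)%E.
  rewrite (_ : sharp l1 l2 z = (M1 l1 * M2 l2 * D) * (V1 ^+ l1 * V2 ^+ l2)); last first.
    by rewrite /sharp -/D mulrAC.
  apply: (@integral_le_indic _ _ _ (lebk R d (l1 + l2)) (near2 l1 l2 z)) => //.
  - exact: (@measurable_near2 l1 l2 z).
  - exact: lebk_near2.
  - by apply: aeW => u /=; rewrite lexx.
have key : {ae lebk R d (l1 + l2), forall u, (a u <= b u + e u)%E /\ (b u <= a u + e u)%E}.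
  apply: (@filterS _ (almost_everywhere (lebk R d (l1 + l2))) _ _ _ _ hz) => u hu.
  have [ten0|ten_neq0] := eqVneq (tensor (@g1 l1) (@g2 l2) (tcat4 z u)) 0.
    by rewrite /a /b ten0 !mul0r !add0e.
  (* The tensor is nonzero only where the added points are near their own clusters. *)
  have nu : near2 l1 l2 z u.
    apply: contrapT => nu; have := tensor_le z u.
    rewrite indicE memNset// mulr0 => h.
    by move/eqP: ten_neq0; apply; apply/eqP; rewrite eq_le h tensor0.
  have sp : sep z - 2 * t <= sep (tcat4 z u) by case: nu; exact: sep_tcat4.
  move: hu; rewrite {2 3}/tcat4 tfst_tcat tsnd_tcat => hu.
  have {}hu : `|rho (tcat4 z u) - rho (tcat (tfst z) (tfst u)) * rho (tcat (tsnd z) (tsnd u))| <= D.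
    apply: (le_trans hu); apply: (@le_trans _ _ (`|C J| * phi (c J * sep (tcat4 z u)))).
      rewrite ler_wpM2r ?ler_norm// phi0// mulr_ge0 ?sep_ge0// ltW// c_gt0 ?J1//.
    rewrite ler_wpM2l// phi_ni// ?ler_pM2l ?c_gt0 ?J1// mulr_ge0 ?subr_ge0 ?(ltW st)// ltW// c_gt0 ?J1//.
  move: hu; rewrite ler_distl => /andP[h1 h2].
  have tl := tensor_le z u; rewrite indicE mem_set// mulr1 in tl.
  have tD : tensor (@g1 l1) (@g2 l2) (tcat4 z u) * D <= M1 l1 * M2 l2 * D by rewrite ler_wpM2r.
  have T0 := tensor0 (tcat4 z u).
  rewrite /a /b /e indicE mem_set// mulr1 -!EFinD !lee_fin; split.
    have := ler_wpM2l T0 h2; rewrite mulrDr; lra.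
  have := ler_wpM2l T0 h1; rewrite mulrBr; lra.
have fin f h : measurable_fun setT f -> measurable_fun setT h ->
    (forall u, 0 <= f u)%E -> (forall u, 0 <= h u)%E ->
    {ae lebk R d (l1 + l2), forall u, (f u <= h u + e u)%E} ->
    (\int[lebk R d (l1 + l2)]_u f u <= \int[lebk R d (l1 + l2)]_u h u + (sharp l1 l2 z)%:E)%E.
  move=> mf mh f0 h0 fh.
  apply: (@le_trans _ _ (\int[lebk R d (l1 + l2)]_u (h u + e u))%E).
    apply: ae_ge0_le_integral => //.
    - by move=> u _; rewrite adde_ge0.
    - exact: emeasurable_funD.
    - by apply: (@filterS _ (almost_everywhere (lebk R d (l1 + l2))) _ _ _ _ fh).
  by rewrite ge0_integralD// leeD2l.
split; apply: fin => //; apply: (@filterS _ (almost_everywhere (lebk R d (l1 + l2))) _ _ _ _ key) => u [] //.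
Qed.

(* Replacing the correlation function of two enlarged clusters by the product of
   their correlation functions costs [C_J phi(c_J (s - 2 t))], since enlarging
   them brings them closer by at most [2 t]. *)
Definition mixing_error (s : R) : \bar R :=
  (\sum_(l1 <oo) \sum_(l2 <oo) (l1`!%:R^-1 * l2`!%:R^-1 *
     (M1 l1 * M2 l2 * (V1 ^+ l1 * V2 ^+ l2) *
  (`|C (p + l1 + (q + l2))%N| * phi (c (p + l1 + (q + l2))%N * (s - 2 * t)))))%:E)%E.

Let js40 l1 l2 z Y : (0 <= js4 l1 l2 z Y)%E.
Proof. by apply: joint_sum_ge0 => w; rewrite lee_fin. Qed.

Let mjs4 l1 l2 z : measurable_fun setT (js4 l1 l2 z).
Proof.
have mG : measurable_fun setT (fun w => (tensor (@g1 l1) (@g2 l2) w)%:E : \bar R).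
  by apply/measurable_EFinP; exact: measurable_tensor.
have G0 w : (0 <= (tensor (@g1 l1) (@g2 l2) w)%:E :> \bar R)%E by rewrite lee_fin.
exact: (measurable_joint_sum (@measurable_tcat4 _ (pt R d) p q l1 l2)
  (@ktuples_tcat4 _ _ p q l1 l2) mG G0 (measurable_cst z) (@measurable_id _ _ setT)).
Qed.

Let palm_expansion2 : {ae lebk R d (p + q), forall z, 2 * t < sep z ->
  ((\int[palm (p + q)%N z]_Y (expansion g1 (tfst z) Y * expansion g2 (tsnd z) Y)) * (rho z)%:E =
   \sum_(l1 <oo) \sum_(l2 <oo)
     ((l1`!%:R^-1)%:E * (l2`!%:R^-1)%:E * tensor_integral l1 l2 z))%E}.
Proof.
have [_ rho0 _ _] := corr pq1.
have := ae_foralln (fun l1 => ae_foralln (fun l2 => @palm_tensor l1 l2)).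
apply: (@filterS _ (almost_everywhere (lebk R d (p + q)))) => z hz st.
have exps Y : (expansion g1 (tfst z) Y * expansion g2 (tsnd z) Y =
   \sum_(l1 <oo) \sum_(l2 <oo) ((l1`!%:R^-1)%:E * (l2`!%:R^-1)%:E * js4 l1 l2 z Y))%E.
  rewrite {1}/expansion ge0_nneseriesZr; last 2 first.
  - exact: expansion_ge0 f2 _ _.
  - by move=> l; exact: term_ge0 f1 _ _ _.
  apply: eq_eseriesr => l1 _; rewrite /expansion ge0_nneseriesZl; last 2 first.
  - exact: term_ge0 f1 _ _ _.
  - by move=> l; exact: term_ge0 f2 _ _ _.
  apply: eq_eseriesr => l2 _; rewrite muleACA; congr (_ * _)%E.
  exact: js_tensor t0 f1 f2 st.
under eq_integral do rewrite exps.
have t0' l1 l2 Y : (0 <= (l1`!%:R^-1)%:E * (l2`!%:R^-1)%:E * js4 l1 l2 z Y)%E.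
  by rewrite !mule_ge0.
have mt l1 l2 : measurable_fun setT (fun Y => (l1`!%:R^-1)%:E * (l2`!%:R^-1)%:E * js4 l1 l2 z Y)%E.
  by apply: emeasurable_funM => //; exact: mjs4.
rewrite integral_nneseries//; last 2 first.
- by move=> l1; apply: ge0_emeasurable_sum.
- by move=> l1 Y _; apply: nneseries_ge0.
rewrite ge0_nneseriesZr ?lee_fin//; last first.
  by move=> l1; apply: integral_ge0 => Y _; apply: nneseries_ge0.
apply: eq_eseriesr => l1 _; rewrite integral_nneseries//.
rewrite ge0_nneseriesZr ?lee_fin//; last first.
  by move=> l2; apply: integral_ge0.
apply: eq_eseriesr => l2 _; rewrite -hz ge0_integralZl ?mule_ge0//.
by rewrite !muleA.
Qed.

(** The bounds of [compare] are summed over both orders with the factorial weights. All quantities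
    may still be infinite here. *)
Lemma palm_mixing : {ae lebk R d (p + q), forall z, 2 * t < sep z ->
  let A := ((\int[palm (p + q)%N z]_Y
     (expansion g1 (tfst z) Y * expansion g2 (tsnd z) Y)) * (rho z)%:E)%E in
  let B := (((\int[palm p (tfst z)]_Y expansion g1 (tfst z) Y) * (rho (tfst z))%:E) *
   ((\int[palm q (tsnd z)]_Y expansion g2 (tsnd z) Y) * (rho (tsnd z))%:E))%E in
  (A <= B + mixing_error (sep z))%E /\ (B <= A + mixing_error (sep z))%E}.
Proof.
have a1 := ae_tfst q (palm_expansion p1 t0 f1).
have a2 := ae_tsnd p (palm_expansion q1 t0 f2).
have a3 := ae_foralln (fun l1 => ae_foralln (fun l2 => @compare l1 l2)).
have a4 := palm_expansion2.
have := ae_and (ae_and a1 a2) (ae_and a3 a4).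
apply: (@filterS _ (almost_everywhere (lebk R d (p + q)))) => z [[h1 h2] [h3 h4]] st A B.
rewrite /A /B h1 h2 h4//.
have i1 l : (0 <= family_integral g1 l (tfst z))%E by exact: family_integral_ge0 p1 f1 _ _.
have i2 l : (0 <= family_integral g2 l (tsnd z))%E by exact: family_integral_ge0 q1 f2 _ _.
have i4 l1 l2 : (0 <= tensor_integral l1 l2 z)%E.
  have [_ rho0 _ _] := corr (J1 l1 l2).
  by apply: integral_ge0 => u _; rewrite lee_fin mulr_ge0.
have -> : ((\sum_(l <oo) (l`!%:R^-1)%:E * family_integral g1 l (tfst z)) *
  (\sum_(l <oo) (l`!%:R^-1)%:E * family_integral g2 l (tsnd z)) =
  \sum_(l1 <oo) \sum_(l2 <oo) ((l1`!%:R^-1)%:E * (l2`!%:R^-1)%:E *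
    (family_integral g1 l1 (tfst z) * family_integral g2 l2 (tsnd z))))%E.
  rewrite ge0_nneseriesZr; last 2 first.
  - by apply: nneseries_ge0 => l _ _; rewrite mule_ge0.
  - by move=> l; rewrite mule_ge0.
  apply: eq_eseriesr => l1 _; rewrite ge0_nneseriesZl; last 2 first.
  - by rewrite mule_ge0.
  - by move=> l; rewrite mule_ge0.
  by apply: eq_eseriesr => l2 _; rewrite muleACA.
have sum_le (a b : nat -> nat -> \bar R) : (forall l1 l2, 0 <= a l1 l2)%E ->
    (forall l1 l2, 0 <= b l1 l2)%E ->
    (forall l1 l2, a l1 l2 <= b l1 l2 + (sharp l1 l2 z)%:E)%E ->
    (\sum_(l1 <oo) \sum_(l2 <oo) ((l1`!%:R^-1)%:E * (l2`!%:R^-1)%:E * a l1 l2) <=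
     \sum_(l1 <oo) \sum_(l2 <oo) ((l1`!%:R^-1)%:E * (l2`!%:R^-1)%:E * b l1 l2) +
       mixing_error (sep z))%E.
  move=> a0 b0 ab; rewrite /mixing_error.
  have s0 l1 l2 : (0 <= (l1`!%:R^-1 * l2`!%:R^-1 * sharp l1 l2 z)%:E :> \bar R)%E.
    by rewrite lee_fin mulr_ge0 ?sharp0// mulr_ge0 ?invr_ge0.
  rewrite -nneseriesD; last 2 first.
  - by move=> l1 _ _; apply: nneseries_ge0 => l2 _ _; rewrite !mule_ge0.
  - by move=> l1 _ _; apply: nneseries_ge0 => l2 _ _; exact: s0.
  apply: lee_nneseries => [l1 _ _|l1 _].
    by apply: nneseries_ge0 => l2 _ _; rewrite !mule_ge0.
  rewrite -nneseriesD; last 2 first.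
  - by move=> l2 _ _; rewrite !mule_ge0.
  - by move=> l2 _ _; exact: s0.
  apply: lee_nneseries => [l2 _ _|l2 _]; first by rewrite !mule_ge0.
  rewrite EFinM [X in (_ + X * _)%E]EFinM -ge0_muleDr//; last by rewrite lee_fin sharp0.
  by apply: lee_wpmul2l => //; rewrite mule_ge0.
split; apply: sum_le => // l1 l2; rewrite ?mule_ge0//; by have [] := h3 l1 l2 st.
Qed.

End two.
End core.

(** * Moebius inversion *)

Lemma esum_finType {R : realType} {I : finType} (F : I -> \bar R) :
  (forall i, 0 <= F i)%E -> (\esum_(i in [set: I]) F i = \sum_(i : I) F i)%E.
Proof.
move=> F0; have -> : [set: I] = [set` index_enum I].
  by apply/seteqP; split => i //= _; rewrite mem_index_enum.
by rewrite esum_fset// -fsbig_seq// index_enum_uniq.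
Qed.

Section moebius_finset.
Context {R : realType} {N : nat}.
Implicit Types (T U : {set 'I_N}) (f : {set 'I_N} -> R).

(** The exponent [#|U| + #|T|] has the parity of the usual [#|U| - #|T|] and avoids subtraction. *)
Definition moebius f U : R := \sum_(T : {set 'I_N} | T \subset U) (-1) ^+ (#|U| + #|T|) * f T.

(** A sign-reversing involution on sets, for the cancellation below. *)
Let toggle (i : 'I_N) U : {set 'I_N} := if i \in U then U :\ i else i |: U.

Let toggleK i : involutive (toggle i).
Proof.
move=> U; rewrite /toggle; case: (boolP (i \in U)) => iU.
  by rewrite !inE eqxx /= finset.setD1K.
by rewrite finset.setU11 finset.setU1K.
Qed.

(** If some [i] is outside [T], adding or removing [i] pairs the supersets of [T] with opposite
    signs, and the sum equals its own opposite. *)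
Lemma sum_supersets T : \sum_(U : {set 'I_N} | T \subset U) (-1) ^+ (#|U| + #|T|) =
  (T == [set: 'I_N]%SET)%:R :> R.
Proof.
have [->|TT] := eqVneq T [set: 'I_N]%SET.
  rewrite (big_pred1 [set: 'I_N]%SET); first by rewrite -signr_odd oddD addbb.
  by move=> U; rewrite finset.subTset.
have [i iT] : exists i, i \notin T.
  apply/existsP; move: TT; apply: contraNT; rewrite negb_exists => /forallP h.
  by apply/eqP/setP => i; rewrite inE; have := h i; rewrite negbK.
rewrite mulr0n; set S := \sum_(U : {set 'I_N} | _) _.
suff e : S = - S by lra.
rewrite {1}/S (reindex_inj (inv_inj (toggleK i))) -sumrN /=.
have sub U : (T \subset toggle i U) = (T \subset U).
  rewrite /toggle; case: ifP => iU.
    by rewrite subsetD1 iT andbT.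
  apply/idP/idP => [|h]; last exact: fintype.subset_trans h (finset.subsetUr _ _).
  by move=> /fintype.subsetP h; apply/fintype.subsetP => j jT; have := h j jT; rewrite !inE => /orP[/eqP ji|//]; move: iT; rewrite -ji jT.
apply: eq_big => // U _; rewrite /toggle; case: (boolP (i \in U)) => iU.
  by rewrite [in RHS](cardsD1 i U) iU add1n addSn exprS mulN1r opprK.
by rewrite cardsU1 iU add1n addSn exprS mulN1r.
Qed.

Lemma sum_moebius f : \sum_U moebius f U = f [set: 'I_N]%SET.
Proof.
rewrite /moebius (exchange_big_dep predT) //=.
rewrite (eq_bigr (fun T => (T == [set: 'I_N]%SET)%:R * f T)); last first.
  by move=> T _; rewrite -mulr_suml sum_supersets.
rewrite (bigD1 [set: 'I_N]%SET)//= eqxx mul1r big1 ?addr0// => T /negPf ->.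
by rewrite mul0r.
Qed.

Lemma moebius_imset l (h : {ffun 'I_l -> 'I_N}) f : injective h ->
  moebius f (h @: [set: 'I_l]%SET) =
  \sum_(S : {set 'I_l}) (-1) ^+ (l + #|S|) * f (h @: S).
Proof.
move=> hi; rewrite /moebius card_imset// cardsT card_ord.
rewrite (reindex_onto (fun S : {set 'I_l} => h @: S) (fun T => h @^-1: T)) /=.
  apply: eq_big => [S|S _]; last by rewrite card_imset.
  rewrite imsetS ?finset.subsetT//=; apply/eqP/finset.setP => j.
  by rewrite inE mem_imset.
move=> T /fintype.subsetP TU; apply/finset.setP => i; apply/imsetP/idP => [[j]|iT].
  by rewrite inE => jT ->.
by have /imsetP[j _ ij] := TU i iT; exists j => //; rewrite inE -ij.
Qed.

(** Each set with [l] elements is the image of exactly [l!] injections; this is the factor that the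
    weight 1/l! of [expansion] cancels. *)
Lemma sum_injections l (F : {set 'I_N} -> R) :
  \sum_(h : {ffun 'I_l -> 'I_N} | injectiveb h) F (h @: [set: 'I_l]%SET) =
  l`!%:R * \sum_(U : {set 'I_N} | #|U| == l) F U.
Proof.
rewrite (partition_big (fun h : {ffun 'I_l -> 'I_N} => h @: [set: 'I_l]%SET)
  (fun U : {set 'I_N} => #|U| == l)) /=; last first.
  by move=> h /injectiveP hi; rewrite card_imset// cardsT card_ord.
rewrite mulr_sumr; apply: eq_bigr => U /eqP Ul.
rewrite (eq_bigr (fun=> F U)); last by move=> h /andP[_ /eqP ->].
rewrite sumr_const mulr_natl; congr (_ *+ _).
have := card_inj_ffuns_on 'I_l (mem U).
rewrite card_ord Ul ffactnn => <-.
apply: eq_card => h; rewrite [RHS]inE [LHS]unfold_in [RHS]andbC.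
case: (boolP (injectiveb h)) => //= /injectiveP hi.
apply/eqP/ffun_onP => [<- i|hU]; first by rewrite imset_f.
apply/eqP; rewrite eqEcard card_imset// cardsT card_ord Ul leqnn andbT.
by apply/fintype.subsetP => _ /imsetP[j _ ->]; exact: hU.
Qed.

End moebius_finset.

(** * Local functionals of a configuration as sums over finite sets of nearby points *)

Section configurations.
Context {R : realType} {d : nat}.

Lemma locally_finite_image m (w : m.-tuple (pt R d)) (A : {set 'I_m}) :
  locally_finite [set y | exists2 i, i \in A & y = tnth w i].
Proof.
move=> r; apply: (sub_finite_set (B := [set` (w : seq _)])) => //.
by move=> _ [[i _ ->] _] /=; exact: mem_tnth.
Qed.

Definition lf_of m (w : m.-tuple (pt R d)) (A : {set 'I_m}) : lfset R d :=
  LFSet (locally_finite_image w A).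

(** Selects the least index of each value, so that a repeated entry of [w] is counted once. *)
Let first m (w : m.-tuple (pt R d)) (A : {set 'I_m}) (i : 'I_m) : Prop :=
  i \in A /\ forall j : 'I_m, j \in A -> (j < i)%N -> tnth w j <> tnth w i.

(** The number of points in [B] is a sum over the indices that are the first of their value; being
    first is a measurable condition on [w]. *)
Lemma measurable_lf_of m (A : {set 'I_m}) :
  measurable_fun setT (fun w : m.-tuple (pt R d) => lf_of w A).
Proof.
apply: measurable_to_lfset => B mB.
have mB1 : measurable_fun setT (fun y => (\1_B y)%:E : \bar R).
  exact/measurable_EFinP/measurable_indic.
have mf i : measurable [set w : m.-tuple (pt R d) | first w A i].
  rewrite (_ : [set w | _] = [set w : m.-tuple (pt R d) | i \in A] `&`
    \bigcap_(j in [set j : 'I_m | (j \in A) && (j < i)%N]) ~` [set w | tnth w j = tnth w i]).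
    apply: measurableI.
      by case: (i \in A); rewrite ?set_true ?set_false.
    apply: fin_bigcap_measurable => // j _; apply: measurableC.
    by apply: measurable_eq_pt; exact: measurable_tnth.
  apply/seteqP; split => w [iA h]; split => //.
    by move=> j /= /andP[jA ji]; exact: h.
  by move=> j jA ji; apply: (h j); rewrite /= jA ji.
rewrite (_ : (fun w => _) = (fun w : m.-tuple (pt R d) =>
    \sum_(i < m) ((\1_[set w | first w A i] w)%:E * (\1_B (tnth w i))%:E)))%E.
  apply: emeasurable_sum => i; apply: emeasurable_funM.
    exact/measurable_EFinP/measurable_indic.
  exact: (measurableT_comp mB1 (measurable_tnth i)).
apply/funext => w; rewrite esum_indic//.
rewrite (_ : (lf_of w A : set _) = (fun i => tnth w i) @` [set i | first w A i]).
  rewrite esum_image; last first.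
    move=> i j /set_mem[iA hi] /set_mem[jA hj] ij; apply: val_inj.
    case: (ltngtP i j) => // [ltij|ltji]; first by case: (hj i iA ltij).
    by case: (hi j jA ltji).
  rewrite esum_mkcond esum_finType; last by move=> i; case: ifP => _; rewrite ?lee_fin.
  apply: eq_bigr => i _; rewrite !indicE.
  have [/set_mem fi|/negP fi] := boolP (i \in [set i | first w A i]).
    by rewrite [w \in _]mem_set// mul1e.
  by rewrite [w \in _]memNset ?mul0e// => fi'; apply: fi; exact: mem_set.
apply/seteqP; split => y /=; last by move=> [i [iA _] <-]; exists i.
move=> [i iA ->].
have Pi : (i \in A) && (tnth w i == tnth w i) by rewrite iA eqxx.
have [k /andP[kA /eqP ki] kmin] :=
  @arg_minnP _ i (fun k => (k \in A) && (tnth w k == tnth w i)) (@nat_of_ord m) Pi.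
exists k => //; split => // j jA jk /esym e.
by have := kmin j; rewrite jA -e ki eqxx leqNgt jk => /(_ isT).
Qed.

Lemma lfset_ext (Y Z : lfset R d) : (Y : set _) = Z -> Y = Z.
Proof.
case: Y Z => [Y hY] [Z hZ] /= e; rewrite -{Z}e in hZ *.
by congr LFSet; exact: Prop_irrelevance.
Qed.

Lemma finite_near (Y : lfset R d) p (t : R) (x : p.-tuple (pt R d)) :
  finite_set (Y `&` near_points t x).
Proof.
rewrite near_pointsE; elim/big_rec : _ => [|k A _ IH]; first by rewrite setI0.
rewrite setIUr finite_setU; split => //.
pose r := t + \sum_i `|tnth (tnth x k) i|.
apply: (sub_finite_set _ (lf_setP Y r)) => y [Yy xy]; split => // i.
have := le_trans (coord_le_dist (tnth x k) y i) xy.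
rewrite distrC => h.
rewrite -[tnth y i](subrK (tnth (tnth x k) i)) (le_trans (ler_normD _ _))// lerD//.
by rewrite (bigD1 i)//= lerDl sumr_ge0.
Qed.

Section mobius_family.
Variables (p : nat) (t : R) (psi : p.-tuple (pt R d) -> lfset R d -> R).
Hypothesis t0 : 0 <= t.
Hypothesis mpsi : measurable_fun setT
  (fun z : p.-tuple (pt R d) * lfset R d => psi z.1 z.2).
Hypothesis psi_local : forall x Y, (forall i, lf_set Y (tnth x i)) ->
  psi x Y = psi x (lfI Y (near_points t x)).

(** All base indices are kept whatever [S] is: the functional is evaluated at the base points, which
    have to stay in the configuration. *)
Definition with_extra l (S : {set 'I_l}) : {set 'I_(p + l)} :=
  [set a : 'I_(p + l) | if fintype.split a is inr j then j \in S else true]%SET.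

Lemma mem_with_extra_l l (S : {set 'I_l}) i : lshift l i \in with_extra S.
Proof. by rewrite inE (unsplitK (inl i : 'I_p + 'I_l)%type). Qed.

Lemma mem_with_extra_r l (S : {set 'I_l}) j : (rshift p j \in with_extra S) = (j \in S).
Proof. by rewrite inE (unsplitK (inr j : 'I_p + 'I_l)%type). Qed.

Lemma lf_of_tcat l (S : {set 'I_l}) (x : p.-tuple (pt R d)) (u : l.-tuple (pt R d)) y :
  lf_set (lf_of (tcat x u) (with_extra S)) y <->
  (exists i, y = tnth x i) \/ (exists2 j, j \in S & y = tnth u j).
Proof.
split=> [[a + ->]|[[i ->]|[j jS ->]]].
- case: (split_ordP a) => k ->; rewrite ?tnth_lshift ?tnth_rshift.
    by move=> _; left; exists k.
  by rewrite mem_with_extra_r => kS; right; exists k.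
- by exists (lshift l i); rewrite ?mem_with_extra_l ?tnth_lshift.
- by exists (rshift p j); rewrite ?mem_with_extra_r ?tnth_rshift.
Qed.

Definition admissible_tuples l : set ((p + l).-tuple (pt R d)) :=
  [set w : (p + l).-tuple (pt R d) | uniq w /\ near_tuples l t (tfst w) (tsnd w)].

Lemma measurable_admissible_tuples l : measurable (@admissible_tuples l).
Proof.
have m2 (a : 'I_(p + l)) : measurable_fun setT (fun w : (p + l).-tuple (pt R d) => tnth w a).
  exact: measurable_tnth.
rewrite (_ : @admissible_tuples l =
  (\bigcap_(ij in [set ij : 'I_(p + l) * 'I_(p + l) | ij.1 != ij.2])
      ~` [set w | tnth w ij.1 = tnth w ij.2]) `&`
  \bigcap_(j in [set: 'I_l]) \bigcup_(i in [set: 'I_p])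
    ((fun w => dist (tnth w (lshift l i)) (tnth w (rshift p j))) @^-1` `]-oo, t]%classic)).
  apply: measurableI; apply: fin_bigcap_measurable => // i _.
    by apply: measurableC; exact: measurable_eq_pt.
  apply: fin_bigcup_measurable => // j _; rewrite -[X in measurable X]setTI.
  exact: measurable_dist.
apply/seteqP; split => w /= [H1 H2]; split.
- by move=> ij /= nij /tuple_uniqP -/(_ H1) => e; rewrite e eqxx in nij.
- move=> j _; have [i] := H2 j; rewrite !tnth_mktuple => h; exists i => //=.
- apply/tuple_uniqP => a b ab; apply/eqP; apply: contraT => nab.
  by have := H1 (a, b) nab; rewrite /= ab.
- move=> j; have [i _ /=] := H2 j Logic.I; rewrite in_itv /= => h; exists i.
  by rewrite !tnth_mktuple.
Qed.

(* Moebius inversion of [S |-> psi x (x U u_S)], so that a local [psi] is recovered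
   as a sum over the finite sets of points near [x]. *)
Definition mob l (w : (p + l).-tuple (pt R d)) : R :=
  \1_(@admissible_tuples l) w * \sum_(S : {set 'I_l})
    (-1) ^+ (l + #|S|) * psi (tfst w) (lf_of w (with_extra S)).

Lemma measurable_mob l : measurable_fun setT (@mob l).
Proof.
apply: measurable_funM.
  by apply: measurable_indic; exact: measurable_admissible_tuples.
apply: measurable_sum => S; apply: measurable_funM => //.
apply: (measurableT_comp mpsi (g := fun w : (p + l).-tuple (pt R d) =>
  (tfst w, lf_of w (with_extra S)))).
by apply: measurable_fun_pair; [exact: (@measurable_tfst _ _ p l) | exact: measurable_lf_of].
Qed.

(** The map [h] will be the positive or the negative part; [h 0 = 0] preserves the support
    condition. *)
Lemma local_mob (M : nat -> R) (h : R -> R) : h 0 = 0 -> measurable_fun setT h ->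
  (forall a, 0 <= h a <= `|a|) -> (forall l w, `|@mob l w| <= M l) ->
  local_family t M (fun l w => h (@mob l w)).
Proof.
move=> h0 mh hle hM l; split.
- exact: (measurableT_comp mh (@measurable_mob l)).
- by move=> w; have /andP[-> /le_trans] := hle (mob w); apply.
- move=> w; apply: contraNP => nw; apply/eqP.
  by rewrite /mob indicE memNset ?mul0r//= => -[].
Qed.

Section expand.
Variables (x : p.-tuple (pt R d)) (Y : lfset R d).
Hypotheses (ux : uniq x) (Yx : forall i, lf_set Y (tnth x i)).

(** The finitely many points other than those of [x] on which a local functional can depend.
    Enumerated by [e], they turn finite sets of points into subsets of ['I_N]. *)
Let V : set (pt R d) := (Y `&` near_points t x) `\` [set` (x : seq _)].
Let finV : finite_set V.
Proof. by apply: sub_finite_set (finite_near Y t x) => y []. Qed.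
Let s : seq (pt R d) := finmap.enum_fset (fset_set V).
Let N := size s.
Let e := in_tuple s.
Let e_inj : injective (tnth e).
Proof. by apply/tuple_uniqP; exact: finmap.fset_uniq. Qed.
Let e_V y : V y <-> exists i, y = tnth e i.
Proof.
have E : (y \in s) = (y \in V) by rewrite /s in_fset_set.
split=> [Vy|[i ->]].
  have : y \in e by rewrite /e /= E mem_set.
  by move=> /tnthP[i ->]; exists i.
by apply: set_mem; rewrite in_fset_set// in E *; have := mem_tnth i e; rewrite in_fset_set.
Qed.
Let Psi (T : {set 'I_N}) : R := psi x (lf_of (tcat x e) (with_extra T)).

Let tup l (f : {ffun 'I_l -> 'I_N}) : l.-tuple (pt R d) := [tuple tnth e (f j) | j < l].

(** A tuple that lists distinct points of [V] is admissible, and the sets [S] of its positions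
    correspond to the subsets of the listed points. *)
Let mob_tup l (f : {ffun 'I_l -> 'I_N}) : injective f ->
  mob (tcat x (tup f)) = moebius Psi (f @: [set: 'I_l]%SET).
Proof.
move=> fi; rewrite moebius_imset// /mob indicE mem_set ?mul1r.
  apply: eq_bigr => S _; congr (_ * _); rewrite tfst_tcat /Psi; congr psi.
  apply: lfset_ext; apply/seteqP; split => y /lf_of_tcat[[i ->]|[j jS ->]];
    apply/lf_of_tcat; (try by left; exists i); right.
    by exists (f j); [exact: imset_f | rewrite tnth_mktuple].
  case/imsetP: jS => k kS ->; exists k => //.
  by rewrite tnth_mktuple.
split.
  have [] // : ktuples (p + l) setT (tcat x (tup f)).
  apply/ktuples_tcat; split.
  - by split.
  - split => //; apply/tuple_uniqP => a b; rewrite !tnth_mktuple => /e_inj; exact: fi.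
  - move=> i j; rewrite tnth_mktuple => xe.
    have [_] : V (tnth e (f j)) by apply/e_V; exists (f j).
    by apply; rewrite /= -xe mem_tnth.
rewrite tfst_tcat tsnd_tcat => j; rewrite tnth_mktuple.
by have [[_]] : V (tnth e (f j)) by apply/e_V; exists (f j).
Qed.

(** An extension with a point far from [x] has coefficient [h 0 = 0]; all others are tuples of
    distinct points of [V], given by injections into ['I_N]. *)
Let js_mob (h : R -> R) l : h 0 = 0 -> (forall a, 0 <= h a) ->
  joint_sum tcat (fun w => (h (@mob l w))%:E) x Y =
  (\sum_(f : {ffun 'I_l -> 'I_N} | injectiveb f)
    h (moebius Psi (f @: [set: 'I_l]%SET)))%:E.
Proof.
move=> h0 hge0.
transitivity (\esum_(u in @tup l @` [set f : {ffun 'I_l -> 'I_N} | injectiveb f])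
  (h (mob (tcat x u)))%:E)%E.
  rewrite /joint_sum esum_mkcond [RHS]esum_mkcond; apply: eq_esum => u _.
  case: ifPn => [/set_mem uY|/negP nuY]; case: ifPn => [/set_mem uf|/negP nuf] //.
    rewrite /mob indicE memNset ?mul0r ?h0// => -[uw nw]; apply: nuf; apply: mem_set => /=.
    move: uY => /ktuples_tcat[_ [uu uY] xu].
    have uV j : V (tnth u j).
      split; last by move=> /= /tnthP[i /esym]; exact: xu.
      by split => //; have := nw j; rewrite tfst_tcat tsnd_tcat.
    have /choice[f fE] : forall j, exists i, tnth u j = tnth e i.
      by move=> j; have /e_V := uV j.
    exists [ffun j => f j].
      apply/injectiveP => a b; rewrite !ffunE => fab.
      by move/tuple_uniqP: uu; apply; rewrite !fE fab.
    by apply: eq_from_tnth => j; rewrite tnth_mktuple ffunE fE.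
  case: nuY; apply: mem_set; case: uf => f /injectiveP fi <-.
  apply/ktuples_tcat; split => //.
  - split.
      by apply/tuple_uniqP => a b; rewrite !tnth_mktuple => /e_inj; exact: fi.
    move=> j; rewrite tnth_mktuple.
    by have [[]] : V (tnth e (f j)) by apply/e_V; exists (f j).
  - move=> i j; rewrite tnth_mktuple => xe.
    have [_] : V (tnth e (f j)) by apply/e_V; exists (f j).
    by apply; rewrite /= -xe mem_tnth.
rewrite esum_image; last first.
  move=> f g /set_mem/injectiveP fi /set_mem/injectiveP gi fg; apply/ffunP => j.
  by have := congr1 (fun v => tnth v j) fg; rewrite !tnth_mktuple => /e_inj.
rewrite esum_mkcond esum_finType; last by move=> f; case: ifP => //; rewrite lee_fin.
rewrite -sumEFin [RHS]big_mkcond /=; apply: eq_bigr => f _.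
case: ifPn => [/set_mem|/negP nf].
  by move=> fi; rewrite fi mob_tup//; exact/injectiveP.
by rewrite ifF//; apply/negP => fi; apply: nf; exact: mem_set.
Qed.

Let expansion_mob (h : R -> R) : h 0 = 0 -> (forall a, 0 <= h a) ->
  expansion (fun l w => h (@mob l w)) x Y = (\sum_U h (moebius Psi U))%:E.
Proof.
move=> h0 hge0; rewrite /expansion.
have term l : ((l`!%:R^-1)%:E * joint_sum tcat (fun w => (h (@mob l w))%:E) x Y =
    (\sum_(U : {set 'I_N} | #|U| == l) h (moebius Psi U))%:E)%E.
  rewrite js_mob// (sum_injections l (fun U => h (moebius Psi U))) -EFinM mulrA.
  by rewrite mulVf ?mul1r// pnatr_eq0 -lt0n fact_gt0.
under eq_eseriesr do rewrite term.
(* No subset of ['I_N] has more than [N] elements, so the series is a finite sum. *)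
rewrite (nneseries_split _ N.+1) => [|k _]; last by rewrite lee_fin sumr_ge0.
rewrite [X in (_ + X)%E]eseries0 ?adde0; last first.
  move=> k Nk _; rewrite big_pred0// => U; apply/negP => /eqP Uk.
  by have := max_card (mem U); rewrite Uk card_ord leqNgt Nk.
rewrite big_mkord sumEFin; congr EFin.
under eq_bigr do rewrite big_mkcond.
rewrite exchange_big /=; apply: eq_bigr => U _.
have UN : (#|U| < N.+1)%N by rewrite ltnS (leq_trans (max_card _))// card_ord.
rewrite (bigD1 (Ordinal UN))//= eqxx big1 ?addr0// => i.
by rewrite -val_eqE /= eq_sym => /negPf ->.
Qed.

(** The two expansions are the sums of the positive and of the negative parts of the Moebius
    transform. Their difference is the sum of the transform over all subsets, hence the value at the
    full set, and locality identifies this value with [psi x Y]. *)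
Lemma mob_expansion : exists a b : R,
  [/\ expansion (fun l w => Num.max (@mob l w) 0) x Y = a%:E,
      expansion (fun l w => Num.max (- @mob l w) 0) x Y = b%:E &
      psi x Y = a - b].
Proof.
exists (\sum_U Num.max (moebius Psi U) 0), (\sum_U Num.max (- moebius Psi U) 0); split.
- apply: (expansion_mob (h := fun a => Num.max a 0)) => [|a]; first by rewrite maxxx.
  by rewrite le_max lexx orbT.
- apply: (expansion_mob (h := fun a => Num.max (- a) 0)) => [|a].
    by rewrite oppr0 maxxx.
  by rewrite le_max lexx orbT.
rewrite -sumrB (eq_bigr (fun U => moebius Psi U)); last first.
  by move=> U _; case: (lerP 0 (moebius Psi U)) => h; rewrite ?(max_l h) ?(max_r (ltW h)) /Num.max; case: ltP; lra.
rewrite sum_moebius psi_local// /Psi; congr psi; apply: lfset_ext.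
apply/seteqP; split => y.
  move=> [Yy ny]; apply/lf_of_tcat; have [/tnthP[i ->]|yx] := boolP (y \in (x : seq _)).
    by left; exists i.
  right; have /e_V[i ->] : V y by split => //; exact/negP.
  by exists i; rewrite ?inE.
move=> /lf_of_tcat[[i ->]|[j _ ->]].
  by split => //; exists i; rewrite distxx.
by have [] : V (tnth e j) by apply/e_V; exists j.
Qed.

End expand.

Lemma expansion_outside (g : forall l, (p + l).-tuple (pt R d) -> R) x Y :
  ~ (forall i, lf_set Y (tnth x i)) -> expansion g x Y = 0%E.
Proof.
move=> nY; rewrite /expansion eseries0// => l _ _.
rewrite /joint_sum (_ : [set u | _] = set0) ?esum_set0 ?mule0//.
by apply/seteqP; split => // u /ktuples_tcat[[_ xY] _ _]; apply: nY.
Qed.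

End mobius_family.
End configurations.

(** For [r = 0] the integrals may be infinite, but every product with [r] is zero. For [r > 0] the
    finite products make [f] and [g] integrable, and integration is linear. *)
Lemma integral_diff_scaled {dm : measure_display} {T : measurableType dm} {R : realType}
    (mu : {measure set T -> \bar R}) (f g : T -> \bar R) (h : T -> R) (r a b : R) :
  measurable_fun setT f -> measurable_fun setT g ->
  (forall y, 0 <= f y)%E -> (forall y, 0 <= g y)%E -> 0 <= r ->
  ((\int[mu]_y f y) * r%:E = a%:E)%E -> ((\int[mu]_y g y) * r%:E = b%:E)%E ->
  (forall y, (h y)%:E = f y - g y)%E ->
  ((\int[mu]_y (h y)%:E) * r%:E = (a - b)%:E)%E.
Proof.
move=> mf mg f0 g0 r0 fa gb hfg; have [rz|rz] := eqVneq r 0.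
  move: fa gb; rewrite rz !mule0 => -[<-] [<-].
  by rewrite subrr.
have rp : 0 < r by rewrite lt_neqAle eq_sym rz.
have fin (u : \bar R) c : (0 <= u)%E -> (u * r%:E = c%:E)%E -> exists v, u = v%:E.
  case: u => [v _ _|_|//]; first by exists v.
  by rewrite mulyr gtr0_sg// mul1e.
have [a' fa'] := fin _ _ (integral_ge0 mu (fun y _ => f0 y)) fa.
have [b' gb'] := fin _ _ (integral_ge0 mu (fun y _ => g0 y)) gb.
have intf : mu.-integrable setT f.
  apply/integrableP; split => //; rewrite (eq_integral f) ?fa' ?ltry// => y _.
  by rewrite gee0_abs.
have intg : mu.-integrable setT g.
  apply/integrableP; split => //; rewrite (eq_integral g) ?gb' ?ltry// => y _.
  by rewrite gee0_abs.
rewrite (eq_integral (f \- g)%E) => [|y _]; last exact: hfg.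
rewrite integralB//; move: fa gb; rewrite fa' gb' => -[<-] [<-].
by rewrite -EFinB -EFinM mulrBl.
Qed.

Lemma integral_add_scaled {dm : measure_display} {T : measurableType dm} {R : realType}
    (mu : {measure set T -> \bar R}) (f g : T -> \bar R) (r a b : R) :
  measurable_fun setT f -> measurable_fun setT g ->
  (forall y, 0 <= f y)%E -> (forall y, 0 <= g y)%E ->
  ((\int[mu]_y f y) * r%:E = a%:E)%E -> ((\int[mu]_y g y) * r%:E = b%:E)%E ->
  ((\int[mu]_y (f y + g y)) * r%:E = (a + b)%:E)%E.
Proof.
move=> mf mg f0 g0 fa gb; rewrite ge0_integralD//.
by rewrite ge0_muleDl ?fa ?gb//; apply: integral_ge0.
Qed.

(** A finite error and finite factors force [A] to be finite, which turns two inequalities between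
    extended reals into a distance. *)
Lemma near_real {R : realType} (A B1 B2 e : \bar R) (b1 b2 E : R) :
  (e <= E%:E)%E -> (0 <= A)%E -> B1 = b1%:E -> B2 = b2%:E ->
  (A <= B1 * B2 + e)%E /\ (B1 * B2 <= A + e)%E ->
  exists2 a : R, A = a%:E & `|a - b1 * b2| <= E.
Proof.
move=> eE A0 -> -> [h1 h2].
have {}h1 := le_trans h1 (leeD2l _ eE); have {}h2 := le_trans h2 (leeD2l _ eE).
case: A A0 h1 h2 => [a _|_|//]; rewrite -?EFinD ?lee_fin; last by rewrite leNgt ltry.
by move=> h1 h2; exists a => //; rewrite ler_distl; apply/andP; split; lra.
Qed.

Lemma dist_quad {R : realType} (a1 a2 a3 a4 p1 n1 p2 n2 E : R) :
  `|a1 - p1 * p2| <= E -> `|a2 - p1 * n2| <= E -> `|a3 - n1 * p2| <= E ->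
  `|a4 - n1 * n2| <= E ->
  `|a1 + a4 - (a2 + a3) - (p1 - n1) * (p2 - n2)| <= 4 * E.
Proof.
rewrite !ler_distl => /andP[? ?] /andP[? ?] /andP[? ?] /andP[? ?].
by apply/andP; split; lra.
Qed.

Lemma uniq_tfst (T : eqType) p q (z : (p + q).-tuple T) : uniq z -> uniq (tfst z).
Proof.
by move=> /tuple_uniqP zi; apply/tuple_uniqP => i j; rewrite !tnth_mktuple => /zi /lshift_inj.
Qed.

Lemma uniq_tsnd (T : eqType) p q (z : (p + q).-tuple T) : uniq z -> uniq (tsnd z).
Proof.
by move=> /tuple_uniqP zi; apply/tuple_uniqP => i j; rewrite !tnth_mktuple => /zi /rshift_inj.
Qed.

(** The second clause covers the configurations that miss an entry of [x]: the expansions vanish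
    there, and so must [psi]. *)
Definition local_functional {R : realType} {d p : nat} (t : R) (M : nat -> R)
    (psi : p.-tuple (pt R d) -> lfset R d -> R) : Prop :=
  [/\ measurable_fun setT (fun z : p.-tuple (pt R d) * lfset R d => psi z.1 z.2),
      forall x Y, ~ (forall i, lf_set Y (tnth x i)) -> psi x Y = 0,
      forall x Y, (forall i, lf_set Y (tnth x i)) ->
        psi x Y = psi x (lfI Y (near_points t x)) &
      forall l w, `|mob t psi (l := l) w| <= M l].

(** * Mixing for signed local functionals *)

Section signed.
Context {R : realType} {d p : nat}.
Variables (t : R) (M : nat -> R) (psi : p.-tuple (pt R d) -> lfset R d -> R).
Hypotheses (t0 : 0 <= t) (lpsi : local_functional t M psi).

Definition mobp l (w : (p + l).-tuple (pt R d)) : R := Num.max (mob t psi w) 0.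
Definition mobn l (w : (p + l).-tuple (pt R d)) : R := Num.max (- mob t psi w) 0.

Lemma local_mobp : local_family t M mobp.
Proof.
have [m _ _ b] := lpsi; apply: (@local_mob _ _ _ _ _ m M (fun a => Num.max a 0)) => //.
- by rewrite maxxx.
- by apply: measurable_funrpos.
- by move=> a; rewrite le_max lexx orbT /= ge_max ler_norm normr_ge0.
Qed.

Lemma local_mobn : local_family t M mobn.
Proof.
have [m _ _ b] := lpsi; apply: (@local_mob _ _ _ _ _ m M (fun a => Num.max (- a) 0)) => //.
- by rewrite oppr0 maxxx.
- by apply: measurable_funrneg.
- by move=> a; rewrite le_max lexx orbT /= ge_max normr_ge0 -normrN ler_norm.
Qed.

Lemma functional_expansion (x : p.-tuple (pt R d)) Y : uniq x ->
  (exists a b : R, [/\ expansion mobp x Y = a%:E, expansion mobn x Y = b%:E &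
    psi x Y = a - b]).
Proof.
have [m h0 hl b] := lpsi; move=> ux.
have [Yx|nYx] := pselect (forall i, lf_set Y (tnth x i)).
  exact: mob_expansion.
by exists 0, 0; rewrite !expansion_outside// h0// subrr.
Qed.

End signed.

Section mixing_functionals.
Context {dd : measure_display} {Omega : measurableType dd} {R : realType}.
Variables (P : probability Omega R) (d : nat) (X : {RV P >-> lfset R d})
  (rho : forall k, k.-tuple (pt R d) -> R)
  (palm : forall k, R.-pker (k.-tuple (pt R d)) ~> lfset R d).
Hypothesis corr : forall k, (1 <= k)%N -> correlation_function X (@rho k).
Hypothesis palmP : forall k, (1 <= k)%N -> palm_version X (palm k).
Variable kappa : nat -> R.
Hypothesis kappa0 : forall k, 0 <= kappa k.
Hypothesis rho_le : forall k, (1 <= k)%N -> {ae lebk R d k, forall x, rho x <= kappa k}.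

Definition palm_mean p (psi : p.-tuple (pt R d) -> lfset R d -> R) x : \bar R :=
  ((\int[palm p x]_Y (psi x Y)%:E) * (rho x)%:E)%E.

(** The sum of the bounds on the terms of an expansion: if it is finite, the Palm means of both
    parts, scaled by [rho], are finite almost everywhere. *)
Definition family_bound p (t : R) (M : nat -> R) : \bar R :=
  (\sum_(l <oo) (l`!%:R^-1 * (M l * kappa (p + l) * near_volume d p t ^+ l))%:E)%E.

Let palm_expansion_fin p t M (g : forall l, (p + l).-tuple (pt R d) -> R) :
  (1 <= p)%N -> 0 <= t -> local_family t M g -> (family_bound p t M < +oo)%E ->
  {ae lebk R d p, forall x, exists a : R,
    ((\int[palm p x]_Y expansion g x Y) * (rho x)%:E)%E = a%:E}.
Proof.
move=> p1 t0 lg fin.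
have a1 := palm_expansion corr palmP kappa0 rho_le p1 t0 lg.
have a2 := ae_foralln (fun l => family_integral_le corr kappa0 rho_le p1 t0 lg l).
have := ae_and a1 a2.
apply: (@filterS _ (almost_everywhere (lebk R d p))) => x [-> le].
have i0 l : (0 <= family_integral rho g l x)%E by exact: (family_integral_ge0 corr p1 lg).
have s0 : (0 <= \sum_(l <oo) (l`!%:R^-1)%:E * family_integral rho g l x)%E.
  by apply: nneseries_ge0 => l _ _; rewrite mule_ge0// lee_fin invr_ge0.
have : (\sum_(l <oo) (l`!%:R^-1)%:E * family_integral rho g l x < +oo)%E.
  apply: le_lt_trans fin; apply: lee_nneseries => [l _ _|l _].
    by rewrite mule_ge0// lee_fin invr_ge0.
  by rewrite EFinM; apply: lee_wpmul2l; [rewrite lee_fin invr_ge0|exact: le].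
case: (\sum_(l <oo) _)%E s0 => // a _ _; by exists a.
Qed.

Let single p t M (psi : p.-tuple (pt R d) -> lfset R d -> R) :
  (1 <= p)%N -> 0 <= t -> local_functional t M psi -> (family_bound p t M < +oo)%E ->
  {ae lebk R d p, forall x : p.-tuple (pt R d), uniq x -> exists a b : R,
    [/\ ((\int[palm p x]_Y expansion (mobp t psi) x Y) * (rho x)%:E)%E = a%:E,
        ((\int[palm p x]_Y expansion (mobn t psi) x Y) * (rho x)%:E)%E = b%:E &
        palm_mean psi x = (a - b)%:E]}.
Proof.
move=> p1 t0 lpsi fin; have [_ rho0 _ _] := corr p1.
have := ae_and (palm_expansion_fin p1 t0 (local_mobp lpsi) fin)
  (palm_expansion_fin p1 t0 (local_mobn lpsi) fin).
apply: (@filterS _ (almost_everywhere (lebk R d p))) => x [[a ha] [b hb]] ux.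
exists a, b; split => //.
apply: (integral_diff_scaled _ _ _ _ _ ha hb) => //.
- exact: (measurable_expansion (local_mobp lpsi) (measurable_cst x) (@measurable_id _ _ setT)).
- exact: (measurable_expansion (local_mobn lpsi) (measurable_cst x) (@measurable_id _ _ setT)).
- by move=> Y; exact: expansion_ge0 (local_mobp lpsi) _ _.
- by move=> Y; exact: expansion_ge0 (local_mobn lpsi) _ _.
- move=> Y; have [a' [b' [-> -> ->]]] := functional_expansion t0 lpsi Y ux.
  by rewrite EFinB.
Qed.

Variables (phi : R -> R) (c C : nat -> R).
Hypothesis decay : correlation_decay rho phi c C.

(** Each functional is a difference of two nonnegative expansions, so [palm_mixing] is applied to
    four pairs of signs, which yields the factor 4. As [E] is quantified inside the
    almost-everywhere statement, one null set serves every real bound on the error. *)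
Lemma functional_mixing p q t M1 M2 (psi1 : p.-tuple (pt R d) -> lfset R d -> R)
    (psi2 : q.-tuple (pt R d) -> lfset R d -> R) :
  (1 <= p)%N -> (1 <= q)%N -> 0 <= t ->
  local_functional t M1 psi1 -> local_functional t M2 psi2 ->
  (family_bound p t M1 < +oo)%E -> (family_bound q t M2 < +oo)%E ->
  {ae lebk R d (p + q), forall z : (p + q).-tuple (pt R d), uniq z -> 2 * t < sep z ->
    forall E : R, (mixing_error d p q t M1 M2 phi c C (sep z) <= E%:E)%E ->
    exists a b1 b2 : R,
    [/\ palm_mean (fun x Y => psi1 (tfst x) Y * psi2 (tsnd x) Y) z = a%:E,
        palm_mean psi1 (tfst z) = b1%:E, palm_mean psi2 (tsnd z) = b2%:E &
        `|a - b1 * b2| <= 4 * E]}.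
Proof.
move=> p1 q1 t0 l1 l2 fin1 fin2.
have pq1 : (1 <= p + q)%N by rewrite addn_gt0 p1.
have [_ rho0 _ _] := corr pq1.
have s1 := ae_tfst q (single p1 t0 l1 fin1).
have s2 := ae_tsnd p (single q1 t0 l2 fin2).
have lp1 := local_mobp l1; have ln1 := local_mobn l1.
have lp2 := local_mobp l2; have ln2 := local_mobn l2.
have mix g1 g2 (f1 : local_family t M1 g1) (f2 : local_family t M2 g2) :=
  palm_mixing corr palmP kappa0 rho_le p1 q1 t0 f1 f2 decay.
have := ae_and (ae_and s1 s2) (ae_and
  (ae_and (mix _ _ lp1 lp2) (mix _ _ lp1 ln2)) (ae_and (mix _ _ ln1 lp2) (mix _ _ ln1 ln2))).
apply: (@filterS _ (almost_everywhere (lebk R d (p + q)))) => z.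
move=> [[h1 h2] [[mpp mpn] [mnp mnn]]] uz st E hE.
have [ap [an [eap ean em1]]] := h1 (uniq_tfst uz).
have [bp [bn [ebp ebn em2]]] := h2 (uniq_tsnd uz).
have me1 g (f : local_family t M1 g) : measurable_fun setT (fun Y => expansion g (tfst z) Y).
  exact: (measurable_expansion f (measurable_cst _) (@measurable_id _ _ setT)).
have me2 g (f : local_family t M2 g) : measurable_fun setT (fun Y => expansion g (tsnd z) Y).
  exact: (measurable_expansion f (measurable_cst _) (@measurable_id _ _ setT)).
have e0 g1 g2 (f1 : local_family t M1 g1) (f2 : local_family t M2 g2) Y :
    (0 <= expansion g1 (tfst z) Y * expansion g2 (tsnd z) Y)%E.
  by apply: mule_ge0; [exact: expansion_ge0 f1 _ _|exact: expansion_ge0 f2 _ _].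
have i0 g1 g2 (f1 : local_family t M1 g1) (f2 : local_family t M2 g2) :
    (0 <= (\int[palm (p + q)%N z]_Y (expansion g1 (tfst z) Y * expansion g2 (tsnd z) Y)) *
      (rho z)%:E)%E.
  by apply: mule_ge0; [apply: integral_ge0 => Y _; exact: e0|rewrite lee_fin].
have [app eapp dpp] := near_real hE (i0 _ _ lp1 lp2) eap ebp (mpp st).
have [apn eapn dpn] := near_real hE (i0 _ _ lp1 ln2) eap ebn (mpn st).
have [anp eanp dnp] := near_real hE (i0 _ _ ln1 lp2) ean ebp (mnp st).
have [ann eann dnn] := near_real hE (i0 _ _ ln1 ln2) ean ebn (mnn st).
exists ((app + ann) - (apn + anp)), (ap - an), (bp - bn); split => //; last first.
  exact: dist_quad dpp dpn dnp dnn.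
have mm g1 g2 (f1 : local_family t M1 g1) (f2 : local_family t M2 g2) :
    measurable_fun setT (fun Y => expansion g1 (tfst z) Y * expansion g2 (tsnd z) Y)%E.
  by apply: emeasurable_funM; [exact: me1|exact: me2].
have ep := integral_add_scaled (mm _ _ lp1 lp2) (mm _ _ ln1 ln2) (e0 _ _ lp1 lp2) (e0 _ _ ln1 ln2) eapp eann.
have en := integral_add_scaled (mm _ _ lp1 ln2) (mm _ _ ln1 lp2) (e0 _ _ lp1 ln2) (e0 _ _ ln1 lp2) eapn eanp.
apply: (integral_diff_scaled _ _ _ _ _ ep en) => //.
- exact: (emeasurable_funD (mm _ _ lp1 lp2) (mm _ _ ln1 ln2)).
- exact: (emeasurable_funD (mm _ _ lp1 ln2) (mm _ _ ln1 lp2)).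
- by move=> Y; apply: adde_ge0; exact: e0.
- by move=> Y; apply: adde_ge0; exact: e0.
move=> Y.
have [a' [b' [-> -> ->]]] := functional_expansion t0 l1 Y (uniq_tfst uz).
have [a'' [b'' [-> -> ->]]] := functional_expansion t0 l2 Y (uniq_tsnd uz).
rewrite -!(EFinM, EFinD, EFinN); congr EFin; ring.
Qed.

End mixing_functionals.

(** * Bounds on correlation functions and Palm means *)

(** The criterion for equality is applied to the maximum of [f] and [g] against [g]: their integrals
    over [B] agree, as is seen by cutting [B] along the set where [g < f]. *)
Lemma ae_le_of_integrals {d : measure_display} {T : measurableType d}
    {R : realType} (mu : {sigma_finite_measure set T -> \bar R})
    (f g : T -> \bar R) (c : R) :
  measurable_fun setT f -> measurable_fun setT g ->
  (forall x, 0 <= f x)%E -> (forall x, 0 <= g x)%E ->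
  {ae mu, forall x, g x <= c%:E}%E ->
  (forall B, measurable B -> \int[mu]_(x in B) f x <= \int[mu]_(x in B) g x)%E ->
  {ae mu, forall x, f x <= g x}%E.
Proof.
move=> mf mg f0 g0 gc fg.
have mh : measurable_fun setT (fun x => maxe (f x) (g x)) by exact: measurable_maxe.
have h0 x : (0 <= maxe (f x) (g x))%E by rewrite le_max f0.
have mA : measurable [set x | g x < f x]%E.
  by rewrite -[X in measurable X]setTI; exact: emeasurable_fun_lt.
have := @ae_eq_of_integrals _ _ _ mu _ g c mh mg h0 g0 gc.
have E : forall B, measurable B ->
    (\int[mu]_(x in B) maxe (f x) (g x) = \int[mu]_(x in B) g x)%E.
  move=> B mB; apply/eqP; rewrite eq_le; apply/andP; split; last first.
    apply: ge0_le_integral => //; try exact: measurable_funTS.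
    by move=> x _; rewrite le_max lexx orbT.
  rewrite -(setUIDK B [set x | g x < f x]%E).
  rewrite ge0_integral_setU//=; last 4 first.
  - exact: measurableI.
  - exact: measurableD.
  - exact: measurable_funTS.
  - by apply/disj_set2P/seteqP; split => // x [[_ a] [_ b]].
  rewrite ge0_integral_setU//=; last 4 first.
  - exact: measurableI.
  - exact: measurableD.
  - exact: measurable_funTS.
  - by apply/disj_set2P/seteqP; split => // x [[_ a] [_ b]].
  apply: leeD.
    rewrite (eq_integral f); first by apply: fg; exact: measurableI.
    by move=> x /set_mem[_ /= gf]; rewrite max_l// ltW.
  rewrite (eq_integral g)// => x /set_mem[_ /= /negP].
  by rewrite -leNgt => /max_r.
move=> /(_ E); apply: (@filterS _ (almost_everywhere mu)) => x <-.
by rewrite le_max lexx.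
Qed.

Lemma measurable_window {R : realType} {d : nat} (n : option nat) :
  measurable (window n : set (pt R d)).
Proof.
case: n => [m|] //=; pose c : R := m%:R `^ d%:R^-1 / 2.
rewrite (_ : [set x | _] = \bigcap_(i in [set: 'I_d])
   ((fun x : pt R d => tnth x i) @^-1` `[- c, c]%classic)).
  apply: fin_bigcap_measurable => // i _; rewrite -[X in measurable X]setTI.
  exact: (measurable_tnth i).
apply/seteqP; split => x /=.
  by move=> h i _; rewrite /= in_itv/= -ler_norml.
by move=> h i; have := h i Logic.I; rewrite /= in_itv/= -ler_norml.
Qed.

(** A score is measurable in each variable separately. Translation invariance moves the point to the
    origin, and joint measurability follows from that of translating the configuration. *)
Lemma measurable_score {R : realType} {d : nat} (xi : pt R d -> lfset R d -> R)
    {dX : measure_display} {T : measurableType dX} (x : T -> pt R d) (Y : T -> lfset R d) :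
  score_function xi -> measurable_fun setT x -> measurable_fun setT Y ->
  measurable_fun setT (fun s => xi (x s) (Y s)).
Proof.
move=> [_ mxi _ xiT] mx mY.
pose opp (y : pt R d) : pt R d := [tuple - tnth y i | i < d].
have mopp : measurable_fun setT (fun s => opp (x s)).
  apply/measurable_fun_tnthP => i.
  rewrite [X in measurable_fun _ X](_ : _ = (fun s => - tnth (x s) i)); last first.
    by apply/funext => s /=; rewrite tnth_mktuple.
  by apply: measurable_funN; exact: (measurableT_comp (measurable_tnth i) mx).
rewrite (_ : (fun s => _) =
   (fun s => xi [tuple 0 | i < d] (lf_translate (opp (x s)) (Y s)))).
  exact: (measurableT_comp (mxi _) (measurable_lf_translate mY mopp)).
apply/funext => s; rewrite -[LHS](xiT (opp (x s))); congr (xi _ _).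
by apply: eq_from_tnth => i; rewrite !tnth_mktuple subrr.
Qed.

Lemma measurable_lfI_window {R : realType} {d : nat} (n : option nat)
    {dX : measure_display} {T : measurableType dX} (Y : T -> lfset R d) :
  measurable_fun setT Y -> measurable_fun setT (fun s => lfI (Y s) (window n)).
Proof.
move=> mY; apply: (@measurable_lfI _ _ _ _ _ mY (fun=> window n)) => //.
rewrite (_ : [set z | _] = [set: T] `*` window n).
  by apply: measurableX => //; exact: measurable_window.
by apply/seteqP; split => [[a b]|[a b] []].
Qed.

Lemma measurable_lfI_cball {R : realType} {d : nat} (r : R)
    {dX : measure_display} {T : measurableType dX} (x : T -> pt R d) (Y : T -> lfset R d) :
  measurable_fun setT x -> measurable_fun setT Y ->
  measurable_fun setT (fun s => lfI (Y s) (cball (x s) r)).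
Proof.
move=> mx mY; apply: (@measurable_lfI _ _ _ _ _ mY (fun s => cball (x s) r)) => //.
rewrite (_ : [set z | _] = (fun z : T * pt R d => dist (x z.1) z.2) @^-1` `]-oo, r]%classic).
  rewrite -[X in measurable X]setTI; apply: measurable_dist => //.
  exact: (measurableT_comp mx measurable_fst).
by apply/seteqP; split => [[a b]|[a b]]; rewrite /= in_itv.
Qed.

(** The recursion of the decay inequality for one point against [k] others, where [phi] is at most
    1. The value at 0 is a dummy. *)
Fixpoint correlation_bound {R : realType} (lam : R) (C : nat -> R) (k : nat) : R :=
  if k is k'.+1 then
    if k' is 0%N then lam else lam * correlation_bound lam C k' + `|C k|
  else 0.

Lemma correlation_bound_ge0 {R : realType} (lam : R) C k : 0 <= lam ->
  0 <= correlation_bound lam C k.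
Proof.
move=> lam0; elim: k => //= -[|k] IH //.
by rewrite addr_ge0// mulr_ge0.
Qed.

Section bounds.
Context {dd : measure_display} {Omega : measurableType dd} {R : realType}.
Variables (P : probability Omega R) (d : nat) (X : {RV P >-> lfset R d})
  (rho : forall k, k.-tuple (pt R d) -> R)
  (palm : forall k, R.-pker (k.-tuple (pt R d)) ~> lfset R d).

Lemma correlation_le (lam : R) phi c C : 0 <= lam ->
  (forall k, (1 <= k)%N -> correlation_function X (@rho k)) ->
  {ae lebk R d 1, forall x, rho x = lam} -> correlation_decay rho phi c C ->
  forall k, (1 <= k)%N ->
  {ae lebk R d k, forall x, rho x <= correlation_bound lam C k}.
Proof.
move=> lam0 corr rho1 [[phi01 _ _] c0 dec]; elim=> [//|[_ _|k IH _]].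
  by apply: (@filterS _ (almost_everywhere (lebk R d 1)) _ _ _ _ rho1) => x ->.
have a1 := ae_tfst k.+1 rho1.
have a2 := ae_tsnd 1 (IH isT).
have := ae_and (ae_and a1 a2) (dec 1%N k.+1 isT isT).
apply: (@filterS _ (almost_everywhere (lebk R d (1 + k.+1)))) => x [[h1 h2]].
rewrite h1 ler_distl => /andP[_ h]; apply: (le_trans h).
have [_ r0 _ _] := corr k.+1 isT.
apply: lerD; first by rewrite ler_wpM2l.
have /andP[p0 p1] : 0 <= phi (c (1 + k.+1)%N * sep x) <= 1.
  by apply: phi01; rewrite mulr_ge0 ?sep_ge0// ltW// c0.
by apply: (le_trans (ler_norm _)); rewrite normrM (ger0_norm p0) ler_piMr.
Qed.

Hypothesis corr : forall k, (1 <= k)%N -> correlation_function X (@rho k).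
Hypothesis palmP : forall k, (1 <= k)%N -> palm_version X (palm k).
Variable kappa : nat -> R.
Hypothesis kappa0 : forall k, 0 <= kappa k.
Hypothesis rho_le : forall k, (1 <= k)%N -> {ae lebk R d k, forall x, rho x <= kappa k}.

(** The factorial moment measure has density [rho], so its null sets are Lebesgue null within the
    set where [rho] is nonzero. Elsewhere a Palm mean multiplied by [rho] is zero anyway. *)
Lemma ae_factorial_moment l (Q : l.+1.-tuple (pt R d) -> Prop) :
  {ae factorial_moment X (k := l.+1), forall x, Q x} ->
  {ae lebk R d l.+1, forall x, rho x != 0 -> Q x}.
Proof.
have [mrho rho0 _ rhoE] := corr (isT : (1 <= l.+1)%N).
move=> [A [mA A0 QA]].
have i0 : (\int[lebk R d l.+1]_(x in A) (rho x)%:E = 0)%E by rewrite -rhoE.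
have mr : measurable_fun A (fun x => (rho x)%:E) by apply/measurable_EFinP/measurable_funTS.
have /(ae_eq_integral_abs (lebk R d l.+1) mA mr) : (\int[lebk R d l.+1]_(x in A) `|(rho x)%:E| = 0)%E.
  by rewrite -i0; apply: eq_integral => x _; rewrite gee0_abs// lee_fin.
apply: (@filterS _ (almost_everywhere (lebk R d l.+1))) => x h rx.
apply: contrapT => nQ; move/eqP: rx; apply.
by have [] := h (QA x nQ).
Qed.

(* Exchanging the coordinates [0] and [i] does not change the sums over k-tuples
   of points, hence a bound on the first coordinate holds for all of them; both
   sides are compared after integration, through Campbell's formula. *)
Lemma palm_coord_bound l (f : pt R d * lfset R d -> \bar R) (W : set (pt R d)) (M : R) :
  measurable_fun setT f -> (forall z, 0 <= f z)%E -> measurable W -> 0 <= M ->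
  {ae factorial_moment X (k := l.+1), forall x, (forall i, W (tnth x i)) ->
    (\int[palm l.+1 x]_Y f (thead x, Y) <= M%:E)%E} ->
  forall i, {ae lebk R d l.+1, forall x, (forall j, W (tnth x j)) ->
    ((\int[palm l.+1 x]_Y f (tnth x i, Y)) * (rho x)%:E <= (M * rho x)%:E)%E}.
Proof.
move=> mf f0 mW M0 hM i.
have l1 : (1 <= l.+1)%N by [].
have [mrho rho0 _ rhoE] := corr l1.
pose WW : set (l.+1.-tuple (pt R d)) := [set x | forall j, W (tnth x j)].
have mWW : measurable WW.
  exact: (measurable_tuple_box (fun=> mW)).
have mfi j : measurable_fun setT
    (fun z : l.+1.-tuple (pt R d) * lfset R d => f (tnth z.1 j, z.2)).
  apply: (measurableT_comp mf); apply: measurable_fun_pair => //.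
  exact: (measurableT_comp (measurable_tnth j) measurable_fst).
have m1 (B : set (l.+1.-tuple (pt R d))) : measurable B ->
    measurable_fun setT (fun x => (\1_B x)%:E : \bar R).
  by move=> mB; exact/measurable_EFinP/measurable_indic.
(* The indicator of [WW] carries the window condition, so that the comparison of integrals can run
   over all measurable sets. *)
pose F x : \bar R := ((\int[palm l.+1 x]_Y f (tnth x i, Y)) * (rho x)%:E * (\1_WW x)%:E)%E.
pose G x : \bar R := ((M * rho x)%:E * (\1_WW x)%:E)%E.
suff : {ae lebk R d l.+1, forall x, (F x <= G x)%E}.
  apply: (@filterS _ (almost_everywhere (lebk R d l.+1))) => x + Wx.
  by rewrite /F /G indicE mem_set// !mule1.
have mpalm j : measurable_fun setT (fun x => (\int[palm l.+1 x]_Y f (tnth x j, Y)) * (rho x)%:E)%E.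
  apply: emeasurable_funM; last exact/measurable_EFinP.
  exact: (measurable_integral_palm _ (mfi j)).
have p0 j x : (0 <= (\int[palm l.+1 x]_Y f (tnth x j, Y)) * (rho x)%:E)%E.
  by apply: mule_ge0; [exact: integral_ge0|rewrite lee_fin].
have ind0 (B : set (l.+1.-tuple (pt R d))) x : (0 <= (\1_B x)%:E :> \bar R)%E by rewrite lee_fin.
have [F0 G0] : (forall x, 0 <= F x)%E /\ (forall x, 0 <= G x)%E.
  split=> x; first exact: mule_ge0.
  by apply: mule_ge0 => //; rewrite lee_fin mulr_ge0.
have mG : measurable_fun setT G.
  apply: emeasurable_funM; last exact: m1.
  by apply/measurable_EFinP; exact: measurable_funM.
apply: (ae_le_of_integrals (mu := lebk R d l.+1) (c := M * kappa l.+1)) => //.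
- by apply: emeasurable_funM => //; exact: m1.
- apply: (@filterS _ (almost_everywhere (lebk R d l.+1)) _ _ _ _ (rho_le l1)) => x hx.
  rewrite /G -EFinM lee_fin indicE; case: (x \in WW); rewrite ?mulr1 ?mulr0 ?mulr_ge0//.
  by rewrite ler_wpM2l.
move=> B mB.
pose tr (j : 'I_l.+1) := if j == ord0 then i else if j == i then ord0 else j.
have trK : involutive tr.
  move=> j; rewrite /tr; case: (eqVneq j ord0) => [->|j0].
    by case: (eqVneq i ord0) => [->|_]; rewrite ?eqxx.
  by case: (eqVneq j i) => [->|ji]; rewrite ?eqxx// (negPf j0) (negPf ji).
pose sw (x : l.+1.-tuple (pt R d)) : l.+1.-tuple (pt R d) :=
  [tuple tnth x (tr j) | j < l.+1].
have swK : involutive sw.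
  by move=> x; apply: eq_from_tnth => j; rewrite !tnth_mktuple trK.
have msw : measurable_fun setT sw.
  apply/measurable_fun_tnthP => j.
  rewrite [X in measurable_fun _ X](_ : _ = (fun x => tnth x (tr j))); last first.
    by apply/funext => x /=; rewrite tnth_mktuple.
  exact: measurable_tnth.
pose D := B `&` WW.
have mD : measurable D by exact: measurableI.
have mDs : measurable (sw @^-1` D) by rewrite -[X in measurable X]setTI; exact: msw.
have camp (A : set (l.+1.-tuple (pt R d))) j : measurable A ->
    (\int[P]_w (\esum_(x in ktuples l.+1 (X w)) (f (tnth x j, X w) * (\1_A x)%:E)) =
     \int[lebk R d l.+1]_x ((\int[palm l.+1 x]_Y f (tnth x j, Y)) * (rho x)%:E * (\1_A x)%:E))%E.
  move=> mA.
  rewrite (campbell corr palmP (f := fun z => (f (tnth z.1 j, z.2) * (\1_A z.1)%:E)%E))//.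
  - apply: eq_integral => x _ /=; rewrite ge0_integralZr//; first by rewrite muleAC.
    apply: (measurableT_comp mf); apply: measurable_fun_pair => //.
  - apply: emeasurable_funM => //; exact: (measurableT_comp (m1 _ mA) measurable_fst).
  - by move=> z; apply: mule_ge0.
have camp1 (A : set (l.+1.-tuple (pt R d))) : measurable A ->
    (\int[P]_w (\esum_(x in ktuples l.+1 (X w)) (\1_A x)%:E) =
     \int[lebk R d l.+1]_x ((rho x)%:E * (\1_A x)%:E))%E.
  move=> mA.
  rewrite (campbell corr palmP (f := fun z => (\1_A z.1)%:E))//.
  - apply: eq_integral => x _ /=; rewrite integral_cst// prob_kernel mule1 muleC//.
  - exact: (measurableT_comp (m1 _ mA) measurable_fst).
have swmem (Y : lfset R d) x : ktuples l.+1 Y x -> ktuples l.+1 Y (sw x).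
  move=> [/tuple_uniqP ux Yx]; split.
    by apply/tuple_uniqP => a b; rewrite !tnth_mktuple => /ux /(inv_inj trK).
  by move=> a; rewrite tnth_mktuple.
have reind (Y : lfset R d) (h : l.+1.-tuple (pt R d) -> \bar R) :
    ((\esum_(x in ktuples l.+1 Y) h (sw x)) = \esum_(x in ktuples l.+1 Y) h x)%E.
  symmetry; apply: (@reindex_esum R _ _ (ktuples l.+1 Y) (ktuples l.+1 Y) sw h); split.
  - by move=> x; exact: swmem.
  - by move=> x y _ _ /(congr1 sw); rewrite !swK.
  - by move=> x Yx; exists (sw x); [exact: swmem|rewrite swK].
rewrite [leLHS]integral_mkcond [leRHS]integral_mkcond.
have restr (H : l.+1.-tuple (pt R d) -> \bar R) :
    ((fun x => H x * (\1_WW x)%:E) \_ B = (fun x => H x * (\1_D x)%:E))%E.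
  apply/funext => x; rewrite patchE /D !indicE in_setI.
  by case: (x \in B) => //=; rewrite mule0.
rewrite /F /G !restr -camp//.
have -> : (\int[P]_w (\esum_(x in ktuples l.+1 (X w)) (f (tnth x i, X w) * (\1_D x)%:E)) =
   \int[P]_w (\esum_(x in ktuples l.+1 (X w)) (f (tnth x ord0, X w) * (\1_(sw @^-1` D) x)%:E)))%E.
  apply: eq_integral => w _.
  rewrite -(reind (X w) (fun x => f (tnth x i, X w) * (\1_D x)%:E)%E); apply: eq_esum => x _.
  by rewrite tnth_mktuple (_ : tr i = ord0)// /tr eqxx; case: eqP.
rewrite camp//.
apply: (@le_trans _ _ (\int[lebk R d l.+1]_x (M%:E * ((rho x)%:E * (\1_(sw @^-1` D) x)%:E)))%E).
  apply: ae_ge0_le_integral => //.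
  - by move=> x _; exact: mule_ge0.
  - by apply: emeasurable_funM => //; exact: m1.
  - by move=> x _; rewrite !mule_ge0// lee_fin.
  - apply: emeasurable_funM => //; apply: emeasurable_funM; last exact: m1.
    exact/measurable_EFinP.
  have := ae_factorial_moment hM.
  apply: (@filterS _ (almost_everywhere (lebk R d l.+1))) => x hx _.
  rewrite indicE; have [/set_mem Dx|_] := boolP (x \in sw @^-1` D); last by rewrite !mule0.
  rewrite !mule1; have [->|rx] := eqVneq (rho x) 0; first by rewrite !mule0.
  apply: lee_wpmul2r; first by rewrite lee_fin.
  apply: hx => // a; have [_ /(_ (tr a))] := Dx.
  by rewrite tnth_mktuple trK.
rewrite ge0_integralZl//; last 2 first.
- by apply: emeasurable_funM; [exact/measurable_EFinP|exact: m1].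
- by move=> x _; rewrite mule_ge0// lee_fin.
rewrite -camp1//.
have -> : (\int[P]_w (\esum_(x in ktuples l.+1 (X w)) (\1_(sw @^-1` D) x)%:E) =
   \int[P]_w (\esum_(x in ktuples l.+1 (X w)) (\1_D x)%:E))%E.
  by apply: eq_integral => w _; rewrite -(reind (X w) (fun x => (\1_D x)%:E)).
rewrite camp1// -ge0_integralZl//; last 2 first.
- by apply: emeasurable_funM; [exact/measurable_EFinP|exact: m1].
- by move=> x _; rewrite mule_ge0// lee_fin.
by rewrite le_eqVlt; apply/orP; left; apply/eqP; apply: eq_integral => x _; rewrite muleA -EFinM.
Qed.

End bounds.

Section scaled_integrals.
Context {dm : measure_display} {T : measurableType dm} {R : realType}.
Variable mu : {measure set T -> \bar R}.

Let scaled_fin (G : T -> \bar R) (r c : R) : 0 < r -> (forall y, 0 <= G y)%E ->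
  ((\int[mu]_y G y) * r%:E <= c%:E)%E -> exists2 g, (\int[mu]_y G y = g%:E)%E & g * r <= c.
Proof.
move=> r0 G0; have : (0 <= \int[mu]_y G y)%E by exact: integral_ge0.
case: (\int[mu]_y G y)%E => [g _|_|//]; first by rewrite -EFinM lee_fin; exists g.
by rewrite mulyr gtr0_sg// mul1e leNgt ltry.
Qed.

Let norm_le (psi : T -> R) (G : T -> \bar R) :
  measurable_fun setT psi -> measurable_fun setT G -> (forall y, (`|psi y|%:E <= G y)%E) ->
  (\int[mu]_y `|(psi y)%:E| <= \int[mu]_y G y)%E.
Proof.
move=> mpsi mG h; apply: ge0_le_integral => //.
- by apply/measurable_EFinP; exact: measurableT_comp.
- by move=> y _; exact: h.
Qed.

Let scaled_integrable (psi : T -> R) (G : T -> \bar R) (r c : R) :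
  measurable_fun setT psi -> measurable_fun setT G -> 0 < r ->
  (forall y, (`|psi y|%:E <= G y)%E) -> ((\int[mu]_y G y) * r%:E <= c%:E)%E ->
  mu.-integrable setT (fun y => (psi y)%:E).
Proof.
move=> mpsi mG rp psiG Gc.
have G0 y : (0 <= G y)%E by apply: le_trans (psiG y); rewrite lee_fin.
have [g iG _] := scaled_fin rp G0 Gc.
apply/integrableP; split; first exact/measurable_EFinP.
by apply: le_lt_trans (norm_le mpsi mG psiG) _; rewrite iG ltry.
Qed.

(** For [r = 0] the product is zero whatever the integral is, and [c] is nonnegative by the last
    hypothesis. For [r > 0] the dominating [G] makes [psi] integrable. *)
Lemma scaled_integral_le (psi : T -> R) (G : T -> \bar R) (r c : R) :
  measurable_fun setT psi -> measurable_fun setT G -> 0 <= r ->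
  (forall y, (`|psi y|%:E <= G y)%E) -> ((\int[mu]_y G y) * r%:E <= c%:E)%E ->
  exists2 a : R, ((\int[mu]_y (psi y)%:E) * r%:E = a%:E)%E & `|a| <= c.
Proof.
move=> mpsi mG r0 psiG Gc.
have G0 y : (0 <= G y)%E by apply: le_trans (psiG y); rewrite lee_fin.
have [rz|rz] := eqVneq r 0.
  by exists 0; [rewrite rz mule0|rewrite normr0; move: Gc; rewrite rz mule0 lee_fin].
have rp : 0 < r by rewrite lt_neqAle eq_sym rz.
have [g iG gc] := scaled_fin rp G0 Gc.
have intp := scaled_integrable mpsi mG rp psiG Gc.
have fin := integrable_fin_num measurableT intp.
have := le_trans (le_abse_integral mu measurableT (measurable_int mu intp)) (norm_le mpsi mG psiG).
rewrite iG; move: fin => /fineK <-; set a := fine _ => /=; rewrite lee_fin => ag.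
exists (a * r); rewrite ?EFinM// normrM (gtr0_norm rp).
by apply: le_trans gc; rewrite ler_wpM2r.
Qed.

(** [G1] and [G2] serve only for integrability; the quantitative bound is that of [G]. *)
Lemma scaled_integral_dist (psi1 psi2 : T -> R) (G1 G2 G : T -> \bar R) (r c1 c2 c : R) :
  measurable_fun setT psi1 -> measurable_fun setT psi2 ->
  measurable_fun setT G1 -> measurable_fun setT G2 -> measurable_fun setT G -> 0 <= r ->
  (forall y, (`|psi1 y|%:E <= G1 y)%E) -> (forall y, (`|psi2 y|%:E <= G2 y)%E) ->
  (forall y, (`|psi1 y - psi2 y|%:E <= G y)%E) ->
  ((\int[mu]_y G1 y) * r%:E <= c1%:E)%E -> ((\int[mu]_y G2 y) * r%:E <= c2%:E)%E ->
  ((\int[mu]_y G y) * r%:E <= c%:E)%E ->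
  exists a b : R, [/\ ((\int[mu]_y (psi1 y)%:E) * r%:E = a%:E)%E,
    ((\int[mu]_y (psi2 y)%:E) * r%:E = b%:E)%E & `|a - b| <= c].
Proof.
move=> m1 m2 mG1 mG2 mG r0 h1 h2 h i1 i2 i.
have [a ea _] := scaled_integral_le m1 mG1 r0 h1 i1.
have [b eb _] := scaled_integral_le m2 mG2 r0 h2 i2.
have m12 : measurable_fun setT (fun y => psi1 y - psi2 y) by exact: measurable_funB.
have [e ee ec] := scaled_integral_le m12 mG r0 h i.
exists a, b; split => //; suff <- : e = a - b by [].
have [rz|rz] := eqVneq r 0.
  by move: ea eb ee; rewrite rz !mule0 => -[<-] [<-] [<-]; rewrite subrr.
have rp : 0 < r by rewrite lt_neqAle eq_sym rz.
have I1 := scaled_integrable m1 mG1 rp h1 i1; have I2 := scaled_integrable m2 mG2 rp h2 i2.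
have f1 := integrable_fin_num measurableT I1; have f2 := integrable_fin_num measurableT I2.
move: ee; under eq_integral do rewrite EFinB.
rewrite integralB//; move: ea eb.
rewrite -(fineK f1) -(fineK f2) -EFinB -!EFinM => -[<-] [<-] [<-].
by rewrite mulrBl.
Qed.

End scaled_integrals.

Section products.
Context {R : realType} {d : nat}.
Implicit Type th : pt R d -> lfset R d -> R.

Definition pprod th p (ks : p.-tuple nat) (x : p.-tuple (pt R d)) (Y : lfset R d) : R :=
  \prod_(i < p) th (tnth x i) Y ^+ tnth ks i.

Lemma pprod_split th p q (ks : (p + q).-tuple nat) z Y :
  pprod th ks z Y = pprod th (tfst ks) (tfst z) Y * pprod th (tsnd ks) (tsnd z) Y.
Proof.
rewrite /pprod big_split_ord /=.
by congr (_ * _); apply: eq_bigr => i _; rewrite !tnth_mktuple.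
Qed.

Lemma measurable_pprod th p (ks : p.-tuple nat) :
  measurable_fun setT (fun z : pt R d * lfset R d => th z.1 z.2) ->
  measurable_fun setT (fun z : p.-tuple (pt R d) * lfset R d => pprod th ks z.1 z.2).
Proof.
move=> mth; rewrite /pprod; apply: measurable_prod => i _.
apply: measurable_funX; apply: (measurableT_comp mth (g := fun z => (tnth z.1 i, z.2))).
apply: measurable_fun_pair => //.
exact: (measurableT_comp (measurable_tnth i) measurable_fst).
Qed.

(** Positive exponents matter: a zero exponent would give the factor [0 ^+ 0 = 1]. *)
Lemma pprod_outside th p (ks : p.-tuple nat) x (Y : lfset R d) :
  (forall y (Y : lfset R d), ~ lf_set Y y -> th y Y = 0) ->
  (forall i, (1 <= tnth ks i)%N) ->
  ~ (forall i, lf_set Y (tnth x i)) -> pprod th ks x Y = 0.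
Proof.
move=> th0 k1 /existsNP[i Yi]; rewrite /pprod (bigD1 i)//= th0// expr0n.
by rewrite gtn_eqF ?mul0r// k1.
Qed.

Lemma pprod_local t th p (ks : p.-tuple nat) x Y :
  (forall y Y, th y Y = th y (lfI Y (cball y t))) ->
  pprod th ks x Y = pprod th ks x (lfI Y (near_points t x)).
Proof.
move=> thl; apply: eq_bigr => i _; rewrite thl [in RHS]thl; congr (th _ _ ^+ _).
apply: lfset_ext; apply/seteqP; split => y [].
  by move=> Yy yi; split => //; split => //; exists i.
by move=> [].
Qed.

Lemma pprod_norm_le th p (ks : p.-tuple nat) x Y (B : R) : 1 <= B ->
  (forall i, `|th (tnth x i) Y| <= B) ->
  `|pprod th ks x Y| <= B ^+ (\sum_(i < p) tnth ks i).
Proof.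
move=> B1 h; rewrite /pprod normr_prod.
rewrite -prodrXr; apply: ler_prod => i _; rewrite normr_ge0 normrX /=.
by rewrite lerXn2r ?nnegrE// (le_trans ler01).
Qed.

End products.

(** Replaces a product of powers of several scores, bounded by a power of the largest one, by a sum
    of powers of single scores, which the moment condition controls. *)
Lemma max_le_sum {R : realType} p (Z : 'I_p -> R) N : (1 <= p)%N ->
  (forall i, 1 <= Z i) ->
  exists2 z, (forall i, Z i <= z) & exists2 i, z = Z i & z ^+ N <= \sum_i Z i ^+ N.
Proof.
move=> p1 Z1; have i0 := Ordinal p1.
pose i := [arg max_(i > i0) Z i]%O.
exists (Z i).
  move=> j; rewrite /i; case: (Order.TotalTheory.arg_maxP (i0 := i0) (P := predT) Z) => // k _; exact.
exists i => //; rewrite (bigD1 i)//= lerDl sumr_ge0// => j _.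
by rewrite exprn_ge0// (le_trans ler01).
Qed.

Lemma ae_sub {dm : measure_display} {T : measurableType dm} {R : realType}
    (mu : set T -> \bar R) (Q Q' : T -> Prop) :
  (forall x, Q x -> Q' x) -> {ae mu, forall x, Q x} -> {ae mu, forall x, Q' x}.
Proof.
by move=> QQ' [A [mA A0 QA]]; exists A; split => // x nQ'; apply: QA => /QQ'.
Qed.

(** * Moment bounds for Palm means of products of scores *)

Section moments.
Context {dd : measure_display} {Omega : measurableType dd} {R : realType}.
Variables (P : probability Omega R) (d : nat) (X : {RV P >-> lfset R d})
  (rho : forall k, k.-tuple (pt R d) -> R)
  (palm : forall k, R.-pker (k.-tuple (pt R d)) ~> lfset R d)
  (xi : pt R d -> lfset R d -> R).
Hypothesis corr : forall k, (1 <= k)%N -> correlation_function X (@rho k).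
Hypothesis palmP : forall k, (1 <= k)%N -> palm_version X (palm k).
Variable kappa : nat -> R.
Hypothesis kappa0 : forall k, 0 <= kappa k.
Hypothesis rho_le : forall k, (1 <= k)%N -> {ae lebk R d k, forall x, rho x <= kappa k}.
Hypothesis xiS : score_function xi.
Hypothesis moments : forall p : R, 1 < p -> moment_condition X palm xi p.

Definition windowed (n : option nat) (y : pt R d) (Y : lfset R d) : R :=
  xi y (lfI Y (window n)).

(** The lower cutoff 1, as in the moment condition, makes powers increase with the exponent. *)
Definition zscore n y Y : R := Num.max `|windowed n y Y| 1.

Lemma measurable_windowed n :
  measurable_fun setT (fun z : pt R d * lfset R d => windowed n z.1 z.2).
Proof. apply: (@measurable_score _ _ xi _ _ fst (fun z => lfI z.2 (window n)) xiS measurable_fst).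
exact: measurable_lfI_window measurable_snd. Qed.

Lemma windowed_outside n y (Y : lfset R d) : ~ (lf_set Y y /\ window n y) -> windowed n y Y = 0.
Proof. by move=> h; have [_ _ xi0 _] := xiS; apply: xi0 => -[]; tauto. Qed.

Lemma zscore_ge1 n y Y : 1 <= zscore n y Y.
Proof. by rewrite le_max lexx orbT. Qed.

Lemma measurable_zscore n :
  measurable_fun setT (fun z : pt R d * lfset R d => zscore n z.1 z.2).
Proof.
apply: measurable_maxr => //; apply: measurableT_comp => //.
exact: measurable_windowed.
Qed.

Lemma moment_coord l N : exists2 M : R, 0 <= M & forall n, window_index n -> forall i,
  {ae lebk R d l.+1, forall x, (forall j, window n (tnth x j)) ->
    ((\int[palm l.+1 x]_Y (zscore n (tnth x i) Y ^+ N)%:E) * (rho x)%:E <= (M * rho x)%:E)%E}.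
Proof.
(* The order of the moment has to dominate [N], to reach the number [l.+1] of points of the Palm
   measure, and to exceed 1. *)
pose Q := (maxn N l.+1).+1.
have Q1 : (1 : R) < Q%:R by rewrite ltr1n ltnS leq_max orbT.
have [M hM] := moments Q1.
exists `|M| => // n nn.
have mZ : measurable_fun setT (fun z : pt R d * lfset R d => (zscore n z.1 z.2 ^+ N)%:E : \bar R).
  by apply/measurable_EFinP; apply: measurable_funX; exact: measurable_zscore.
apply: (palm_coord_bound corr palmP kappa0 rho_le mZ) => //.
- by move=> z; rewrite lee_fin exprn_ge0// (le_trans ler01)// zscore_ge1.
- exact: measurable_window.
have lQ : (l.+1 <= Num.truncn (Q%:R : R))%N by rewrite natrK leqW// leq_max leqnn orbT.
have := hM n l nn lQ; apply: ae_sub => x h Wx.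
apply: (@le_trans _ _ M%:E); last by rewrite lee_fin ler_norm.
apply: le_trans (h Wx); apply: ge0_le_integral => //.
- by move=> Y _; rewrite lee_fin exprn_ge0// (le_trans ler01)// zscore_ge1.
- by apply: (measurableT_comp mZ (g := fun Y => (thead x, Y))); exact: measurable_fun_pair.
- apply/measurable_EFinP.
  rewrite (_ : (fun Y => _) = (fun Y => zscore n (thead x) Y ^+ Q)).
    apply: measurable_funX.
    by apply: (measurableT_comp (measurable_zscore n) (g := fun Y => (thead x, Y))); exact: measurable_fun_pair.
  by apply/funext => Y; rewrite powR_mulrn// (le_trans ler01)// zscore_ge1.
move=> Y _; rewrite lee_fin powR_mulrn; last by rewrite (le_trans ler01)// zscore_ge1.
by apply: ler_weXn2l; [exact: zscore_ge1|rewrite leqW// leq_max leqnn].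
Qed.

Lemma measurable_zscore_at n p (x : p.-tuple (pt R d)) i N :
  measurable_fun setT (fun Y => (zscore n (tnth x i) Y ^+ N)%:E : \bar R).
Proof.
apply/measurable_EFinP; apply: measurable_funX.
by apply: (measurableT_comp (measurable_zscore n) (g := fun Y => (tnth x i, Y))); exact: measurable_fun_pair.
Qed.

Lemma measurable_zscore_sum n p (x : p.-tuple (pt R d)) N :
  measurable_fun setT (fun Y => (\sum_i zscore n (tnth x i) Y ^+ N)%:E : \bar R).
Proof.
apply/measurable_EFinP; apply: measurable_sum => i.
by apply/measurable_EFinP; exact: measurable_zscore_at.
Qed.

Lemma moment_sum p N : (1 <= p)%N -> exists2 A : R, 0 <= A & forall n, window_index n ->
  {ae lebk R d p, forall x, (forall j, window n (tnth x j)) ->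
    ((\int[palm p x]_Y (\sum_i zscore n (tnth x i) Y ^+ N)%:E) * (rho x)%:E <= A%:E)%E}.
Proof.
case: p => // l _; have [M M0 hM] := moment_coord l N.
exists (l.+1%:R * (M * kappa l.+1)); first by rewrite !mulr_ge0.
move=> n nn.
(* Coordinates are numbered by natural numbers through [inord], so that countably many
   almost-everywhere statements can be joined. *)
have a1 : {ae lebk R d l.+1, forall x, forall k : nat, (k < l.+1)%N ->
   (forall j, window n (tnth x j)) ->
   ((\int[palm l.+1 x]_Y (zscore n (tnth x (inord k)) Y ^+ N)%:E) * (rho x)%:E <= (M * rho x)%:E)%E}.
  apply: ae_foralln => k; have := hM n nn (inord k).
  by apply: (@filterS _ (almost_everywhere _)) => x h _ /h.
have := ae_and a1 (rho_le (isT : (1 <= l.+1)%N)).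
have [_ rho0 _ _] := corr (isT : (1 <= l.+1)%N).
apply: (@filterS _ (almost_everywhere _)) => x [h rk] Wx.
under eq_integral do rewrite -sumEFin.
rewrite ge0_integral_sum//; last 2 first.
- by move=> i; exact: measurable_zscore_at.
- by move=> i Y _; rewrite lee_fin exprn_ge0// (le_trans ler01)// zscore_ge1.
rewrite ge0_sume_distrl; last first.
  by move=> i _; apply: integral_ge0 => Y _; rewrite lee_fin exprn_ge0// (le_trans ler01)// zscore_ge1.
apply: (@le_trans _ _ (\sum_(i < l.+1) (M * kappa l.+1)%:E)%E).
  apply: lee_sum => i _; rewrite -(inord_val i); apply: le_trans (h i _ Wx) _ => //.
  by rewrite lee_fin ler_wpM2l.
by rewrite sumEFin lee_fin sumr_const card_ord mulr_natl.
Qed.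

Lemma pprod_windowed_le n p (ks : p.-tuple nat) (x : p.-tuple (pt R d)) Y z :
  (forall i, zscore n (tnth x i) Y <= z) -> 1 <= z ->
  `|pprod (windowed n) ks x Y| <= z ^+ (\sum_(i < p) tnth ks i).
Proof.
move=> h z1; apply: pprod_norm_le => // i.
by apply: le_trans (h i); rewrite le_max lexx.
Qed.

Lemma pprod_outside_window n p (ks : p.-tuple nat) (x : p.-tuple (pt R d)) Y th :
  (forall y Y, ~ window n y -> th y Y = 0) ->
  (forall i, (1 <= tnth ks i)%N) -> ~ (forall j, window n (tnth x j)) ->
  pprod th ks x Y = 0.
Proof.
move=> th0 k1 /existsNP[i Wi]; rewrite /pprod (bigD1 i)//= th0// expr0n.
by rewrite gtn_eqF ?mul0r// k1.
Qed.

(** The product is at most the [K]-th power of the largest [zscore], hence at most a sum of [K]-th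
    powers. Outside the window a factor vanishes. The constant depends on [p] and [K] only. *)
Lemma windowed_bounded p K : (1 <= p)%N -> exists2 A : R, 0 <= A &
  forall n (ks : p.-tuple nat), window_index n -> (forall i, (1 <= tnth ks i)%N) ->
  (\sum_(i < p) tnth ks i)%N = K ->
  {ae lebk R d p, forall x : p.-tuple (pt R d), exists2 a : R,
    palm_mean rho palm (pprod (windowed n) ks) x = a%:E & `|a| <= A}.
Proof.
move=> p1; have [A A0 hA] := moment_sum K p1.
exists A => // n ks nn k1 kK; have [_ rho0 _ _] := corr p1.
have := hA n nn; apply: (@filterS _ (almost_everywhere _)) => x h.
have [Wx|nWx] := pselect (forall j, window n (tnth x j)); last first.
  exists 0; last by rewrite normr0.
  rewrite /palm_mean (eq_integral (fun=> 0%E)) ?integral0 ?mul0e// => Y _.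
  rewrite (pprod_outside_window (n := n))// => y Z Wy.
  by apply: windowed_outside => -[].
have {}h := h Wx.
apply: (scaled_integral_le _ (@measurable_zscore_sum n p x K) _ _ h) => //.
  apply: (measurableT_comp (measurable_pprod ks (measurable_windowed n)) (g := fun Y => (x, Y))).
  exact: measurable_fun_pair.
move=> Y; rewrite lee_fin.
have [z zi [i zE le]] := max_le_sum K p1 (fun i => zscore_ge1 n (tnth x i) Y).
apply: le_trans le; rewrite -kK; apply: pprod_windowed_le => //.
by rewrite zE zscore_ge1.
Qed.

End moments.

(** * U-statistics: class (A1) *)

Section low_degree.
Context {R : realType} {l : nat}.
Implicit Types (S T : {set 'I_l}) (f g : {set 'I_l} -> R).

(* The polynomials of degree at most [D] in the indicators [1(j \in S)]. *)
Definition low_degree D f : Prop :=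
  exists2 a : {set 'I_l} -> R, (forall T, (D < #|T|)%N -> a T = 0) &
    forall S, f S = \sum_T a T * (T \subset S)%:R.

Lemma low_degree_subset D T c : (#|T| <= D)%N -> low_degree D (fun S => c * (T \subset S)%:R).
Proof.
move=> TD; exists (fun T' => if T' == T then c else 0).
  by move=> T' h; case: eqP => // e; rewrite e ltnNge TD in h.
by move=> S; rewrite (bigD1 T)//= eqxx big1 ?addr0// => T' /negPf ->; rewrite mul0r.
Qed.

Lemma low_degree_eq D f g : f =1 g -> low_degree D f -> low_degree D g.
Proof. by move=> fg [a a0 aE]; exists a => // S; rewrite -fg. Qed.

Lemma low_degree_sum (I : finType) (Q : pred I) D (F : I -> {set 'I_l} -> R) :
  (forall i, Q i -> low_degree D (F i)) -> low_degree D (fun S => \sum_(i | Q i) F i S).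
Proof.
move=> h; have /choice[a aP] : forall i, exists a : {set 'I_l} -> R, Q i ->
    (forall T, (D < #|T|)%N -> a T = 0) /\ forall S, F i S = \sum_T a T * (T \subset S)%:R.
  move=> i; case: (boolP (Q i)) => Qi; last by exists (fun=> 0).
  by have [a h1 h2] := h i Qi; exists a.
exists (fun T => \sum_(i | Q i) a i T).
  by move=> T DT; rewrite big1// => i Qi; have [-> //] := aP i Qi.
move=> S; under [RHS]eq_bigr do rewrite mulr_suml.
rewrite exchange_big /=; apply: eq_bigr => i Qi.
by have [_ ->] := aP i Qi.
Qed.

(** The product of the indicators of [T \subset S] and [T' \subset S] is that of the union, whose
    size is at most the sum of the sizes. *)
Lemma low_degreeM D1 D2 f g : low_degree D1 f -> low_degree D2 g ->
  low_degree (D1 + D2) (fun S => f S * g S).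
Proof.
move=> [a a0 aE] [b b0 bE].
exists (fun U => \sum_T \sum_(T' | U == T :|: T') a T * b T').
  move=> U DU; rewrite big1// => T _; rewrite big1// => T' /eqP UE.
  have [DT|DT] := ltnP D1 #|T|; first by rewrite a0// mul0r.
  have [DT'|DT'] := ltnP D2 #|T'|; first by rewrite b0// mulr0.
  have := leq_card_setU T T' ; rewrite -UE => /(leq_trans DU).
  by rewrite ltnNge leq_add.
move=> S; rewrite aE bE mulr_suml.
under [RHS]eq_bigr do rewrite mulr_suml.
rewrite exchange_big /=; apply: eq_bigr => T _.
rewrite mulr_sumr; under [RHS]eq_bigr do rewrite mulr_suml.
rewrite (exchange_big_dep predT)//=; apply: eq_bigr => T' _.
rewrite (big_pred1 (T :|: T')); last by move=> U; rewrite eq_sym.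
by rewrite finset.subUset -mulnb natrM mulrACA.
Qed.

Lemma low_degreeX D f k : low_degree D f -> low_degree (k * D) (fun S => f S ^+ k).
Proof.
move=> fD; elim: k => [|k IH].
  apply: (low_degree_eq _ (@low_degree_subset 0 finset.set0 1 _)) => [S|].
    by rewrite finset.sub0set mulr1 expr0.
  by rewrite cards0.
rewrite mulSn; apply: low_degree_eq (low_degreeM fD IH) => S.
by rewrite exprS.
Qed.

Lemma low_degree_prod p (D : 'I_p -> nat) (F : 'I_p -> {set 'I_l} -> R) :
  (forall i, low_degree (D i) (F i)) ->
  low_degree (\sum_i D i) (fun S => \prod_i F i S).
Proof.
elim: p D F => [|p IH] D F h.
  apply: (low_degree_eq _ (@low_degree_subset _ finset.set0 1 _)) => [S|].
    by rewrite finset.sub0set mulr1 big_ord0.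
  by rewrite cards0.
rewrite big_ord_recl.
apply: low_degree_eq (low_degreeM (h ord0) (IH _ _ (fun i => h (lift ord0 i)))) => S.
by rewrite big_ord_recl.
Qed.

(** By [sum_supersets] the alternating sum extracts the coefficient of the full set, and a
    polynomial of degree less than [l] has none. *)
Lemma low_degree_vanish D f : (D < l)%N -> low_degree D f ->
  \sum_(S : {set 'I_l}) (-1) ^+ (l + #|S|) * f S = 0.
Proof.
move=> Dl [a a0 aE].
under eq_bigr do rewrite aE mulr_sumr.
rewrite exchange_big big1//= => T _.
have [/a0 ->|TD] := ltnP D #|T|.
  by rewrite big1// => S _; rewrite mul0r mulr0.
rewrite (eq_bigr (fun S => (-1) ^+ (l + #|T|) * a T * ((-1) ^+ (#|S| + #|T|) * (T \subset S)%:R))); last first.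
  move=> S _; suff -> : (-1) ^+ (l + #|S|) = (-1) ^+ (l + #|T|) * (-1) ^+ (#|S| + #|T|) :> R by ring.
  rewrite -exprD -signr_odd -[RHS]signr_odd !oddD.
  by case: (odd l); case: (odd #|S|); case: (odd #|T|).
rewrite -mulr_sumr (eq_bigr (fun S => if T \subset S then (-1) ^+ (#|S| + #|T|) else 0)); last first.
  by move=> S _; case: ifP => _; rewrite ?mulr1 ?mulr0.
rewrite -big_mkcond sum_supersets; case: eqP => [TE|_]; last by rewrite mulr0.
by move: TD; rewrite TE cardsT card_ord leqNgt Dl.
Qed.

End low_degree.

Section u_statistic.
Context {R : realType} {d k' : nat}.
Variables (xi : pt R d -> lfset R d -> R) (h : k'.+1.-tuple (pt R d) -> R) (r H : R).
Hypothesis r0 : 0 < r.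
Hypothesis hH : forall x, `|h x| <= H.
Hypothesis hr : forall x, (exists i, r < dist (tnth x i) (thead x)) -> h x = 0.
Hypothesis xiE : forall x (X : lfset R d), lf_set X x ->
  xi x X = (k'.+1)`!%:R^-1 * \sum_(y \in ktuples k' X) h [tuple of x :: y].
Hypothesis xiS : score_function xi.

(** A tuple with a point outside the ball contributes zero, since [h] has range [r]; deleting such
    points leaves the sum unchanged. *)
Lemma windowed_cball n y Y : windowed xi n y Y = windowed xi n y (lfI Y (cball y r)).
Proof.
have [_ _ xi0 _] := xiS.
have [[Yy Wy]|nYW] := pselect (lf_set Y y /\ window n y); last first.
  by rewrite !(windowed_outside xiS)// => -[[Yy _] Wy]; apply: nYW.
have yy : cball y r y by rewrite /cball /= distxx ltW.
rewrite /windowed !xiE//; congr (_ * _); symmetry.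
apply: fsbig_widen => [u [uu uY]|u [[uu uY] nu]].
  by split => // i; have [[]] := uY i.
apply: hr; apply: contrapT => nh; apply: nu; split => // i.
have [Yu Wu] := uY i; split => //; split => //.
rewrite /cball /= distC leNgt; apply/negP => ri; apply: nh.
exists (lift ord0 i).
by rewrite (tnth_nth y) /= -tnth_nth theadE.
Qed.

Section at_tuple.
Variables (p l : nat) (w : (p + l).-tuple (pt R d)) (n : option nat).
Hypothesis uw : uniq w.

Let sel (g : {ffun 'I_k' -> 'I_(p + l)}) : k'.-tuple (pt R d) := [tuple tnth w (g j) | j < k'].

(** The window conditions do not involve [S]. Stored in the coefficient, they leave as only
    dependence on [S] the condition that the chosen indices are present. *)
Let coef (i : 'I_p) (g : {ffun 'I_k' -> 'I_(p + l)}) : R :=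
  if [forall j, tnth w (g j) \in (window n : set (pt R d))] &&
     (tnth (tfst w) i \in (window n : set (pt R d)))
  then (k'.+1)`!%:R^-1 * h [tuple of tnth (tfst w) i :: sel g] else 0.

Let windowedE i (S : {set 'I_l}) :
  windowed xi n (tnth (tfst w) i) (lf_of w (with_extra p S)) =
  \sum_(g : {ffun 'I_k' -> 'I_(p + l)} | injectiveb g && [forall j, g j \in with_extra p S]) coef i g.
Proof.
set x := tnth (tfst w) i; set Y := lf_of _ _.
have Yx : lf_set Y x.
  by exists (lshift l i); [exact: mem_with_extra_l|rewrite /x tnth_mktuple].
have [Wx|nWx] := pselect (window n x); last first.
  rewrite windowed_outside//; last by case.
  rewrite big1// => g _; rewrite /coef -/x [_ \in _]memNset ?andbF//.
rewrite /windowed xiE//.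
pose Q (g : {ffun 'I_k' -> 'I_(p + l)}) := injectiveb g && [forall j, g j \in with_extra p S].
pose W (g : {ffun 'I_k' -> 'I_(p + l)}) := [forall j, tnth w (g j) \in (window n : set (pt R d))].
pose s : seq (k'.-tuple (pt R d)) := [seq sel g | g <- index_enum {ffun 'I_k' -> 'I_(p + l)} & Q g && W g].
have seli : injective sel.
  move=> g g' e; apply/ffunP => j; have := congr1 (fun t => tnth t j) e.
  by rewrite !tnth_mktuple; move/tuple_uniqP : uw; exact.
rewrite (fsbigE s); last 3 first.
- by rewrite map_inj_uniq// filter_uniq// index_enum_uniq.
- move=> u /= /mapP[g]; rewrite mem_filter => /andP[/andP[/andP[/injectiveP gi /forallP gS] /forallP gW] _] ->.
  split.
    apply/tuple_uniqP => a b; rewrite !tnth_mktuple => e; apply: gi.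
    by move/tuple_uniqP : uw; apply.
  move=> j; rewrite tnth_mktuple; split; last exact/set_mem.
  by exists (g j).
- move=> u [uu uY]; case/negP.
  have /choice[g gP] : forall j, exists a, a \in with_extra p S /\ tnth u j = tnth w a.
    by move=> j; have [[a aS e] _] := uY j; exists a.
  apply/mapP; exists [ffun j => g j].
    rewrite mem_filter mem_index_enum andbT; apply/andP; split; first (apply/andP; split).
    + apply/injectiveP => a b; rewrite !ffunE => gab.
      have [_ ea] := gP a; have [_ eb] := gP b.
      by move/tuple_uniqP : uu; apply; rewrite ea eb gab.
    + by apply/forallP => j; rewrite ffunE; have [] := gP j.
    + apply/forallP => j; rewrite ffunE; have [_ <-] := gP j.
      by apply: mem_set; have [] := uY j.
  by apply: eq_from_tnth => j; rewrite tnth_mktuple ffunE; have [_ ->] := gP j.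
rewrite big_map big_filter_cond mulr_sumr big_mkcond [RHS]big_mkcond /=.
apply: eq_bigr => g _; rewrite -/(Q g) /coef -/(W g) -/x [x \in _]mem_set// andbT.
case: (boolP (Q g)) => // /andP[/injectiveP gi /forallP gS].
case: (boolP (W g)) => //= /forallP gW; rewrite ifT//.
apply: mem_set; split.
  apply/tuple_uniqP => a b; rewrite !tnth_mktuple => e; apply: gi.
  by move/tuple_uniqP : uw; apply.
move=> j; rewrite tnth_mktuple; split; last exact/set_mem.
by exists (g j).
Qed.

Let H0 : 0 <= H.
Proof. exact: le_trans (normr_ge0 _) (hH [tuple of nseq k'.+1 [tuple 0 | i < d]]). Qed.

Let coef_le i g : `|coef i g| <= H.
Proof.
rewrite /coef; case: ifP => _; last by rewrite normr0.
rewrite normrM -[leRHS]mul1r ler_pM// ger0_norm ?invr_ge0//.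
by rewrite invf_le1 ?ltr0n ?fact_gt0// ler1n fact_gt0.
Qed.

(** There are [(p + l) ^ k'] maps [g], each with a coefficient at most [H]; the added 1 provides the
    lower bound 1 that [pprod_norm_le] asks for. *)
Let windowed_le i S :
  `|windowed xi n (tnth (tfst w) i) (lf_of w (with_extra p S))| <= 1 + H * ((p + l) ^ k')%:R.
Proof.
rewrite windowedE; apply: le_trans (ler_norm_sum _ _ _) _.
apply: (@le_trans _ _ (\sum_(g : {ffun 'I_k' -> 'I_(p + l)}) H)).
  rewrite big_mkcond; apply: ler_sum => g _; case: ifP => // _; exact: coef_le.
by rewrite sumr_const card_ffun !card_ord mulr_natr lerDr.
Qed.

(** A map [g] contributes its coefficient times the indicator that the additional indices in its
    range, at most [k'] of them, belong to [S]. *)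
Let windowed_low_degree i :
  low_degree k' (fun S => windowed xi n (tnth (tfst w) i) (lf_of w (with_extra p S))).
Proof.
pose T (g : {ffun 'I_k' -> 'I_(p + l)}) : {set 'I_l} := [set j | rshift p j \in codom g]%SET.
have Tk g : (#|T g| <= k')%N.
  rewrite -[leqRHS](card_ord k'); apply: leq_trans (leq_image_card g _).
  rewrite -(card_imset _ (@rshift_inj p l)); apply/subset_leq_card/fintype.subsetP => a.
  by move=> /imsetP[j]; rewrite inE => jg ->.
apply: (low_degree_eq (f := fun S => \sum_(g : {ffun 'I_k' -> 'I_(p + l)} | injectiveb g)
    coef i g * (T g \subset S)%:R)); last first.
  by apply: low_degree_sum => g _; exact: low_degree_subset.
move=> S; rewrite windowedE [RHS]big_mkcondr /=; apply: eq_bigr => g _.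
rewrite (_ : (T g \subset S) = [forall j, g j \in with_extra p S]); first by case: ifP; rewrite ?mulr1 ?mulr0.
apply/fintype.subsetP/forallP => [TS j|gS j].
  case: (split_ordP (g j)) => a ga; rewrite ga ?mem_with_extra_l// mem_with_extra_r.
  by apply: TS; rewrite inE -ga codom_f.
by rewrite inE => /codomP[a ja]; have := gS a; rewrite -ja mem_with_extra_r.
Qed.

Lemma pprod_low_degree (ks : p.-tuple nat) :
  low_degree ((\sum_(i < p) tnth ks i) * k') (fun S =>
    pprod (windowed xi n) ks (tfst w) (lf_of w (with_extra p S))).
Proof.
rewrite big_distrl /=; apply: low_degree_prod => i.
exact: low_degreeX (windowed_low_degree i).
Qed.

Lemma pprod_low_degree_le (ks : p.-tuple nat) S :
  `|pprod (windowed xi n) ks (tfst w) (lf_of w (with_extra p S))| <=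
    (1 + H * ((p + l) ^ k')%:R) ^+ (\sum_(i < p) tnth ks i).
Proof.
apply: pprod_norm_le => [|i]; last exact: windowed_le.
by rewrite lerDl mulr_ge0.
Qed.

End at_tuple.

(** Zero beyond the degree [K * k'] of the product, so that all series over additional points are
    finite sums. *)
Definition u_statistic_bound p K l : R :=
  if (l <= K * k')%N then 2 ^+ l * (1 + H * ((p + l) ^ k')%:R) ^+ K else 0.

Lemma sum_signed_le l (B : R) (f : {set 'I_l} -> R) : (forall S : {set 'I_l}, `|f S| <= B) ->
  `|\sum_(S : {set 'I_l}) (-1) ^+ (l + #|S|) * f S| <= 2 ^+ l * B.
Proof.
move=> fB; apply: le_trans (ler_norm_sum _ _ _) _.
apply: (@le_trans _ _ (\sum_(S : {set 'I_l}) B)).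
  by apply: ler_sum => S _; rewrite normrM normrX normrN1 expr1n mul1r.
rewrite sumr_const -[X in _ *+ X]cardsT -powersetT card_powerset cardsT card_ord.
by rewrite -[B *+ _]mulr_natl natrX.
Qed.

Lemma u_statistic_local n p (ks : p.-tuple nat) : (forall i, (1 <= tnth ks i)%N) ->
  local_functional r (u_statistic_bound p (\sum_(i < p) tnth ks i)) (pprod (windowed xi n) ks).
Proof.
move=> k1; split.
- exact: measurable_pprod (measurable_windowed xiS n).
- move=> x Y; apply: pprod_outside => // y Z nZ.
  by rewrite windowed_outside// => -[].
- move=> x Y _; exact: pprod_local (windowed_cball n).
move=> l w; set K := (\sum_(i < p) _)%N.
have [[uw nw]|na] := pselect (admissible_tuples r w).
  rewrite /mob indicE mem_set// mul1r /u_statistic_bound; case: ifPn => lK.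
    by apply: sum_signed_le => S; exact: pprod_low_degree_le.
  rewrite (low_degree_vanish _ (pprod_low_degree n uw ks)) ?normr0//.
  by rewrite ltnNge.
rewrite /mob indicE memNset// mul0r normr0 /u_statistic_bound; case: ifP => // _.
by rewrite mulr_ge0 ?exprn_ge0// addr_ge0// mulr_ge0// (le_trans (normr_ge0 _) (hH [tuple of nseq k'.+1 [tuple 0 | i < d]])).
Qed.

End u_statistic.

(** * Polynomial rates for finite expansions *)

Lemma finite_series {R : realType} (u : nat -> R) D : (forall l, 0 <= u l) ->
  (forall l, (D < l)%N -> u l = 0) -> (\sum_(l <oo) (u l)%:E = (\sum_(l < D.+1) u l)%:E)%E.
Proof.
move=> u0 uD; rewrite (nneseries_split _ D.+1) => [|k _]; last by rewrite lee_fin.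
rewrite [X in (_ + X)%E]eseries0 ?adde0; last first.
  by move=> k Dk _; rewrite uD.
by rewrite big_mkord sumEFin.
Qed.

Lemma fast_decreasing_poly {R : realType} (phi : R -> R) m : fast_decreasing phi ->
  exists2 B : R, 0 <= B & forall u, 0 <= u -> phi u * (1 + u) ^+ m <= B.
Proof.
move=> [phi01 _ phim].
(* The exponent [m.+1] is positive even for [m = 0], where the definition of fast decrease gives no
   limit. *)
have := phim m.+1 isT; move/cvgrPdist_le => /(_ 1 ltr01) /= [u0 [_ hu]].
pose v := Num.max u0 1.
have v1 : 1 <= v by rewrite le_max lexx orbT.
exists ((1 + v) ^+ m + 2 ^+ m); first by rewrite addr_ge0 ?exprn_ge0// addr_ge0// (le_trans ler01).
move=> u ge0u; have /andP[p0 p1] := phi01 u ge0u.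
have [uv|vu] := leP u v.
  apply: (@le_trans _ _ ((1 + v) ^+ m)); last by rewrite lerDl exprn_ge0.
  apply: (@le_trans _ _ ((1 + u) ^+ m)); first by rewrite ler_piMl// exprn_ge0// addr_ge0.
  by rewrite lerXn2r ?nnegrE ?addr_ge0// ?(le_trans ler01)// lerD2l.
apply: (@le_trans _ _ (2 ^+ m)); last by rewrite lerDr exprn_ge0// addr_ge0// (le_trans ler01).
have u1 : 1 <= u by rewrite (le_trans v1)// ltW.
have := hu u; rewrite sub0r normrN => /(_ (le_lt_trans _ vu)).
rewrite le_max lexx => /(_ isT); rewrite ger0_norm ?mulr_ge0 ?exprn_ge0// => hm.
apply: (@le_trans _ _ (phi u * (2 * u) ^+ m)).
  rewrite ler_wpM2l// lerXn2r ?nnegrE ?addr_ge0 ?mulr_ge0//.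
  by rewrite mulr_natl mulr2n lerD2r.
rewrite exprMn mulrCA ler_piMr ?exprn_ge0//; apply: le_trans hm.
by rewrite mulrC ler_wpM2r// exprS ler_peMl// exprn_ge0.
Qed.

Lemma fast_decreasing_shift {R : realType} (phi : R -> R) m (c t : R) :
  fast_decreasing phi -> 0 < c -> 0 <= t ->
  exists2 B : R, 0 <= B & forall s, 2 * t < s -> phi (c * (s - 2 * t)) <= B / (1 + s) ^+ m.
Proof.
move=> fd; have [phi01 _ _] := fd; have [B B0 hB] := fast_decreasing_poly m fd; move=> c0 t0.
(* Chosen so that [1 + s <= D * (1 + u)] for the shifted argument [u], since
   [s = 2 * t + c^-1 * u]. *)
pose D := Num.max (1 + 2 * t) c^-1.
have D1 : 1 + 2 * t <= D by rewrite le_max lexx.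
have Dc : c^-1 <= D by rewrite le_max lexx orbT.
have D0 : 0 <= D by apply: le_trans D1; rewrite addr_ge0 ?mulr_ge0.
exists (B * D ^+ m); first by rewrite mulr_ge0 ?exprn_ge0.
move=> s st; set u := c * (s - 2 * t).
have u0 : 0 <= u by rewrite mulr_ge0 ?subr_ge0 ?ltW.
have s0 : 0 <= s by rewrite (le_trans _ (ltW st))// mulr_ge0.
have sE : 1 + s <= D * (1 + u).
  have -> : s = 2 * t + c^-1 * u by rewrite /u mulrA mulVf ?gt_eqF// mul1r; ring.
  rewrite mulrDr mulr1 addrA lerD// ler_wpM2r//.
rewrite ler_pdivlMr ?exprn_gt0 ?ltr_wpDr//.
apply: (@le_trans _ _ (phi u * (D * (1 + u)) ^+ m)).
  have /andP[p0 _] := phi01 u u0.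
  by rewrite ler_wpM2l// lerXn2r ?nnegrE ?addr_ge0 ?mulr_ge0// addr_ge0.
rewrite exprMn mulrCA [leRHS]mulrC ler_wpM2l ?exprn_ge0//.
exact: hB.
Qed.

(** Only finitely many orders contribute, hence only finitely many constants [c k] and [C k], of
    which no growth is assumed; each term decays at any polynomial rate. *)
Lemma mixing_error_poly {R : realType} d p q (t : R) (M1 M2 : nat -> R) phi (c C : nat -> R) D1 D2 m :
  (1 <= p)%N -> 0 <= t -> fast_decreasing phi -> (forall k, (1 <= k)%N -> 0 < c k) ->
  (forall l, 0 <= M1 l) -> (forall l, 0 <= M2 l) ->
  (forall l, (D1 < l)%N -> M1 l = 0) -> (forall l, (D2 < l)%N -> M2 l = 0) ->
  exists2 A : R, 0 <= A & forall s, 2 * t < s ->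
    (mixing_error d p q t M1 M2 phi c C s <= (A / (1 + s) ^+ m)%:E)%E.
Proof.
move=> p1 t0 fd c0 M10 M20 M1D M2D; have [phi01 _ _] := fd.
have /choice[B hB] : forall k, exists B : R, 0 <= B /\ ((1 <= k)%N ->
    forall s, 2 * t < s -> phi (c k * (s - 2 * t)) <= B / (1 + s) ^+ m).
  case=> [|k]; first by exists 0.
  by have [B B0 h] := fast_decreasing_shift m fd (c0 k.+1 isT) t0; exists B.
have B0 k : 0 <= B k by have [] := hB k.
pose V1 := near_volume d p t; pose V2 := near_volume d q t.
have V10 : 0 <= V1 by exact: near_volume_ge0.
have V20 : 0 <= V2 by exact: near_volume_ge0.
pose a l1 l2 : R := l1`!%:R^-1 * l2`!%:R^-1 * (M1 l1 * M2 l2 * (V1 ^+ l1 * V2 ^+ l2) *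
   (`|C (p + l1 + (q + l2))%N| * B (p + l1 + (q + l2))%N)).
have a0 l1 l2 : 0 <= a l1 l2.
  by rewrite !mulr_ge0// ?invr_ge0// ?exprn_ge0.
exists (\sum_(l1 < D1.+1) \sum_(l2 < D2.+1) a l1 l2).
  by apply: sumr_ge0 => l1 _; exact: sumr_ge0.
move=> s st; have s0 : 0 <= s by rewrite (le_trans _ (ltW st))// mulr_ge0.
have S0 : 0 <= ((1 + s) ^+ m)^-1 by rewrite invr_ge0 exprn_ge0// addr_ge0.
have phi0 k : (1 <= k)%N -> 0 <= phi (c k * (s - 2 * t)).
  move=> k1; have /andP[] // : 0 <= phi (c k * (s - 2 * t)) <= 1.
  by apply: phi01; rewrite mulr_ge0 ?subr_ge0 ?ltW// c0.
have J1 l1 l2 : (1 <= p + l1 + (q + l2))%N by rewrite !addn_gt0 p1.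
rewrite /mixing_error.
apply: (@le_trans _ _ (\sum_(l1 <oo) \sum_(l2 <oo) (a l1 l2 / (1 + s) ^+ m)%:E)%E).
  apply: lee_nneseries => [l1 _ _|l1 _].
    apply: nneseries_ge0 => l2 _ _; rewrite lee_fin.
    by rewrite !mulr_ge0// ?invr_ge0// ?exprn_ge0// phi0.
  apply: lee_nneseries => [l2 _ _|l2 _].
    by rewrite lee_fin !mulr_ge0// ?invr_ge0// ?exprn_ge0// phi0.
  rewrite lee_fin /a -!mulrA; do 2 (rewrite ler_wpM2l ?invr_ge0//).
  do 5 (rewrite ler_wpM2l// ?exprn_ge0//).
  by have [_] := hB (p + l1 + (q + l2))%N; apply.
rewrite (eq_eseriesr (g := fun l1 => (\sum_(l2 < D2.+1) (a l1 l2 / (1 + s) ^+ m))%:E)); last first.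
  move=> l1 _; rewrite (finite_series (D := D2))// => l2; first exact: mulr_ge0.
  by move=> h; rewrite /a (M2D _ h) mulr0 !(mul0r, mulr0).
rewrite (finite_series (D := D1)); last 2 first.
- by move=> l1; apply: sumr_ge0 => l2 _; exact: mulr_ge0.
- by move=> l1 h; rewrite big1// => l2 _; rewrite /a (M1D _ h) !(mul0r, mulr0).
rewrite lee_fin mulr_suml; apply: ler_sum => l1 _.
by rewrite mulr_suml.
Qed.

Section class_A1_mixing.
Context {dd : measure_display} {Omega : measurableType dd} {R : realType}.
Variables (P : probability Omega R) (d : nat) (X : {RV P >-> lfset R d})
  (rho : forall k, k.-tuple (pt R d) -> R)
  (palm : forall k, R.-pker (k.-tuple (pt R d)) ~> lfset R d)
  (xi : pt R d -> lfset R d -> R).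

(** The common goal of both classes. The constant may depend on [m] and on the sums of exponents
    over each cluster, but neither on [n] nor on the single exponents. *)
Definition poly_mixing : Prop := forall p q K1 K2 m, (1 <= p)%N -> (1 <= q)%N ->
  exists2 A : R, 0 <= A & forall n (ks : (p + q).-tuple nat), window_index n ->
    (forall i, (1 <= tnth ks i)%N) ->
    (\sum_(i < p) tnth (tfst ks) i)%N = K1 -> (\sum_(i < q) tnth (tsnd ks) i)%N = K2 ->
    {ae lebk R d (p + q), forall z : (p + q).-tuple (pt R d), uniq z ->
      exists a b1 b2 : R,
      [/\ palm_mean rho palm (pprod (windowed xi n) ks) z = a%:E,
          palm_mean rho palm (pprod (windowed xi n) (tfst ks)) (tfst z) = b1%:E,
          palm_mean rho palm (pprod (windowed xi n) (tsnd ks)) (tsnd z) = b2%:E &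
          `|a - b1 * b2| <= A / (1 + sep z) ^+ m]}.

Hypothesis corr : forall k, (1 <= k)%N -> correlation_function X (@rho k).
Hypothesis palmP : forall k, (1 <= k)%N -> palm_version X (palm k).
Variable kappa : nat -> R.
Hypothesis kappa0 : forall k, 0 <= kappa k.
Hypothesis rho_le : forall k, (1 <= k)%N -> {ae lebk R d k, forall x, rho x <= kappa k}.
Hypothesis xiS : score_function xi.
Hypothesis moments : forall p : R, 1 < p -> moment_condition X palm xi p.

(** The trivial bound, for clusters that are too close for the mixing estimate. *)
Lemma windowed_bounded_triple p q K1 K2 : (1 <= p)%N -> (1 <= q)%N ->
  exists2 A : R, 0 <= A & forall n (ks : (p + q).-tuple nat), window_index n ->
    (forall i, (1 <= tnth ks i)%N) ->
    (\sum_(i < p) tnth (tfst ks) i)%N = K1 -> (\sum_(i < q) tnth (tsnd ks) i)%N = K2 ->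
    {ae lebk R d (p + q), forall z : (p + q).-tuple (pt R d),
      exists a b1 b2 : R,
      [/\ palm_mean rho palm (pprod (windowed xi n) ks) z = a%:E,
          palm_mean rho palm (pprod (windowed xi n) (tfst ks)) (tfst z) = b1%:E,
          palm_mean rho palm (pprod (windowed xi n) (tsnd ks)) (tsnd z) = b2%:E &
          [/\ `|a| <= A, `|b1| <= A & `|b2| <= A]]}.
Proof.
move=> p1 q1; have pq1 : (1 <= p + q)%N by rewrite addn_gt0 p1.
have [A A0 hA] := windowed_bounded corr palmP kappa0 rho_le xiS moments (K1 + K2) pq1.
have [A1 A10 hA1] := windowed_bounded corr palmP kappa0 rho_le xiS moments K1 p1.
have [A2 A20 hA2] := windowed_bounded corr palmP kappa0 rho_le xiS moments K2 q1.
exists (A + A1 + A2); first by rewrite !addr_ge0.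
move=> n ks nn k1 e1 e2.
have k11 i : (1 <= tnth (tfst ks) i)%N by rewrite tnth_mktuple.
have k12 i : (1 <= tnth (tsnd ks) i)%N by rewrite tnth_mktuple.
have e : (\sum_(i < p + q) tnth ks i)%N = (K1 + K2)%N.
  rewrite big_split_ord /= -e1 -e2; congr (_ + _)%N; apply: eq_bigr => i _;
  by rewrite tnth_mktuple.
have := ae_and (hA n ks nn k1 e)
  (ae_and (ae_tfst q (hA1 n (tfst ks) nn k11 e1)) (ae_tsnd p (hA2 n (tsnd ks) nn k12 e2))).
apply: (@filterS _ (almost_everywhere _)) => z [[a ea ha] [[b1 eb1 hb1] [b2 eb2 hb2]]].
by exists a, b1, b2; split => //; split; lra.
Qed.

(** The score is already local, with the fixed radius [t = r]. Beyond separation [2 * r] the mixing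
    estimate applies; up to it, the trivial bound is multiplied by [S], the largest value of
    [(1 + sep z) ^+ m]. *)
Lemma class_A1_poly_mixing : class_A1 rho xi -> poly_mixing.
Proof.
move=> [[phi [c [C decay]]] [k' [h [r [r0 [_ _ [H hH]] hr _ xiE]]]]].
move=> p q K1 K2 m p1 q1.
have [W W0 hW] := windowed_bounded_triple K1 K2 p1 q1.
have [fd c0 _] := decay.
have H0 : 0 <= H.
  exact: le_trans (normr_ge0 _) (hH [tuple of nseq k'.+1 [tuple 0 | i < d]]).
have Mge0 p' K l : 0 <= @u_statistic_bound R k' H p' K l.
  rewrite /u_statistic_bound; case: ifP => // _.
  by rewrite mulr_ge0 ?exprn_ge0// addr_ge0// mulr_ge0.
have MD p' K l : (K * k' < l)%N -> @u_statistic_bound R k' H p' K l = 0.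
  by rewrite /u_statistic_bound ltnNge => /negPf ->.
have [E E0 hE] := mixing_error_poly d q C m p1 (ltW r0) fd c0 (Mge0 p K1) (Mge0 q K2) (MD p K1) (MD q K2).
pose S := (1 + 2 * r) ^+ m.
have S0 : 0 <= S by rewrite exprn_ge0// addr_ge0// mulr_ge0// ltW.
exists (4 * E + (W + W * W) * S).
  by rewrite !(addr_ge0, mulr_ge0).
move=> n ks nn k1 e1 e2.
have k11 i : (1 <= tnth (tfst ks) i)%N by rewrite tnth_mktuple.
have k12 i : (1 <= tnth (tsnd ks) i)%N by rewrite tnth_mktuple.
have l1 := u_statistic_local r0 hH hr xiE xiS n k11.
have l2 := u_statistic_local r0 hH hr xiE xiS n k12.
rewrite e1 in l1; rewrite e2 in l2.
have fin p' K : (family_bound d kappa p' r (@u_statistic_bound R k' H p' K) < +oo)%E.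
  rewrite /family_bound (finite_series (D := (K * k')%N)) ?ltry//.
    by move=> l; rewrite !mulr_ge0 ?invr_ge0// exprn_ge0// near_volume_ge0// ltW.
  by move=> l lK; rewrite MD// !(mul0r, mulr0).
have := ae_and (hW n ks nn k1 e1 e2)
  (functional_mixing corr palmP kappa0 rho_le decay p1 q1 (ltW r0) l1 l2 (fin p K1) (fin q K2)).
apply: (@filterS _ (almost_everywhere _)) => z [[a [b1 [b2 [ea eb1 eb2 [ha hb1 hb2]]]]]] hz uz.
exists a, b1, b2; split => //.
have s0 : 0 <= sep z by exact: sep_ge0.
have S1 : 0 < (1 + sep z) ^+ m by rewrite exprn_gt0// ltr_wpDr.
rewrite ler_pdivlMr//.
have [st|st] := ltP (2 * r) (sep z).
  have [a' [b1' [b2' []]]] := hz uz st _ (hE _ st).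
  rewrite eb1 eb2 (_ : palm_mean _ _ _ z = palm_mean rho palm (pprod (windowed xi n) ks) z); last first.
    by congr (_ * _)%E; apply: eq_integral => Y _; rewrite -pprod_split.
  rewrite ea => -[<-] [<-] [<-]; rewrite mulrA ler_pdivlMr// => /le_trans; apply.
  by rewrite lerDl !(addr_ge0, mulr_ge0).
apply: (@le_trans _ _ ((W + W * W) * S)); last by rewrite lerDr mulr_ge0.
apply: ler_pM => //; first exact: ltW.
  apply: le_trans (ler_normB _ _) _; rewrite normrM lerD//.
  by rewrite ler_pM.
by rewrite /S lerXn2r ?nnegrE ?addr_ge0 ?mulr_ge0 ?(ltW r0)// lerD2l.
Qed.

End class_A1_mixing.

(** * Stabilizing scores: class (A2) *)

Section real_estimates.
Context {R : realType}.

Lemma expR_ge_pow (x : R) n : 0 <= x -> x ^+ n <= n`!%:R * expR x.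
Proof.
case: n => [|n] x0.
  by rewrite expr0 mul1r -[leLHS]expR0 ler_expR.
rewrite -ler_pdivrMl ?ltr0n ?fact_gt0// mulrC.
by apply: le_trans (expR_ge1Dxn n x0); rewrite lerDr.
Qed.

(** The term of order [n] in the exponential series at [n]. *)
Lemma natpow_le_fact n : n%:R ^+ n <= expR 1 ^+ n * n`!%:R :> R.
Proof. by rewrite -expRM_natl mulr1 mulrC; exact: expR_ge_pow. Qed.

(** The condition C_k = O(k^(ak)) in terms of factorials: this form survives shifts of the index and
    compares directly with 1/l!. *)
Definition fact_growth (a : R) (u : nat -> R) : Prop :=
  exists A B : R, [/\ 0 <= A, 1 <= B & forall k, u k <= A * B ^+ k * (k`!%:R `^ a)].

Lemma fact1 k : 1 <= k`!%:R :> R.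
Proof. by rewrite ler1n fact_gt0. Qed.

Lemma powR_ge1 (x a : R) : 1 <= x -> 0 <= a -> 1 <= x `^ a.
Proof. by move=> x1 a0; rewrite -(powRr0 x) ler_powR. Qed.

(** k^(ak) is the power [a] of k^k, which is at most e^k k!. The finitely many indices before [N]
    are absorbed by [S]. *)
Lemma bigO_fact_growth (a : R) (C : nat -> R) : 0 <= a < 1 ->
  C =O_\oo (fun k : nat => k%:R `^ (a * k%:R)) -> fact_growth a (fun k => `|C k|).
Proof.
move=> /andP[a0 a1] /eqO_exP[M M0 [N _ hN]].
pose E := expR (1 : R).
have E1 : 1 <= E by rewrite -expR0 ler_expR.
pose S := \sum_(j < N) `|C j|.
have S0 : 0 <= S by exact: sumr_ge0.
have big k : 1 <= E ^+ k * (k`!%:R `^ a).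
  by rewrite -[leLHS]mul1r ler_pM// ?exprn_ege1// powR_ge1// fact1.
exists (M + S), E; split => //; first by rewrite addr_ge0// ltW.
move=> k; rewrite -mulrA; have [Nk|kN] := leqP N k; last first.
  apply: (@le_trans _ _ S); first by rewrite /S (bigD1 (Ordinal kN))//= lerDl sumr_ge0.
  rewrite -[leLHS]mulr1; apply: ler_pM => //.
  by rewrite lerDr ltW.
apply: le_trans (hN k Nk) _; apply: ler_pM => //; first exact: ltW.
  by rewrite lerDl.
rewrite ger0_norm ?powR_ge0// mulrC powRrM powR_mulrn//.
apply: (@le_trans _ _ ((E ^+ k * k`!%:R) `^ a)).
  by rewrite ge0_ler_powR// ?nnegrE ?mulr_ge0 ?exprn_ge0 ?expR_ge0// natpow_le_fact.
rewrite powRM ?exprn_ge0 ?expR_ge0// ler_wpM2r ?powR_ge0//.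
by rewrite ler1_powR ?exprn_ege1// ltW.
Qed.

Lemma correlation_bound_growth (lam a : R) (C : nat -> R) : 0 <= lam -> 0 <= a < 1 ->
  fact_growth a (fun k => `|C k|) -> fact_growth a (correlation_bound lam C).
Proof.
move=> lam0 /andP[a0 a1] [A [B [A0 B1 hC]]].
(* With [2 * lam <= B'], the term [lam * u] of the recursion costs at most half of one further
   factor [B']. *)
pose B' := B + 2 * lam.
have BB : B <= B' by rewrite lerDl mulr_ge0.
have B'1 : 1 <= B' by exact: le_trans BB.
have B'0 : 0 <= B' by apply: le_trans B'1.
have lB : 2 * lam <= B' by rewrite /B'; lra.
exists (2 * A + 1), B'; split => //; first by rewrite addr_ge0// mulr_ge0.
elim=> [|[|k] IH].
- by rewrite /= !mulr_ge0// ?addr_ge0// ?mulr_ge0// powR_ge0.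
- rewrite (_ : 1`! = 1%N)// powR1 mulr1 expr1 /=; apply: (@le_trans _ _ (1 * B')); first by lra.
  by rewrite ler_wpM2r// lerDr mulr_ge0.
rewrite [leLHS]/=; set u := correlation_bound lam C k.+1 in IH *.
set F := k.+2`!%:R `^ a.
have F0 : 0 <= F by exact: powR_ge0.
have FF : k.+1`!%:R `^ a <= F.
  by rewrite ge0_ler_powR ?nnegrE// ler_nat [leqRHS]factS leq_pmull.
have Bk : 0 <= B' ^+ k.+1 by exact: exprn_ge0.
have h1 : lam * u <= B' / 2 * ((2 * A + 1) * B' ^+ k.+1 * F).
  apply: (@le_trans _ _ (lam * ((2 * A + 1) * B' ^+ k.+1 * F))).
    rewrite ler_wpM2l//; apply: le_trans IH _; rewrite ler_wpM2l// mulr_ge0//.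
    by rewrite addr_ge0// mulr_ge0.
  rewrite ler_wpM2r//; last by lra.
  by rewrite !mulr_ge0// addr_ge0// mulr_ge0.
have h2 : `|C k.+2| <= A * B' ^+ k.+2 * F.
  apply: le_trans (hC _) _; rewrite ler_wpM2r// ler_wpM2l// lerXn2r ?nnegrE//.
  by rewrite (le_trans ler01).
apply: le_trans (lerD h1 h2) _.
(* The recursion term takes [A + 1/2] and the term in [C] takes [A], which together stay below
   [2 * A + 1]. *)
have -> : B' / 2 * ((2 * A + 1) * B' ^+ k.+1 * F) + A * B' ^+ k.+2 * F =
    (2 * A + 1 / 2) * B' ^+ k.+2 * F by rewrite [B' ^+ k.+2]exprS; field.
by rewrite ler_wpM2r// ler_wpM2r ?exprn_ge0//; lra.
Qed.

Lemma bin_le_pow2 n k : ('C(n, k) <= 2 ^ n)%N.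
Proof.
elim: n k => [|n IH] [|k] //; first by rewrite bin0 expn_gt0.
by rewrite binS expnS mul2n -addnn leq_add.
Qed.

Lemma factD_le p l : ((p + l)`! <= 2 ^ (p + l) * (p`! * l`!))%N.
Proof.
rewrite -(@bin_fact (p + l) p) ?leq_addr// addKn leq_mul2r.
by rewrite bin_le_pow2 orbT.
Qed.

Lemma factD_powR (a : R) p l : 0 <= a < 1 ->
  (p + l)`!%:R `^ a <= 2 ^+ (p + l) * ((p`!%:R `^ a) * (l`!%:R `^ a)).
Proof.
move=> /andP[a0 a1].
apply: (@le_trans _ _ ((2 ^ (p + l) * (p`! * l`!))%:R `^ a)).
  by rewrite ge0_ler_powR ?nnegrE// ler_nat factD_le.
rewrite !natrM !powRM ?mulr_ge0// ler_wpM2r ?mulr_ge0 ?powR_ge0//.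
by rewrite natrX ler1_powR ?exprn_ege1 ?ler1n// ltW.
Qed.

Lemma fact_growth_shift (a : R) u p : 0 <= a < 1 -> fact_growth a u ->
  fact_growth a (fun l => u (p + l)%N).
Proof.
move=> a01 [A [B [A0 B1 h]]]; have B0 : 0 <= B by rewrite (le_trans ler01).
exists (A * ((B * 2) ^+ p * (p`!%:R `^ a))), (B * 2); split => [||l].
- by rewrite !mulr_ge0 ?exprn_ge0 ?mulr_ge0 ?powR_ge0.
- by rewrite -[leLHS]mul1r ler_pM// ler1n.
apply: le_trans (h _) _; rewrite -!mulrA ler_wpM2l//.
apply: le_trans (ler_wpM2l (exprn_ge0 _ B0) (factD_powR p l a01)) _.
rewrite !exprD !exprMn le_eqVlt; apply/orP; left; apply/eqP.
by rewrite !mulrA; ring.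
Qed.

(** A bound that factors in [l1] and [l2] turns the double series of the mixing error into a product
    of two series. *)
Lemma fact_growth_split (a : R) u p q : 0 <= a < 1 -> fact_growth a u ->
  exists A B : R, [/\ 0 <= A, 1 <= B & forall l1 l2,
    u (p + l1 + (q + l2))%N <=
      A * (B ^+ l1 * (l1`!%:R `^ a)) * (B ^+ l2 * (l2`!%:R `^ a))].
Proof.
move=> a01 /(fact_growth_shift (p + q) a01)[A [B [A0 B1 h]]].
have B0 : 0 <= B by rewrite (le_trans ler01).
exists A, (B * 2); split => // [|l1 l2]; first by rewrite -[leLHS]mul1r ler_pM// ler1n.
rewrite addnACA; apply: le_trans (h _) _; rewrite -!mulrA ler_wpM2l//.
apply: le_trans (ler_wpM2l (exprn_ge0 _ B0) (factD_powR l1 l2 a01)) _.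
by rewrite !exprD !exprMn le_eqVlt; apply/orP; left; apply/eqP; ring.
Qed.

Lemma nneseries_le_bound (u : nat -> R) (c : R) : (forall l, 0 <= u l) ->
  (forall n, \sum_(l < n) u l <= c) -> (\sum_(l <oo) (u l)%:E <= c%:E)%E.
Proof.
move=> u0 h; apply: lime_le; first by apply: is_cvg_nneseries => l _ _; rewrite lee_fin.
by apply: nearW => n; rewrite big_mkord sumEFin lee_fin.
Qed.

Lemma geometric_half_le n : \sum_(l < n) (2^-1 : R) ^+ l <= 2.
Proof.
suff -> : \sum_(l < n) (2^-1 : R) ^+ l = 2 - 2 * 2^-1 ^+ n.
  by rewrite gerBl mulr_ge0 ?exprn_ge0.
elim: n => [|n IH]; first by rewrite big_ord0 expr0; lra.
by rewrite big_ord_recr /= IH exprS; field.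
Qed.

(** The term of order [l] is 2^(-l) times [v], where v = (2w)^l / (l!)^(1-a). If [v > 1], it is at
    most its power [e0], and since [e0 * (1 - a) >= 1] that power is at most ((2w)^e0)^l / l!, which
    the exponential dominates. *)
Lemma fact_series_le (a w : R) (e0 : nat) : 0 <= a < 1 -> 1 <= e0%:R * (1 - a) -> 0 <= w ->
  (\sum_(l <oo) (l`!%:R^-1 * ((l`!%:R `^ a) * w ^+ l))%:E <= (2 * expR ((2 * w) ^+ e0))%:E)%E.
Proof.
move=> /andP[a0 a1] e0a w0; set E := expR _.
have E1 : 1 <= E by rewrite -expR0 ler_expR exprn_ge0// mulr_ge0.
have e0_gt0 : (0 < e0)%N.
  by rewrite lt0n; apply: contraTneq e0a => ->; rewrite mul0r -ltNge ltr01.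
have term l : l`!%:R^-1 * ((l`!%:R `^ a) * w ^+ l) <= 2^-1 ^+ l * E.
  have l0 : 0 < l`!%:R :> R by rewrite ltr0n fact_gt0.
  pose v := (l`!%:R `^ (a - 1)) * (2 * w) ^+ l.
  have v0 : 0 <= v by rewrite mulr_ge0 ?powR_ge0// exprn_ge0// mulr_ge0.
  have -> : l`!%:R^-1 * ((l`!%:R `^ a) * w ^+ l) = 2^-1 ^+ l * v.
    rewrite /v powRD; last by apply/implyP => _; rewrite gt_eqF.
    rewrite powR_inv1 ?ltW// exprMn.
    rewrite (_ : 2^-1 ^+ l * _ = (2^-1 ^+ l * 2 ^+ l) * (l`!%:R^-1 * ((l`!%:R `^ a) * w ^+ l))); last by ring.
    by rewrite -exprMn mulVf// expr1n mul1r.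
  rewrite ler_wpM2l ?exprn_ge0//.
  have [v1|v1] := leP v 1; first exact: le_trans E1.
  apply: (@le_trans _ _ (v ^+ e0)).
    by rewrite -[leLHS]expr1 ler_weXn2l// ltW.
  have e1 : (l`!%:R `^ (a - 1)) ^+ e0 = l`!%:R `^ ((a - 1) * e0%:R).
    by rewrite powRrM powR_mulrn// powR_ge0.
  rewrite /v exprMn e1.
  apply: (@le_trans _ _ (l`!%:R^-1 * (2 * w) ^+ l ^+ e0)).
    rewrite ler_wpM2r ?exprn_ge0 ?mulr_ge0//.
    rewrite -(powR_inv1 (ltW l0)) ler_powR ?fact1//.
    by rewrite -lerN2 opprK mulrC -mulrN opprB.
  rewrite ler_pdivrMl// -exprM mulnC exprM.
  by apply: expR_ge_pow; rewrite exprn_ge0// mulr_ge0.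
apply: nneseries_le_bound => [l|n].
  by rewrite !mulr_ge0 ?invr_ge0 ?powR_ge0 ?exprn_ge0.
apply: (@le_trans _ _ (\sum_(l < n) 2^-1 ^+ l * E)); first by apply: ler_sum => l _.
by rewrite -mulr_suml ler_wpM2r ?expR_ge0 ?geometric_half_le.
Qed.

Lemma log_decay_exp (phi : R -> R) (b : R) : 0 < b -> log_decay phi b ->
  exists2 eps : R, 0 < eps & exists2 s0 : R, 1 <= s0 &
    forall s, s0 <= s -> phi s <= expR (- eps * (s `^ b)).
Proof.
move=> b0 [_]; rewrite /limf_esup => /ereal_inf_lt[_ [V [s1 [_ hV]] <-] hs].
have [eps [eps0 heps]] : exists eps : R, 0 < eps /\
   (ereal_sup [set ((t `^ (- b))%:E * lne (phi t)%:E)%E | t in V] <= (- eps)%:E)%E.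
  (* A supremum equal to [-oo] allows every rate, and 1 is taken. *)
  move: hs; case: ereal_sup => [r| |_] //; last by exists 1; rewrite leNye.
  rewrite lte_fin => r0; exists (- r); split; first by lra.
  by rewrite opprK.
exists eps => //; exists (Num.max 1 (s1 + 1)); first by rewrite le_max lexx.
move=> s; rewrite ge_max => /andP[s1' s2].
have s0 : 0 < s by rewrite (lt_le_trans ltr01).
have Vs : V s by apply: hV; lra.
have := le_trans (ereal_sup_ubound (ex_intro2 _ _ s Vs erefl)) heps.
rewrite /lne; case: ifPn => [p0 _|]; first by rewrite (le_trans p0)// expR_ge0.
rewrite -ltNge => p0; rewrite -EFinM lee_fin => h.
rewrite -{1}(lnK p0) ler_expR.
have sb : 0 < s `^ b by exact: powR_gt0.
move: h; rewrite powRN ler_pdivrMl// => h; rewrite mulrC; lra.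
Qed.

Lemma exp_dominated (m e : nat) (c eps : R) : (1 <= e)%N -> 0 <= c -> 0 < eps ->
  exists2 A : R, 0 <= A & forall t, 1 <= t ->
    t ^+ m * expR (c * t ^+ e - eps * t ^+ e.+1) <= A.
Proof.
(* Beyond [T] one has [eps * t >= c + 1], so the exponent is at most [- t ^+ e], hence at most
   [- t]. *)
move=> e1 c0 eps0; pose T := (c + 1) / eps.
have T0 : 0 <= T by rewrite divr_ge0// ?addr_ge0// ltW.
exists (T ^+ m * expR (c * T ^+ e) + m`!%:R).
  by rewrite addr_ge0// mulr_ge0 ?exprn_ge0 ?expR_ge0.
move=> t t1; have t0 : 0 <= t by rewrite (le_trans ler01).
have [tT|Tt] := leP t T.
  apply: (@le_trans _ _ (T ^+ m * expR (c * T ^+ e))); last by rewrite lerDl.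
  apply: ler_pM; rewrite ?exprn_ge0 ?expR_ge0//; first by rewrite lerXn2r ?nnegrE.
  rewrite ler_expR; apply: (@le_trans _ _ (c * t ^+ e)).
    by rewrite gerBl mulr_ge0 ?exprn_ge0// ltW.
  by rewrite ler_wpM2l// lerXn2r ?nnegrE.
apply: (@le_trans _ _ (m`!%:R)); last by rewrite lerDr mulr_ge0 ?exprn_ge0 ?expR_ge0.
apply: (@le_trans _ _ (t ^+ m * expR (- t))).
  rewrite ler_wpM2l ?exprn_ge0// ler_expR.
  have te : t <= t ^+ e by rewrite -[leLHS]expr1 ler_weXn2l.
  have h : c + 1 <= eps * t by rewrite mulrC -ler_pdivrMr// ltW.
  have := ler_wpM2r (exprn_ge0 e t0) h.
  rewrite exprS; lra.
by rewrite expRN ler_pdivrMr ?expR_gt0// expR_ge_pow.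
Qed.

Lemma log_decay_poly (phi : R -> R) (b : R) m : 0 < b -> log_decay phi b ->
  (forall t, 0 <= t -> 0 <= phi t <= 1) ->
  exists2 A : R, 0 <= A & forall t, 0 < t -> phi t <= A / t ^+ m.
Proof.
move=> b0 /(log_decay_exp b0)[eps eps0 [s0 s01 h]] phi01.
(* With [m <= b * j], the power [t ^+ m] is at most the [j]-th power of t^b for [t >= 1], and the
   exponential absorbs the latter. *)
pose j := (Num.truncn (m%:R / b)).+1.
have jb : m%:R <= b * j%:R.
  by rewrite mulrC -ler_pdivrMr// ltW// truncnS_gt.
exists (s0 ^+ m + j`!%:R / eps ^+ j).
  by rewrite addr_ge0 ?exprn_ge0 ?divr_ge0 ?exprn_ge0// ?ltW// (lt_le_trans ltr01).
move=> t t0; rewrite ler_pdivlMr ?exprn_gt0//; have [ts|st] := leP t s0.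
  have /andP[p0 p1] := phi01 t (ltW t0).
  apply: (@le_trans _ _ (s0 ^+ m)); last first.
    by rewrite lerDl divr_ge0 ?exprn_ge0// ltW.
  apply: (@le_trans _ _ (t ^+ m)); first by rewrite ler_piMl// exprn_ge0// ltW.
  by rewrite lerXn2r ?nnegrE ?(ltW t0)// (le_trans (ltW t0)).
apply: (@le_trans _ _ (j`!%:R / eps ^+ j)); last first.
  by rewrite lerDr exprn_ge0// (le_trans ler01).
have t1 : 1 <= t by rewrite (le_trans s01)// ltW.
apply: (@le_trans _ _ (expR (- eps * t `^ b) * (t `^ b) ^+ j)).
  apply: ler_pM.
  - by have /andP[] := phi01 t (ltW t0).
  - by rewrite exprn_ge0// ltW.
  - by apply: h; exact: ltW.
  - by rewrite -(powR_mulrn _ (ltW t0)) -(powR_mulrn _ (powR_ge0 _ _)) -powRrM ler_powR.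
rewrite mulNr expRN -ler_pdivlMl ?invr_gt0 ?expR_gt0// invrK.
rewrite mulrA ler_pdivlMr ?exprn_gt0// -exprMn [_ * eps]mulrC [leRHS]mulrC.
by apply: expR_ge_pow; rewrite mulr_ge0 ?powR_ge0// ltW.
Qed.

(** The truncation radius is kept a natural number, so that one null set can serve all radii; the
    price is the gap between [t] and [t.+1]. *)
Lemma nat_root (s : R) N : (1 <= N)%N -> 1 <= s ->
  exists t : nat, [/\ (1 <= t)%N, t%:R ^+ N <= s & s < t.+1%:R ^+ N].
Proof.
move=> N1 s1; pose Q (t : nat) := t%:R ^+ N <= s.
have s0 : 0 <= s by rewrite (le_trans ler01).
have Q1 : exists t, Q t by exists 1%N; rewrite /Q expr1n.
have Qb t : Q t -> (t <= Num.truncn s)%N.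
  rewrite /Q => h; case: t h => // t h.
  rewrite truncn_ge_nat//; apply: le_trans h.
  by rewrite -[leLHS]expr1 ler_weXn2l// ler1n.
case: (ex_maxnP Q1 Qb) => t Qt tmax; exists t; split => //.
  by apply: tmax; rewrite /Q expr1n.
by rewrite ltNge; apply/negP => /tmax; rewrite ltnn.
Qed.

End real_estimates.

Lemma ae_forall_ord {dm : measure_display} {T : measurableType dm} {R : realType}
    (mu : {measure set T -> \bar R}) p (Q : 'I_p -> T -> Prop) :
  (forall i, {ae mu, forall x, Q i x}) -> {ae mu, forall x, forall i, Q i x}.
Proof.
move=> h; have : {ae mu, forall x, forall k : nat, if insub k is Some i then Q i x else True}.
  apply: ae_foralln => k; case: insub => [i|]; [exact: h|exact: aeW].
by apply: ae_sub => x hx i; have := hx i; rewrite valK.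
Qed.

Section scaled_bounds.
Context {dm : measure_display} {T : measurableType dm} {R : realType}.
Variables (mu : {measure set T -> \bar R}) (r : R).
Hypothesis r0 : 0 <= r.
Implicit Types f g : T -> R.

Lemma scaled_leD f g a b : measurable_fun setT f -> measurable_fun setT g ->
  (forall y, 0 <= f y) -> (forall y, 0 <= g y) ->
  ((\int[mu]_y (f y)%:E) * r%:E <= a%:E)%E -> ((\int[mu]_y (g y)%:E) * r%:E <= b%:E)%E ->
  ((\int[mu]_y (f y + g y)%:E) * r%:E <= (a + b)%:E)%E.
Proof.
move=> mf mg f0 g0 fa gb; under eq_integral do rewrite EFinD.
rewrite ge0_integralD//; last 4 first.
- by move=> y _; rewrite lee_fin.
- exact/measurable_EFinP.
- by move=> y _; rewrite lee_fin.
- exact/measurable_EFinP.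
rewrite ge0_muleDl ?EFinD ?leeD//; by apply: integral_ge0 => y _; rewrite lee_fin.
Qed.

Lemma scaled_leZ k f a : measurable_fun setT f -> (forall y, 0 <= f y) -> 0 <= k ->
  ((\int[mu]_y (f y)%:E) * r%:E <= a%:E)%E ->
  ((\int[mu]_y (k * f y)%:E) * r%:E <= (k * a)%:E)%E.
Proof.
move=> mf f0 k0 fa; under eq_integral do rewrite EFinM.
rewrite ge0_integralZl//; last 2 first.
- exact/measurable_EFinP.
- by move=> y _; rewrite lee_fin.
by rewrite -muleA EFinM lee_wpmul2l// lee_fin.
Qed.

Lemma scaled_le_sum p (F : 'I_p -> T -> R) a : (forall i, measurable_fun setT (F i)) ->
  (forall i y, 0 <= F i y) ->
  (forall i, (\int[mu]_y (F i y)%:E) * r%:E <= a%:E)%E ->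
  ((\int[mu]_y (\sum_i F i y)%:E) * r%:E <= (p%:R * a)%:E)%E.
Proof.
move=> mF F0 h; under eq_integral do rewrite -sumEFin.
rewrite ge0_integral_sum//; last 2 first.
- by move=> i; exact/measurable_EFinP.
- by move=> i y _; rewrite lee_fin.
rewrite ge0_sume_distrl; last by move=> i _; apply: integral_ge0 => y _; rewrite lee_fin.
apply: (@le_trans _ _ (\sum_(i < p) a%:E)%E); first by apply: lee_sum => i _; exact: h.
by rewrite sumEFin lee_fin sumr_const card_ord mulr_natl.
Qed.

End scaled_bounds.

(** * Truncated scores and the cost of truncation *)

Section truncation.
Context {R : realType} {d : nat}.
Variable xi : pt R d -> lfset R d -> R.
Hypothesis xiS : score_function xi.

(* The level [t] is also the radius of truncation: large scores are rare by the
   moment condition, and the clipped score is bounded by a power of [t]. *)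
Definition clip (t u : R) : R := if `|u| <= t then u else 0.

Lemma clip_le t u : 0 <= t -> `|clip t u| <= t.
Proof. by move=> t0; rewrite /clip; case: ifP => //; rewrite normr0. Qed.

Lemma clip_id t u : `|u| <= t -> clip t u = u.
Proof. by rewrite /clip => ->. Qed.

Lemma clip0 t : clip t 0 = 0.
Proof. by rewrite /clip; case: ifP. Qed.

Lemma measurable_clip t : measurable_fun setT (clip t).
Proof.
apply: measurable_fun_ifT => //.
by apply: measurable_fun_ler => //; exact: measurableT_comp.
Qed.

Definition truncated (t : nat) n (y : pt R d) (Y : lfset R d) : R :=
  clip t%:R (windowed xi n y (lfI Y (cball y t%:R))).

Lemma measurable_windowed_cball (t : R) n :
  measurable_fun setT (fun z : pt R d * lfset R d => windowed xi n z.1 (lfI z.2 (cball z.1 t))).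
Proof.
apply: (measurableT_comp (measurable_windowed xiS n) (g := fun z => (z.1, lfI z.2 (cball z.1 t)))).
apply: measurable_fun_pair => //.
exact: (measurable_lfI_cball t measurable_fst measurable_snd).
Qed.

Lemma measurable_truncated t n :
  measurable_fun setT (fun z : pt R d * lfset R d => truncated t n z.1 z.2).
Proof. exact: (measurableT_comp (measurable_clip _) (measurable_windowed_cball _ _)). Qed.

Lemma truncated_outside t n y (Y : lfset R d) :
  ~ (lf_set Y y /\ window n y) -> truncated t n y Y = 0.
Proof.
by move=> h; rewrite /truncated (windowed_outside xiS) ?clip0// => -[[]]; tauto.
Qed.

Lemma truncated_cball t n y Y : truncated t n y Y = truncated t n y (lfI Y (cball y t%:R)).
Proof.
rewrite /truncated; congr (clip _ (windowed _ _ _ _)).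
by apply: lfset_ext => /=; rewrite -setIA setIid.
Qed.

Lemma pprod_truncated_le t n p (ks : p.-tuple nat) x Y : (1 <= t)%N ->
  `|pprod (truncated t n) ks x Y| <= t%:R ^+ (\sum_(i < p) tnth ks i).
Proof.
move=> t1; apply: pprod_norm_le => [|i]; first by rewrite ler1n.
by rewrite clip_le.
Qed.

(** A Moebius coefficient of order [l] is a signed sum of [2 ^ l] values, each bounded through
    clipping. *)
Lemma truncated_local t n p (ks : p.-tuple nat) : (1 <= t)%N -> (forall i, (1 <= tnth ks i)%N) ->
  local_functional t%:R (fun l => 2 ^+ l * t%:R ^+ (\sum_(i < p) tnth ks i))
    (pprod (truncated t n) ks).
Proof.
move=> t1 k1; split.
- exact: measurable_pprod (measurable_truncated t n).
- move=> x Y; apply: pprod_outside => // y Z nZ.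
  by rewrite truncated_outside// => -[].
- move=> x Y _; exact: pprod_local (truncated_cball t n).
move=> l w; rewrite /mob normrM.
apply: (@le_trans _ _ (1 * (2 ^+ l * t%:R ^+ (\sum_(i < p) tnth ks i)))); last by rewrite mul1r.
apply: ler_pM => //; first by rewrite indicE; case: (_ \in _); rewrite ?normr1 ?normr0.
by apply: sum_signed_le => S; exact: pprod_truncated_le.
Qed.

(** A measurable substitute, contained in it, for the event that the radius of stabilization exceeds
    [t]. *)
Definition bad (t : nat) n : set (pt R d * lfset R d) :=
  [set z | windowed xi n z.1 z.2 <> windowed xi n z.1 (lfI z.2 (cball z.1 t%:R))].

Lemma measurable_bad t n : measurable (bad t n).
Proof.
rewrite (_ : bad t n = ~` ((fun z => windowed xi n z.1 z.2 -
    windowed xi n z.1 (lfI z.2 (cball z.1 t%:R))) @^-1` [set 0])).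
  apply: measurableC; rewrite -[X in measurable X]setTI.
  apply: measurable_funB => //; first exact: measurable_windowed.
  exact: measurable_windowed_cball.
by apply/seteqP; split => z /= h e; apply: h; [apply/eqP; rewrite -subr_eq0; apply/eqP|rewrite e subrr].
Qed.

(** Otherwise some [r <= t] is suitable. The windowed configuration and its part in the ball of
    radius [t] both extend the part in the ball of radius [r] by points outside that ball, so all
    three give the same score. *)
Lemma bad_stab t n y Y : bad t n (y, Y) -> (t%:R%:E < stab_radius xi y (lfI Y (window n)))%E.
Proof.
rewrite ltNge => nb; apply/negP => le; apply: nb => /=.
(* An infimum below [t.+1] yields a suitable natural radius below [t.+1], hence at most [t]; its
   attainment is not discussed. *)
have : (stab_radius xi y (lfI Y (window n)) < (t.+1)%:R%:E)%E.
  by apply: le_lt_trans le _; rewrite lte_fin ltr_nat.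
move=> /ereal_inf_lt[_ [r [r1 hr] <-]]; rewrite lte_fin ltr_nat ltnS => rt.
set Z := lfI Y (window n) in hr.
have e1 : xi y Z = xi y (lfI Z (cball y r%:R)).
  rewrite (hr Z); congr (xi _ _); apply: lfset_ext => /=.
  by rewrite -setIUr setUv setIT.
have sub : cball y r%:R `<=` cball y t%:R.
  by move=> u /= h; apply: le_trans h _; rewrite ler_nat.
have e2 : xi y (lfI Z (cball y t%:R)) = xi y (lfI Z (cball y r%:R)).
  rewrite (hr (lfI Z (cball y t%:R))); congr (xi _ _); apply: lfset_ext => /=.
  apply/seteqP; split => u.
    move=> [Zu tu]; have [ru|ru] := pselect (cball y r%:R u); first by left.
    by right.
  by move=> [[Zu /sub]|[]].
rewrite /windowed -/Z e1 -e2; congr (xi _ _); apply: lfset_ext => /=.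
by rewrite -!setIA; congr setI; rewrite setIC.
Qed.

(** If the largest [zscore], [z], exceeds [t], both products are at most [z ^+ K], and the ratio z/t
    to the power [m] is at least 1. If not, both are at most [t ^+ K], and they coincide unless a
    [bad] event occurs. *)
Lemma truncation_dist t n p (ks : p.-tuple nat) (x : p.-tuple (pt R d)) Y m : (1 <= p)%N -> (1 <= t)%N ->
  let K := (\sum_(i < p) tnth ks i)%N in
  `|pprod (windowed xi n) ks x Y - pprod (truncated t n) ks x Y| <=
  2 / t%:R ^+ m * (\sum_i zscore xi n (tnth x i) Y ^+ (K + m)) +
  2 * t%:R ^+ K * \sum_i \1_(bad t n) (tnth x i, Y).
Proof.
move=> p1 t1 /=; set K := (\sum_(i < p) _)%N.
have [z zi [i zE le]] := max_le_sum (K + m) p1 (fun i => zscore_ge1 xi n (tnth x i) Y).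
have z1 : 1 <= z by rewrite zE zscore_ge1.
have t0 : 0 < t%:R :> R by rewrite ltr0n.
have z0 : 0 <= z by exact: le_trans z1.
have t0' := ltW t0.
have wz : `|pprod (windowed xi n) ks x Y| <= z ^+ K by exact: pprod_windowed_le.
have wt := pprod_truncated_le n ks x Y t1.
have b0 : 0 <= \sum_i \1_(bad t n) (tnth x i, Y) :> R by apply: sumr_ge0 => j _; rewrite indicE.
have t2 : 0 <= 2 * t%:R ^+ K :> R by rewrite mulr_ge0 ?exprn_ge0.
have s0 : 0 <= 2 / t%:R ^+ m * (\sum_i zscore xi n (tnth x i) Y ^+ (K + m)).
  rewrite mulr_ge0 ?divr_ge0 ?exprn_ge0//.
  by apply: le_trans le; rewrite exprn_ge0// (le_trans ler01).
have [tz|zt] := ltP t%:R z.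
  apply: (@le_trans _ _ (2 / t%:R ^+ m * (\sum_i zscore xi n (tnth x i) Y ^+ (K + m)))); last first.
    by rewrite lerDl mulr_ge0.
  apply: (@le_trans _ _ (2 / t%:R ^+ m * z ^+ (K + m))); last first.
    by rewrite ler_wpM2l// divr_ge0// exprn_ge0.
  apply: (@le_trans _ _ (2 * z ^+ K)).
    apply: le_trans (ler_normB _ _) _; rewrite mulr_natl mulr2n lerD//.
    by apply: le_trans wt _; rewrite lerXn2r ?nnegrE// ltW.
  rewrite -mulrA ler_wpM2l// exprD mulrCA ler_peMr ?exprn_ge0//.
  by rewrite ler_pdivlMl ?exprn_gt0// mulr1 lerXn2r ?nnegrE// ltW.
have [bi|nb] := pselect (exists i, bad t n (tnth x i, Y)).
  apply: (@le_trans _ _ (2 * t%:R ^+ K * \sum_i \1_(bad t n) (tnth x i, Y))); last by rewrite lerDr.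
  apply: (@le_trans _ _ (2 * t%:R ^+ K)).
    apply: le_trans (ler_normB _ _) _; rewrite mulr_natl mulr2n lerD//.
    by apply: le_trans wz _; rewrite lerXn2r ?nnegrE.
  rewrite ler_peMr//; have [j bj] := bi.
  rewrite (bigD1 j)//= indicE mem_set// lerDl.
  by apply: sumr_ge0 => k _; rewrite indicE.
rewrite (_ : pprod (truncated t n) ks x Y = pprod (windowed xi n) ks x Y).
  by rewrite subrr normr0 addr_ge0// mulr_ge0.
apply: eq_bigr => j _; congr (_ ^+ _); rewrite /truncated.
have e : windowed xi n (tnth x j) Y = windowed xi n (tnth x j) (lfI Y (cball (tnth x j) t%:R)).
  by apply: contrapT => h; apply: nb; exists j.
rewrite -e clip_id//; apply: le_trans zt; apply: le_trans (zi j).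
by rewrite le_max lexx.
Qed.

End truncation.

Section stabilization.
Context {dd : measure_display} {Omega : measurableType dd} {R : realType}.
Variables (P : probability Omega R) (d : nat) (X : {RV P >-> lfset R d})
  (rho : forall k, k.-tuple (pt R d) -> R)
  (palm : forall k, R.-pker (k.-tuple (pt R d)) ~> lfset R d)
  (xi : pt R d -> lfset R d -> R).
Hypothesis corr : forall k, (1 <= k)%N -> correlation_function X (@rho k).
Hypothesis palmP : forall k, (1 <= k)%N -> palm_version X (palm k).
Variable kappa : nat -> R.
Hypothesis kappa0 : forall k, 0 <= kappa k.
Hypothesis rho_le : forall k, (1 <= k)%N -> {ae lebk R d k, forall x, rho x <= kappa k}.
Hypothesis xiS : score_function xi.
Hypothesis moments : forall p : R, 1 < p -> moment_condition X palm xi p.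

Lemma bad_coord a phi l t n i : stabilizing X palm xi a phi -> (1 <= t)%N -> window_index n ->
  {ae lebk R d l.+1, forall x, (forall j, window n (tnth x j)) ->
    ((\int[palm l.+1 x]_Y (\1_(bad xi t n) (tnth x i, Y))%:E) * (rho x)%:E <=
      (phi (a l.+1 * t%:R) * rho x)%:E)%E}.
Proof.
move=> [a0 phi01 _ _ stab] t1 nn.
have t0 : 0 < t%:R :> R by rewrite ltr0n.
have /andP[p0 _] : 0 <= phi (a l.+1 * t%:R) <= 1 by apply: phi01; rewrite mulr_ge0// ltW// a0.
have mb : measurable_fun setT (fun z : pt R d * lfset R d => (\1_(bad xi t n) z)%:E : \bar R).
  by apply/measurable_EFinP/measurable_indic; exact: measurable_bad.
apply: (palm_coord_bound corr palmP kappa0 rho_le mb) => //.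
- exact: measurable_window.
have := stab l t%:R n t0 nn; apply: ae_sub => x h Wx.
apply: le_trans (h Wx).
pose B := [set Y | bad xi t n (thead x, Y)].
have mB : measurable B.
  have := measurable_bad xiS t n; rewrite -[X in _ -> measurable X]setTI => mbad.
  by apply: (_ : measurable_fun setT (fun Y : lfset R d => (thead x, Y))) => //; exact: measurable_fun_pair.
rewrite (_ : (fun Y => _) = (fun Y => (\1_B Y)%:E)).
  rewrite integral_indic// setIT -measurable_mu_extE//.
  by apply: le_mu_ext => Y; exact: bad_stab.
by apply/funext => Y; rewrite !indicE; congr ((_ : bool)%:R%:E); apply/idP/idP => /set_mem bY; exact: mem_set.
Qed.

Lemma truncation_error p K m : (1 <= p)%N -> exponentially_stabilizing X palm xi ->
  exists2 A : R, 0 <= A & forall t n (ks : p.-tuple nat), (1 <= t)%N -> window_index n ->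
  (forall i, (1 <= tnth ks i)%N) -> (\sum_(i < p) tnth ks i)%N = K ->
  {ae lebk R d p, forall x : p.-tuple (pt R d), exists a b : R,
    [/\ palm_mean rho palm (pprod (windowed xi n) ks) x = a%:E,
        palm_mean rho palm (pprod (truncated xi t n) ks) x = b%:E &
        `|a - b| <= A / t%:R ^+ m]}.
Proof.
case: p => // l _ [a [phi [stab [c c0 ld]]]].
have [a0 phi01 _ _ _] := stab.
have [A1 A10 hA1] := moment_sum corr palmP kappa0 rho_le xiS moments (K + m) (isT : (1 <= l.+1)%N).
have [A2 A20 hA2] := moment_sum corr palmP kappa0 rho_le xiS moments K (isT : (1 <= l.+1)%N).
(* On a [bad] event the difference may be of size [t ^+ K], so stabilization is used with the power
   [K + m]. *)
have [A3 A30 hA3] := log_decay_poly (K + m) c0 ld phi01.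
have al0 : 0 < a l.+1 by exact: a0.
pose A4 := A3 / a l.+1 ^+ (K + m).
have A40 : 0 <= A4 by rewrite divr_ge0// exprn_ge0// ltW.
pose D := 2 * A1 + 2 * (l.+1%:R * (A4 * kappa l.+1)).
have D0 : 0 <= D by apply: addr_ge0; do ?apply: mulr_ge0 => //.
exists D => //.
move=> t n ks t1 nn k1 kK.
have t0 : 0 < t%:R :> R by rewrite ltr0n.
have [_ rho0 _ _] := corr (isT : (1 <= l.+1)%N).
have bc := ae_forall_ord (fun i => bad_coord i stab t1 nn).
have := ae_and (ae_and (hA1 n nn) (hA2 n nn)) (ae_and (bc l) (rho_le (isT : (1 <= l.+1)%N))).
apply: (@filterS _ (almost_everywhere _)) => x [[h1 h2] [hb hr]].
have [Wx|nWx] := pselect (forall j, window n (tnth x j)); last first.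
  exists 0, 0; split; last by rewrite subrr normr0 divr_ge0// exprn_ge0.
    rewrite /palm_mean (eq_integral (fun=> 0%E)) ?integral0 ?mul0e// => Y _.
    rewrite (pprod_outside_window (n := n))// => y Z Wy.
    by apply: windowed_outside => // -[].
  rewrite /palm_mean (eq_integral (fun=> 0%E)) ?integral0 ?mul0e// => Y _.
  rewrite (pprod_outside_window (n := n))// => y Z Wy.
  by apply: truncated_outside => // -[].
have mx (th : pt R d -> lfset R d -> R) : measurable_fun setT (fun z : pt R d * lfset R d => th z.1 z.2) ->
    measurable_fun setT (fun Y => pprod th ks x Y).
  move=> mth; apply: (measurableT_comp (measurable_pprod ks mth) (g := fun Y => (x, Y))).
  exact: measurable_fun_pair.
have mb i : measurable_fun setT (fun Y => \1_(bad xi t n) (tnth x i, Y) : R).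
  have mi : measurable_fun setT (\1_(bad xi t n) : _ -> R).
    by apply: measurable_indic; exact: measurable_bad.
  apply: (measurableT_comp mi (g := fun Y => (tnth x i, Y))).
  exact: measurable_fun_pair.
have mz N : measurable_fun setT (fun Y => \sum_i zscore xi n (tnth x i) Y ^+ N).
  by apply/measurable_EFinP; exact: measurable_zscore_sum.
have z0 N Y : 0 <= \sum_i zscore xi n (tnth x i) Y ^+ N.
  by apply: sumr_ge0 => i _; rewrite exprn_ge0// (le_trans ler01)// zscore_ge1.
have b0 Y : 0 <= \sum_i \1_(bad xi t n) (tnth x i, Y) :> R.
  by apply: sumr_ge0 => i _; rewrite indicE.
pose G Y := 2 / t%:R ^+ m * (\sum_i zscore xi n (tnth x i) Y ^+ (K + m)) +
  2 * t%:R ^+ K * \sum_i \1_(bad xi t n) (tnth x i, Y).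
have mG : measurable_fun setT G.
  apply: measurable_funD; apply: measurable_funM => //.
  by apply: measurable_sum.
have ptm : 0 <= 2 / t%:R ^+ m :> R by rewrite divr_ge0// exprn_ge0.
have ptK : 0 <= 2 * t%:R ^+ K :> R by rewrite mulr_ge0// exprn_ge0.
have phit : phi (a l.+1 * t%:R) <= A4 / t%:R ^+ (K + m).
  apply: le_trans (hA3 _ _) _; first by rewrite mulr_gt0.
  by rewrite exprMn invfM mulrA.
have iG : ((\int[palm l.+1 x]_Y (G Y)%:E) * (rho x)%:E <=
    (2 / t%:R ^+ m * A1 + 2 * t%:R ^+ K * (l.+1%:R * (A4 / t%:R ^+ (K + m) * kappa l.+1)))%:E)%E.
  apply: scaled_leD => //.
  - exact: measurable_funM.
  - by apply: measurable_funM => //; exact: measurable_sum.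
  - by move=> Y; exact: mulr_ge0.
  - by move=> Y; exact: mulr_ge0.
  - by apply: scaled_leZ => //; exact: h1.
  apply: scaled_leZ => //; first exact: measurable_sum.
  apply: scaled_le_sum => // i; apply: le_trans (hb i Wx) _.
  rewrite lee_fin; apply: ler_pM => //.
  by have /andP[] := phi01 (a l.+1 * t%:R) (mulr_ge0 (ltW al0) (ltW t0)).
have i2 : ((\int[palm l.+1 x]_Y (t%:R ^+ K)%:E) * (rho x)%:E <= (t%:R ^+ K * rho x)%:E)%E.
  by rewrite integral_cst// prob_kernel mule1.
have g1 Y : (`|pprod (windowed xi n) ks x Y|%:E <= (\sum_i zscore xi n (tnth x i) Y ^+ K)%:E)%E.
  rewrite lee_fin.
  have [z zi [i zE le]] := max_le_sum K (isT : (1 <= l.+1)%N) (fun i => zscore_ge1 xi n (tnth x i) Y).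
  apply: le_trans le; rewrite -kK; apply: pprod_windowed_le => //.
  by rewrite zE zscore_ge1.
have g2 Y : (`|pprod (truncated xi t n) ks x Y|%:E <= (t%:R ^+ K)%:E)%E.
  by rewrite lee_fin -kK; exact: pprod_truncated_le.
have g3 Y : (`|pprod (windowed xi n) ks x Y - pprod (truncated xi t n) ks x Y|%:E <= (G Y)%:E)%E.
  by rewrite lee_fin /G -kK; exact: truncation_dist.
have mG' : measurable_fun setT (fun Y => (G Y)%:E) by exact/measurable_EFinP.
have [a' [b' [ea eb le]]] := scaled_integral_dist
  (mx _ (measurable_windowed xiS n)) (mx _ (measurable_truncated xiS t n))
  (measurable_zscore_sum xiS n x K) (measurable_cst _) mG' (rho0 x) g1 g2 g3 (h2 Wx) i2 iG.
exists a', b'; split => //; apply: le_trans le _.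
rewrite le_eqVlt; apply/orP; left; apply/eqP; rewrite /D exprD; field.
by rewrite !expf_neq0 ?gt_eqF.
Qed.

End stabilization.

(** * Exponential bounds for the mixing error *)

Section exponential_errors.
Context {R : realType}.
Variables (d : nat) (a : R) (e0 : nat).
Hypotheses (a01 : 0 <= a < 1) (e0a : 1 <= e0%:R * (1 - a)).

(** The volume contributes [t ^+ d] and the factorial series the power [e0]; the successor makes [e]
    positive by definition. *)
Let e := (d * e0).+1.

Let power_le p (B : R) : 0 <= B -> exists2 c : R, 0 <= c &
  forall t : R, 1 <= t -> (2 * (2 * B * near_volume d p t)) ^+ e0 <= c * t ^+ e.
Proof.
move=> B0; exists ((2 * (2 * B * (p%:R * 2 ^+ d))) ^+ e0).
  by rewrite exprn_ge0// !mulr_ge0// exprn_ge0.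
move=> t t1; rewrite /near_volume.
have -> : 2 * (2 * B * (p%:R * (2 * t) ^+ d)) = 2 * (2 * B * (p%:R * 2 ^+ d)) * t ^+ d.
  by rewrite exprMn; ring.
rewrite [leLHS]exprMn ler_wpM2l ?exprn_ge0 ?mulr_ge0 ?exprn_ge0//.
by rewrite -exprM ler_weXn2l.
Qed.

(** As all decay constants [c_k] are 1, the factor [phi (s - 2 * t)] is common to all orders. The
    remaining double series splits into two factorial series at [2 * B * V], where 2 comes from the
    Moebius coefficients, [B] from the growth of [C] and [V] from the volume. *)
Lemma mixing_error_exp p q K1 K2 (phi : R -> R) C : (forall s, 0 <= s -> 0 <= phi s <= 1) ->
  fact_growth a (fun k => `|C k|) ->
  exists A c : R, [/\ 0 <= A, 0 <= c & forall (t : nat) s, (1 <= t)%N -> 2 * t%:R < s ->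
    (mixing_error d p q t%:R (fun l => 2 ^+ l * t%:R ^+ K1)%R (fun l => 2 ^+ l * t%:R ^+ K2)%R
       phi (fun=> 1%R) C s <=
     (A * t%:R ^+ (K1 + K2) * expR (c * t%:R ^+ e) * phi (s - 2 * t%:R))%:E)%E].
Proof.
move=> phi01 /(fact_growth_split p q a01)[A [B [A0 B1 hC]]].
have B0 : 0 <= B by rewrite (le_trans ler01).
have [c1 c10 h1] := power_le p B0; have [c2 c20 h2] := power_le q B0.
exists (A * 4), (c1 + c2); split => [||t s t1 st]; rewrite ?mulr_ge0 ?addr_ge0//.
have tr1 : 1 <= t%:R :> R by rewrite ler1n.
have tr0 : 0 <= t%:R :> R by [].
have /andP[p0 _] : 0 <= phi (s - 2 * t%:R) <= 1 by apply: phi01; rewrite subr_ge0 ltW.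
pose V1 : R := near_volume d p t%:R; pose V2 : R := near_volume d q t%:R.
have V10 : 0 <= V1 by apply: near_volume_ge0.
have V20 : 0 <= V2 by apply: near_volume_ge0.
pose w1 := 2 * B * V1; pose w2 := 2 * B * V2.
have w10 : 0 <= w1 by rewrite !mulr_ge0.
have w20 : 0 <= w2 by rewrite !mulr_ge0.
pose F := t%:R ^+ (K1 + K2) * A * phi (s - 2 * t%:R).
have F0 : 0 <= F by rewrite !mulr_ge0 ?exprn_ge0.
pose u (w : R) l := l`!%:R^-1 * ((l`!%:R `^ a) * w ^+ l).
have u0 w l : 0 <= w -> 0 <= u w l.
  by move=> w0; rewrite !mulr_ge0 ?invr_ge0 ?powR_ge0 ?exprn_ge0.
apply: (@le_trans _ _ (\sum_(l1 <oo) \sum_(l2 <oo) (F%:E * (u w1 l1)%:E * (u w2 l2)%:E))%E).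
  rewrite /mixing_error -/V1 -/V2; apply: lee_nneseries => [l1 _ _|l1 _].
    apply: nneseries_ge0 => l2 _ _; rewrite lee_fin mul1r.
    by rewrite !mulr_ge0 ?invr_ge0 ?exprn_ge0.
  apply: lee_nneseries => [l2 _ _|l2 _].
    by rewrite lee_fin mul1r !mulr_ge0 ?invr_ge0 ?exprn_ge0.
  rewrite -!EFinM lee_fin mul1r.
  have -> : F * u w1 l1 * u w2 l2 = l1`!%:R^-1 * l2`!%:R^-1 *
     (2 ^+ l1 * t%:R ^+ K1 * (2 ^+ l2 * t%:R ^+ K2) * (V1 ^+ l1 * V2 ^+ l2) *
       (A * (B ^+ l1 * (l1`!%:R `^ a)) * (B ^+ l2 * (l2`!%:R `^ a)) * phi (s - 2 * t%:R))).
    by rewrite /F /u /w1 /w2 !exprMn exprD; ring.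
  rewrite ler_wpM2l ?mulr_ge0 ?invr_ge0// ler_wpM2l ?mulr_ge0 ?exprn_ge0//.
  by rewrite ler_wpM2r.
rewrite (eq_eseriesr (g := fun l1 => (F%:E * (\sum_(l2 <oo) (u w2 l2)%:E) * (u w1 l1)%:E)%E)); last first.
  move=> l1 _; rewrite muleAC ge0_nneseriesZl//; last by move=> l2; rewrite lee_fin u0.
  by rewrite lee_fin mulr_ge0// u0.
have S20 : (0 <= \sum_(l2 <oo) (u w2 l2)%:E)%E by apply: nneseries_ge0 => l _ _; rewrite lee_fin u0.
have S10 : (0 <= \sum_(l2 <oo) (u w1 l2)%:E)%E by apply: nneseries_ge0 => l _ _; rewrite lee_fin u0.
rewrite -ge0_nneseriesZl; last 2 first.
- by rewrite mule_ge0.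
- by move=> l; rewrite lee_fin u0.
have S1 := fact_series_le a01 e0a w10; have S2 := fact_series_le a01 e0a w20.
apply: (@le_trans _ _ (F%:E * (2 * expR ((2 * w2) ^+ e0))%:E * (2 * expR ((2 * w1) ^+ e0))%:E)%E).
  apply: lee_pmul => //; first by rewrite mule_ge0.
  by apply: lee_pmul.
rewrite -!EFinM lee_fin.
have -> : F * (2 * expR ((2 * w2) ^+ e0)) * (2 * expR ((2 * w1) ^+ e0)) =
    A * 4 * t%:R ^+ (K1 + K2) * expR ((2 * w1) ^+ e0 + (2 * w2) ^+ e0) * phi (s - 2 * t%:R).
  by rewrite /F expRD; ring.
rewrite ler_wpM2r// ler_wpM2l ?mulr_ge0 ?exprn_ge0// ler_expR (mulrDl c1).
by apply: lerD; [exact: h1|exact: h2].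
Qed.

Lemma family_bound_fin p K (kappa : nat -> R) t : (forall k, 0 <= kappa k) ->
  fact_growth a kappa -> (family_bound d kappa p t%:R (fun l => (2 ^+ l * t%:R ^+ K)%R) < +oo)%E.
Proof.
move=> kappa0 /(fact_growth_shift p a01)[A [B [A0 B1 h]]].
have B0 : 0 <= B by rewrite (le_trans ler01).
pose V : R := near_volume d p t%:R.
have V0 : 0 <= V by exact: near_volume_ge0.
pose w := 2 * B * V.
have w0 : 0 <= w by rewrite !mulr_ge0.
apply: (@le_lt_trans _ _ ((t%:R ^+ K * A)%:E * \sum_(l <oo) (l`!%:R^-1 * ((l`!%:R `^ a) * w ^+ l))%:E)%E).
  rewrite ge0_nneseriesZl; last 2 first.
  - by rewrite lee_fin mulr_ge0 ?exprn_ge0.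
  - by move=> l; rewrite lee_fin !mulr_ge0 ?invr_ge0 ?powR_ge0 ?exprn_ge0.
  apply: lee_nneseries => [l _ _|l _].
    by rewrite lee_fin !mulr_ge0 ?invr_ge0 ?exprn_ge0.
  rewrite -EFinM lee_fin.
  have -> : t%:R ^+ K * A * (l`!%:R^-1 * ((l`!%:R `^ a) * w ^+ l)) =
     l`!%:R^-1 * (2 ^+ l * t%:R ^+ K * (A * B ^+ l * (l`!%:R `^ a)) * V ^+ l).
    by rewrite /w !exprMn; ring.
  rewrite ler_wpM2l ?invr_ge0// ler_wpM2r ?exprn_ge0// ler_wpM2l ?mulr_ge0 ?exprn_ge0//.
have S := fact_series_le a01 e0a w0.
apply: (@le_lt_trans _ _ ((t%:R ^+ K * A)%:E * (2 * expR ((2 * w) ^+ e0))%:E)%E).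
  by rewrite lee_wpmul2l// lee_fin mulr_ge0 ?exprn_ge0.
by rewrite -EFinM ltry.
Qed.

End exponential_errors.

(** The difference of products is split as [(b1 - b1') * b2' + b1 * (b2 - b2')], and [b2'] is at
    most [W + D] because [u <= 1]. *)
Lemma truncation_product {R : realType} (a a' b1 b1' b2 b2' D E W u : R) :
  0 <= D -> 0 <= W -> 0 <= u <= 1 -> `|a - a'| <= D * u -> `|b1 - b1'| <= D * u ->
  `|b2 - b2'| <= D * u -> `|b1| <= W -> `|b2| <= W -> `|a' - b1' * b2'| <= E * u ->
  `|a - b1 * b2| <= (D + E + D * (2 * W + D)) * u.
Proof.
move=> D0 W0 /andP[u0 u1] ha h1 h2 w1 w2 h.
have Du : D * u <= D by rewrite ler_piMr.
have w2' : `|b2'| <= W + D.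
  have -> : b2' = b2 - (b2 - b2') by ring.
  by apply: le_trans (ler_normB _ _) _; rewrite lerD// (le_trans h2).
have -> : a - b1 * b2 = (a - a') + (a' - b1' * b2') - ((b1 - b1') * b2' + b1 * (b2 - b2')) by ring.
have e1 : `|(b1 - b1') * b2'| <= D * u * (W + D) by rewrite normrM ler_pM.
have e2 : `|b1 * (b2 - b2')| <= W * (D * u) by rewrite normrM ler_pM.
have := ler_normB ((a - a') + (a' - b1' * b2')) ((b1 - b1') * b2' + b1 * (b2 - b2')).
have := ler_normD (a - a') (a' - b1' * b2').
have := ler_normD ((b1 - b1') * b2') (b1 * (b2 - b2')).
move=> t1 t2 t3; apply: (le_trans t3).
have -> : (D + E + D * (2 * W + D)) * u = (D * u + E * u) + (D * u * (W + D) + W * (D * u)) by ring.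
by apply: lerD; [exact: le_trans t2 (lerD ha h)|exact: le_trans t1 (lerD e1 e2)].
Qed.

Lemma half_facts {R : realType} (s t s0 : R) : 4 <= t -> 4 * t <= s -> 2 * s0 <= t ->
  [/\ 2 * t < s, s0 <= s / 2, 0 <= s / 2 & s / 2 <= s - 2 * t].
Proof. by move=> h1 h2 h3; split; lra. Qed.

Section class_A2_mixing.
Context {dd : measure_display} {Omega : measurableType dd} {R : realType}.
Variables (P : probability Omega R) (d : nat) (X : {RV P >-> lfset R d})
  (rho : forall k, k.-tuple (pt R d) -> R)
  (palm : forall k, R.-pker (k.-tuple (pt R d)) ~> lfset R d)
  (xi : pt R d -> lfset R d -> R).
Hypothesis corr : forall k, (1 <= k)%N -> correlation_function X (@rho k).
Hypothesis palmP : forall k, (1 <= k)%N -> palm_version X (palm k).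
Hypothesis xiS : score_function xi.
Hypothesis moments : forall p : R, 1 < p -> moment_condition X palm xi p.
Variable lam : R.
Hypothesis lam0 : 0 <= lam.
Hypothesis rho1 : {ae lebk R d 1, forall x, rho x = lam}.

(** For separation [s] the radius [t] is the integer part of the [N]-th root of [s]. A truncation
    error of order t^(-Nm) is then of order s^(-m), and the exponential in [t ^+ e] loses against
    the decay of [phi]. *)
Lemma class_A2_poly_mixing : class_A2 X rho palm xi -> poly_mixing rho palm xi.
Proof.
move=> [[phi [C [decay [a a01 CO] [b b0 ld]]]] stab _] p q K1 K2 m p1 q1.
have pq1 : (1 <= p + q)%N by rewrite addn_gt0 p1.
have [[phi01 phi_ni _] _ _] := decay.
pose kappa := correlation_bound lam C.
have kappa0 k : 0 <= kappa k by exact: correlation_bound_ge0.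
have rho_le := correlation_le lam0 corr rho1 decay.
have gC := bigO_fact_growth a01 CO.
have gk := correlation_bound_growth lam0 a01 gC.
have [W W0 hW] := windowed_bounded_triple corr palmP kappa0 rho_le xiS moments K1 K2 p1 q1.
have [a0 a1] := andP a01.
have a1' : 0 < 1 - a by rewrite subr_gt0.
pose e0 := (Num.truncn (1 - a)^-1).+1.
have e0a : 1 <= e0%:R * (1 - a).
  by rewrite -ler_pdivrMr// mul1r ltW// truncnS_gt.
pose e := (d * e0).+1.
have [Am [cm [Am0 cm0 hmix]]] := mixing_error_exp d a01 e0a p q K1 K2 phi01 gC.
have [eps eps0 [s0 s01 hphi]] := log_decay_exp b0 ld.
(* As [N * b >= e.+1], the bound on [phi] at [s / 2] decays like an exponential in [t ^+ e.+1]; as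
   [N >= 2], also [4 * t <= t ^+ N <= s] for [t >= 4]. *)
pose N := (Num.truncn (e.+1%:R / b)).+2.
have Nb : e.+1%:R <= N%:R * b.
  rewrite -ler_pdivrMr//; apply: le_trans (ltW (truncnS_gt _)) _.
  by rewrite ler_nat.
(* The argument [s - 2 * t] of [phi] is only known to be at least [s / 2]. *)
pose eps' := eps * (2^-1 `^ b).
have eps'0 : 0 < eps' by rewrite mulr_gt0// powR_gt0.
(* [K1 + K2] is the power of [t] due to clipping, [N * m] the power to be gained. *)
have [Ae Ae0 hexp] := exp_dominated (K1 + K2 + N * m) (isT : (1 <= e)%N) cm0 eps'0.
have [D1 D10 hD1] := truncation_error corr palmP kappa0 rho_le xiS moments (K1 + K2) (N * m) pq1 stab.
have [D2 D20 hD2] := truncation_error corr palmP kappa0 rho_le xiS moments K1 (N * m) p1 stab.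
have [D3 D30 hD3] := truncation_error corr palmP kappa0 rho_le xiS moments K2 (N * m) q1 stab.
pose D := D1 + D2 + D3.
have D0 : 0 <= D by rewrite !addr_ge0.
(* At least 4 and at least [2 * s0], so that [half_facts] applies to [t >= n0]; separations below
   [n0 ^+ N] are left to the trivial bound [A1]. *)
pose n0 := (Num.truncn (2 * s0)).+4.
pose E := 4 * (Am * Ae).
have E0 : 0 <= E by rewrite !mulr_ge0.
pose A1 := (W + W * W) * (1 + n0%:R ^+ N) ^+ m.
have A10 : 0 <= A1.
  by apply: mulr_ge0; rewrite ?exprn_ge0 ?addr_ge0 ?exprn_ge0// mulr_ge0.
pose A2 := (D + E + D * (2 * W + D)) * 4 ^+ (N * m).
have A20 : 0 <= A2.
  by rewrite mulr_ge0 ?exprn_ge0// !addr_ge0// mulr_ge0// addr_ge0// mulr_ge0.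
exists (A1 + A2); first exact: addr_ge0.
move=> n ks nn k1 k1E k2E.
have k11 i : (1 <= tnth (tfst ks) i)%N by rewrite tnth_mktuple.
have k12 i : (1 <= tnth (tsnd ks) i)%N by rewrite tnth_mktuple.
have kE : (\sum_(i < p + q) tnth ks i)%N = (K1 + K2)%N.
  rewrite big_split_ord /= -k1E -k2E; congr (_ + _)%N; apply: eq_bigr => i _;
  by rewrite tnth_mktuple.
(* The radius will be chosen as a function of [z], so the estimate is first secured for all [t]
   outside one null set. *)
pose Q (t : nat) (z : (p + q).-tuple (pt R d)) := (1 <= t)%N -> uniq z ->
  2 * t%:R < sep z -> forall err : R,
  (mixing_error d p q t%:R (fun l => 2 ^+ l * t%:R ^+ K1)%R (fun l => 2 ^+ l * t%:R ^+ K2)%R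
     phi (fun=> 1%R) C (sep z) <= err%:E)%E ->
  exists a a' b1 b1' b2 b2' : R,
  [/\ palm_mean rho palm (pprod (windowed xi n) ks) z = a%:E,
      palm_mean rho palm (pprod (windowed xi n) (tfst ks)) (tfst z) = b1%:E,
      palm_mean rho palm (pprod (windowed xi n) (tsnd ks)) (tsnd z) = b2%:E &
      [/\ `|a - a'| <= D1 / t%:R ^+ (N * m), `|b1 - b1'| <= D2 / t%:R ^+ (N * m),
          `|b2 - b2'| <= D3 / t%:R ^+ (N * m) & `|a' - b1' * b2'| <= 4 * err]].
have aeQ : {ae lebk R d (p + q), forall z, forall t, Q t z}.
  apply: ae_foralln => t; have [t1|t1] := leqP 1 t; last first.
    by apply: aeW => z; rewrite /Q leqNgt t1.
  have l1 := truncated_local xiS n t1 k11; have l2 := truncated_local xiS n t1 k12.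
  rewrite k1E in l1; rewrite k2E in l2.
  have fin p' K := family_bound_fin d a01 e0a p' K t kappa0 gk.
  have t0 : 0 <= t%:R :> R by [].
  have mix := functional_mixing corr palmP kappa0 rho_le decay p1 q1 t0 l1 l2 (fin p K1) (fin q K2).
  have := ae_and mix (ae_and (hD1 t n ks t1 nn k1 kE)
    (ae_and (ae_tfst q (hD2 t n (tfst ks) t1 nn k11 k1E)) (ae_tsnd p (hD3 t n (tsnd ks) t1 nn k12 k2E)))).
  apply: ae_sub => z [hmixz [[x [x' [ex ex' dx]]] [[y [y' [ey ey' dy]]] [v [v' [ev ev' dv]]]]]].
  move=> _ uz st err herr.
  have [x'' [y'' [v'' []]]] := hmixz uz st err herr.
  rewrite ey' ev' (_ : palm_mean _ _ _ z = palm_mean rho palm (pprod (truncated xi t n) ks) z); last first.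
    by congr (_ * _)%E; apply: eq_integral => Y _; rewrite -pprod_split.
  rewrite ex' => -[<-] [<-] [<-] le.
  by exists x, x', y, y', v, v'.
have := ae_and (hW n ks nn k1 k1E k2E) aeQ.
apply: ae_sub => z [[x [y [v [ex ey ev [hx hy hv]]]]] hQ] uz.
exists x, y, v; split => //.
have sz0 : 0 <= sep z by exact: sep_ge0.
have S1 : 0 < (1 + sep z) ^+ m by rewrite exprn_gt0// ltr_wpDr.
rewrite ler_pdivlMr//.
have [small|large] := ltP (sep z) (n0%:R ^+ N).
  apply: (@le_trans _ _ A1); last by rewrite lerDl.
  apply: ler_pM => //; first exact: ltW.
    apply: le_trans (ler_normB _ _) _; rewrite normrM lerD//.
    by rewrite ler_pM.
  by rewrite lerXn2r ?nnegrE ?addr_ge0 ?exprn_ge0// lerD2l ltW.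
have n01 : 1 <= n0%:R ^+ N :> R by rewrite exprn_ege1// ler1n.
have [t [t1 tN Nt]] := nat_root (isT : (1 <= N)%N) (le_trans n01 large).
have n0t : (n0 <= t)%N.
  have := le_lt_trans large Nt; rewrite ltr_pXn2r ?nnegrE//.
  by rewrite ltr_nat ltnS.
have t0 : 0 < t%:R :> R by rewrite ltr0n.
have tr1 : 1 <= t%:R :> R by rewrite ler1n.
have t4 : 4 <= t%:R :> R by rewrite ler_nat (leq_trans _ n0t).
have ts : 4 * t%:R <= sep z.
  apply: le_trans tN; apply: (@le_trans _ _ (t%:R ^+ 2)); first by rewrite expr2 ler_wpM2r.
  by apply: ler_weXn2l.
have s0t : 2 * s0 <= t%:R.
  apply: (@le_trans _ _ n0%:R); last by rewrite ler_nat.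
  by apply: le_trans (ltW (truncnS_gt _)) _; rewrite ler_nat /n0 ltnS -addn3 leq_addr.
have [st half half0 half_le] := half_facts t4 ts s0t.
pose u : R := (t%:R ^+ (N * m))^-1.
have u0 : 0 <= u by rewrite invr_ge0 exprn_ge0.
have u1 : u <= 1 by rewrite invf_le1 ?exprn_gt0// exprn_ege1.
have mixu : (mixing_error d p q t%:R (fun l => 2 ^+ l * t%:R ^+ K1)%R (fun l => 2 ^+ l * t%:R ^+ K2)%R
     phi (fun=> 1%R) C (sep z) <= (Am * Ae * u)%:E)%E.
  apply: le_trans (hmix t (sep z) t1 st) _; rewrite lee_fin.
  have phile : phi (sep z - 2 * t%:R) <= expR (- (eps' * t%:R ^+ e.+1)).
    apply: (@le_trans _ _ (phi (sep z / 2))); first exact: phi_ni.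
    apply: le_trans (hphi _ half) _; rewrite ler_expR mulNr lerN2 /eps' -mulrA.
    apply: ler_wpM2l; first exact: ltW.
    rewrite [leRHS]powRM ?invr_ge0// [leRHS]mulrC ler_wpM2l ?powR_ge0//.
    apply: (@le_trans _ _ ((t%:R ^+ N) `^ b)); last by apply: ge0_ler_powR; rewrite ?nnegrE ?exprn_ge0// ltW.
    by rewrite -!powR_mulrn// -powRrM ler_powR.
  apply: (@le_trans _ _ (Am * t%:R ^+ (K1 + K2) * expR (cm * t%:R ^+ e) * expR (- (eps' * t%:R ^+ e.+1)))).
    by rewrite ler_wpM2l// !mulr_ge0 ?exprn_ge0 ?expR_ge0.
  rewrite -!mulrA -expRD ler_wpM2l// ler_pdivlMr ?exprn_gt0//.
  rewrite mulrAC -exprD [eps * _]mulrA; exact: hexp.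
have [x1 [x' [y1 [y' [v1 [v' [ex1 ey1 ev1 [dx dy dv dm]]]]]]]] := hQ t t1 uz st _ mixu.
move: ex1 ey1 ev1; rewrite ex ey ev => -[xE] [yE] [vE]; rewrite -xE -yE -vE in dx dy dv *.
have le3 Di : Di <= D -> forall r : R, r <= Di / t%:R ^+ (N * m) -> r <= D * u.
  by move=> DD r /le_trans; apply; rewrite ler_wpM2r.
have {}dx := le3 D1 _ _ dx; have {}dy := le3 D2 _ _ dy; have {}dv := le3 D3 _ _ dv.
have le : `|x - y * v| <= (D + E + D * (2 * W + D)) * u.
  apply: (truncation_product D0 W0 _ (dx _) (dy _) (dv _) hy hv); rewrite /D ?u0 ?u1//.
  - by rewrite -addrA lerDl addr_ge0.
  - by rewrite addrAC lerDr addr_ge0.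
  - by rewrite lerDr addr_ge0.
  - by apply: le_trans dm _; rewrite /E !mulrA.
apply: (@le_trans _ _ A2); last by rewrite lerDr.
apply: (@le_trans _ _ ((D + E + D * (2 * W + D)) * u * (4 * t%:R) ^+ (N * m))); last first.
  rewrite /A2 -mulrA ler_wpM2l//; first by rewrite !addr_ge0// mulr_ge0// addr_ge0// mulr_ge0.
  by rewrite exprMn mulrCA /u mulVf ?mulr1// expf_neq0// gt_eqF.
apply: ler_pM => //; first exact: ltW.
(* What is left is [1 + s <= (4 * t) ^+ N]: the left side is at most twice (t+1)^N, and t+1 is at
   most [2 * t]. *)
rewrite exprM lerXn2r ?nnegrE ?addr_ge0 ?exprn_ge0 ?mulr_ge0//.
apply: (@le_trans _ _ (t.+1%:R ^+ N + t.+1%:R ^+ N)).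
  by rewrite lerD ?(ltW Nt)// exprn_ege1// ler1n.
rewrite -mulr2n -[_ *+ 2]mulr_natl; apply: (@le_trans _ _ (2 ^+ N * (2 * t%:R) ^+ N)).
  apply: ler_pM; rewrite ?exprn_ge0//; first by rewrite -[leLHS]expr1 ler_weXn2l// ler1n.
  rewrite lerXn2r ?nnegrE ?mulr_ge0// -natr1; lra.
have -> : 4 * t%:R = 2 * (2 * t%:R) :> R by ring.
by rewrite [leRHS]exprMn.
Qed.

End class_A2_mixing.

(** * The fast decreasing function *)

(* Bounds by [A K m (1 + s)^-m] for all [m] yield a single decreasing function,
   the infimum over [j] of [D_j (1 + s)^-j]: taking [D_j >= A K j] for [K <= j]
   leaves finitely many [j] for each [K], absorbed by the constant. *)
Section envelope.
Context {R : realType}.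
Variable A : nat -> nat -> R.
Hypothesis A0 : forall K m, 0 <= A K m.

(** [D 0 = 1] keeps the infimum at most 1. All [D j] are at least 1, which settles the indices
    [j <= K] once the constant dominates [A K j]. *)
Let D j : R := if j is 0%N then 1 else 1 + \sum_(K < j.+1) A K j.

Let D1 j : 1 <= D j.
Proof. by case: j => // j; rewrite lerDl sumr_ge0. Qed.

Let D0 j : 0 <= D j. Proof. exact: le_trans (D1 j). Qed.

Let values (s : R) : set R := [set D j / (1 + s) ^+ j | j in [set: nat]].

Definition envelope (s : R) : R := inf (values s).

Definition envelope_constant K : R := 1 + \sum_(m < K.+1) A K m.

Let lb0 s : 0 <= s -> lbound (values s) 0.
Proof. by move=> s0 _ [j _ <-]; rewrite divr_ge0 ?exprn_ge0 ?addr_ge0. Qed.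

Let envelope_le s j : 0 <= s -> envelope s <= D j / (1 + s) ^+ j.
Proof. by move=> s0; apply: ge_inf; [exists 0; exact: lb0|exists j]. Qed.

Let le_envelope s x : (forall j, x <= D j / (1 + s) ^+ j) -> x <= envelope s.
Proof.
move=> h; apply: lb_le_inf; first by exists (D 0 / (1 + s) ^+ 0), 0%N.
by move=> _ [j _ <-].
Qed.

Let envelope_ge0 s : 0 <= s -> 0 <= envelope s.
Proof. by move=> s0; apply: le_envelope => j; rewrite divr_ge0 ?exprn_ge0 ?addr_ge0. Qed.

Lemma fast_decreasing_envelope : fast_decreasing envelope.
Proof.
split=> [t t0|s t s0 st|m _].
- by rewrite envelope_ge0//= (le_trans (envelope_le 0 t0))// expr0 divr1.
- apply: le_envelope => j; apply: le_trans (envelope_le j (le_trans s0 st)) _.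
  rewrite ler_wpM2l// lef_pV2 ?posrE ?exprn_gt0 ?ltr_wpDr ?(le_trans s0 st)//.
  by rewrite lerXn2r ?nnegrE ?addr_ge0 ?(le_trans s0 st)// lerD2l.
apply/cvgrPdist_le => eps eps0; exists (Num.max 0 (D m.+1 / eps)); split.
  exact: num_real.
move=> t; rewrite gt_max => /andP[t0 tD] /=; have t0' := ltW t0.
have t1 : 0 < 1 + t by rewrite ltr_wpDr.
rewrite sub0r normrN ger0_norm ?mulr_ge0 ?exprn_ge0 ?envelope_ge0//.
apply: (@le_trans _ _ ((1 + t) ^+ m * (D m.+1 / (1 + t) ^+ m.+1))).
  apply: ler_pM; rewrite ?exprn_ge0 ?envelope_ge0 ?envelope_le//.
  by rewrite lerXn2r ?nnegrE ?(ltW t1)// lerDr.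
have -> : (1 + t) ^+ m * (D m.+1 / (1 + t) ^+ m.+1) = D m.+1 / (1 + t).
  have aux (x y c : R) : x != 0 -> y != 0 -> x * (c / (x * y)) = c / y by move=> *; field; apply/andP.
  by rewrite exprSr aux ?expf_neq0// gt_eqF.
rewrite ler_pdivrMr// -ler_pdivrMl// mulrC (le_trans (ltW tD))// lerDr//.
Qed.

Lemma le_envelope_constant K s v : 0 <= s -> (forall m, v <= A K m / (1 + s) ^+ m) ->
  v <= envelope_constant K * envelope s.
Proof.
move=> s0 h; have C1 : 1 <= envelope_constant K by rewrite lerDl sumr_ge0.
have C0 : 0 < envelope_constant K by rewrite (lt_le_trans ltr01).
rewrite -ler_pdivrMl//; apply: le_envelope => j; rewrite ler_pdivrMl//.
apply: le_trans (h j) _; rewrite mulrA ler_wpM2r ?invr_ge0 ?exprn_ge0 ?addr_ge0//.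
have [jK|Kj] := leqP j K.
  apply: (@le_trans _ _ (envelope_constant K)); last by rewrite ler_peMr// ltW.
  rewrite /envelope_constant (bigD1 (Ordinal (jK : (j < K.+1)%N)))//= addrCA lerDl.
  by rewrite addr_ge0// sumr_ge0.
apply: (@le_trans _ _ (D j)); last by rewrite ler_peMl.
rewrite /D; case: j Kj {h} => // j Kj.
have Kj' : (K < j.+2)%N by rewrite ltnS ltnW.
rewrite (bigD1 (Ordinal Kj'))//= addrCA lerDl addr_ge0// sumr_ge0// => i _.
Qed.

End envelope.

(** Positive exponents force [p <= K1] and [q <= K2], so a given total [K] leaves finitely many
    [(p, q, K1, K2)], and summing their constants gives one that depends on [K] and [m] only. *)
Lemma weighted_mixing {R : realType} (d : nat) (rho : forall k, k.-tuple (pt R d) -> R)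
    (palm : forall k, R.-pker (k.-tuple (pt R d)) ~> lfset R d) (xi : pt R d -> lfset R d -> R) :
  poly_mixing rho palm xi -> exists2 A : nat -> nat -> R, (forall K m, 0 <= A K m) &
  forall n p q (ks : (p + q).-tuple nat), window_index n -> (1 <= p)%N -> (1 <= q)%N ->
    (forall i, (1 <= tnth ks i)%N) ->
    {ae lebk R d (p + q), forall x : (p + q).-tuple (pt R d), uniq x ->
      exists a b1 b2 : R,
      [/\ weighted_correlation rho palm xi n ks x = a%:E,
          weighted_correlation rho palm xi n (tfst ks) (tfst x) = b1%:E,
          weighted_correlation rho palm xi n (tsnd ks) (tsnd x) = b2%:E &
          forall m, `|a - b1 * b2| <= A (\sum_(i < p + q) tnth ks i)%N m / (1 + sep x) ^+ m]}.
Proof.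
move=> mix.
pose good p q K1 K2 m (A : R) := 0 <= A /\ ((1 <= p)%N -> (1 <= q)%N ->
  forall n (ks : (p + q).-tuple nat), window_index n -> (forall i, (1 <= tnth ks i)%N) ->
    (\sum_(i < p) tnth (tfst ks) i)%N = K1 -> (\sum_(i < q) tnth (tsnd ks) i)%N = K2 ->
    {ae lebk R d (p + q), forall z : (p + q).-tuple (pt R d), uniq z ->
      exists a b1 b2 : R,
      [/\ palm_mean rho palm (pprod (windowed xi n) ks) z = a%:E,
          palm_mean rho palm (pprod (windowed xi n) (tfst ks)) (tfst z) = b1%:E,
          palm_mean rho palm (pprod (windowed xi n) (tsnd ks)) (tsnd z) = b2%:E &
          `|a - b1 * b2| <= A / (1 + sep z) ^+ m]}).
have /choice[B hB] : forall v : nat * nat * (nat * nat) * nat, exists A,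
    good v.1.1.1 v.1.1.2 v.1.2.1 v.1.2.2 v.2 A.
  move=> [[[p q] [K1 K2]] m] /=; have [/andP[p1 q1]|npq] := boolP ((1 <= p) && (1 <= q))%N.
    by have [A A0 hA] := mix p q K1 K2 m p1 q1; exists A.
  by exists 0; split => // p1 q1; rewrite p1 q1 in npq.
have B0 v : 0 <= B v by have [] := hB v.
pose A K m := \sum_(p < K.+1) \sum_(q < K.+1) \sum_(K1 < K.+1) B (p : nat, q : nat, (K1 : nat, (K - K1)%N), m).
have A0 K m : 0 <= A K m by do 3 apply: sumr_ge0 => ? _.
exists A => // n p q ks nn p1 q1 k1.
set K := (\sum_(i < p + q) tnth ks i)%N.
pose K1 := (\sum_(i < p) tnth (tfst ks) i)%N; pose K2 := (\sum_(i < q) tnth (tsnd ks) i)%N.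
have KE : K = (K1 + K2)%N.
  rewrite /K big_split_ord; congr (_ + _)%N; apply: eq_bigr => i _;
  by rewrite tnth_mktuple.
have pK1 : (p <= K1)%N.
  rewrite -[leqLHS]card_ord -sum1_card leq_sum// => i _.
  by rewrite tnth_mktuple.
have qK2 : (q <= K2)%N.
  rewrite -[leqLHS]card_ord -sum1_card leq_sum// => i _.
  by rewrite tnth_mktuple.
have pK : (p < K.+1)%N by rewrite ltnS KE (leq_trans pK1)// leq_addr.
have qK : (q < K.+1)%N by rewrite ltnS KE (leq_trans qK2)// leq_addl.
have KK : (K1 < K.+1)%N by rewrite ltnS KE leq_addr.
have BA m : B (p, q, (K1, K2), m) <= A K m.
  rewrite /A (bigD1 (Ordinal pK))//= (bigD1 (Ordinal qK))//= (bigD1 (Ordinal KK))//=.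
  have -> : K2 = (K - K1)%N by rewrite KE addKn.
  by rewrite -!addrA lerDl !addr_ge0//; do ?apply: sumr_ge0 => ? _ //.
have gd m : good p q K1 K2 m (B (p, q, (K1, K2), m)) by exact: hB.
have := ae_foralln (fun m => proj2 (gd m) p1 q1 n ks nn k1 erefl erefl).
apply: (@filterS _ (almost_everywhere _)) => z h uz.
(* The three real values do not depend on [m]: they are taken from [m = 0] and identified with those
   of every other [m]. *)
have [a [b1 [b2 [ea eb1 eb2 _]]]] := h 0%N uz.
exists a, b1, b2; split => // m.
have [a' [b1' [b2' []]]] := h m uz.
rewrite ea eb1 eb2 => -[<-] [<-] [<-] /le_trans; apply.
by rewrite ler_wpM2r// invr_ge0 exprn_ge0// addr_ge0// sep_ge0.
Qed.

Unset Implicit Arguments.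

Theorem theorem1p11 (dd : measure_display) (Omega : measurableType dd)
    (R : realType) (P : probability Omega R) (d : nat)
    (X : {RV P >-> lfset R d})
    (rho : forall k : nat, k.-tuple (pt R d) -> R)
    (palm : forall k : nat, R.-pker (k.-tuple (pt R d)) ~> lfset R d)
    (xi : pt R d -> lfset R d -> R) :
  (2 <= d)%N ->
  admissible X rho ->
  (forall k : nat, (1 <= k)%N -> palm_version X (palm k)) ->
  score_function xi ->
  class_A1 rho xi \/ class_A2 X rho palm xi ->
  (forall p : R, 1 < p -> moment_condition X palm xi p) ->
  exists (phi : R -> R) (c C : nat -> R),
    [/\ fast_decreasing phi,
        forall k : nat, (1 <= k)%N -> 0 < c k &
        forall (n : option nat) (p q : nat) (ks : (p + q).-tuple nat),
          window_index n -> (1 <= p)%N -> (1 <= q)%N ->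
          (forall i, (1 <= tnth ks i)%N) ->
          let K := (\sum_(i < p + q) tnth ks i)%N in
          {ae lebk R d (p + q), forall x : (p + q).-tuple (pt R d), uniq x ->
            (`|weighted_correlation rho palm xi n ks x
               - weighted_correlation rho palm xi n (tfst ks) (tfst x)
                 * weighted_correlation rho palm xi n (tsnd ks) (tsnd x)|
              <= (C K * phi (c K * sep x))%:E)%E}].
Proof.
move=> _ [_ corr [lam lam0 rho1]] palmP xiS cls moments.
have mix : poly_mixing rho palm xi.
  case: cls => [A1|A2]; last exact: class_A2_poly_mixing corr palmP xiS moments lam (ltW lam0) rho1 A2.
  have [[phi [c [C decay]]] _] := A1.
  exact: class_A1_poly_mixing corr palmP _ (fun k => correlation_bound_ge0 C k (ltW lam0))
    (correlation_le (ltW lam0) corr rho1 decay) xiS moments A1.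
have [A A0 hA] := weighted_mixing mix.
(* The dependence on [K] sits entirely in the multiplicative constant, so every scale can be 1. *)
exists (envelope A), (fun=> 1), (envelope_constant A); split => //.
  exact: fast_decreasing_envelope.
move=> n p q ks nn p1 q1 k1 K; have := hA n p q ks nn p1 q1 k1.
apply: (@filterS _ (almost_everywhere _)) => x h ux.
have [a [b1 [b2 [-> -> -> le]]]] := h ux.
rewrite mul1r -EFinM -EFinB lee_fin.
exact: le_envelope_constant (sep_ge0 _) le.
Qed.
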